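(* Let $0<\alpha\le 1$ and $\cos^{-1}\frac{\alpha}{2}\le\theta<\pi$, and let $T_{\alpha,\theta}\subset\mathbb{R}^2$ be the triangle with vertices $O(0,0)$, $A(1,0)$, $B(\alpha\cos\theta,\alpha\sin\theta)$. Then for every vector field $q=\{q_1,q_2\}\in H^1(T_{\alpha,\theta})^2$, $$\|q-\Pi^F_{\alpha,\theta}q\|\le C_6(\alpha,\theta)\,|q|_1 ,$$ where $\Pi^F_{\alpha,\theta}$ is the Fortin interpolation operator and $C_6(\alpha,\theta)$ is the explicit constant, both defined in the context.
   Context: The edges of $T_{\alpha,\theta}$ are $e_1=OA$, $e_2=OB$, $e_3=AB$. $\|\cdot\|$ denotes the norm of $L_2(T_{\alpha,\theta})$ or $L_2(T_{\alpha,\theta})^2$; for scalar $v$, $|v|_1=\|\nabla v\|$, and for a vector field $q=\{q_1,q_2\}$, $|q|_1^2=|q_1|_1^2+|q_2|_1^2$. Fortin interpolation: for $q\in H^1(T_{\alpha,\theta})^2$, $\Pi^F_{\alpha,\theta}q=q_h$ is the unique vector field of the form $q_h(x)=\{\alpha_1+\alpha_3x_1,\ \alpha_2+\alpha_3x_2\}$ ($\alpha_1,\alpha_2,\alpha_3$ real constants; lowest-order Raviart–Thomas form) satisfying $\int_{e_i}(q_h-q)\cdot\vec n\,ds=0$ for $i=1,2,3$, where $\vec n$ is the unit outward normal. Constants: for $i=1,2$ put $$c_i=C_i(\alpha,\theta)=\sup\Big\{\frac{\|v\|}{|v|_1}: v\in H^1(T_{\alpha,\theta})\setminus\{0\},\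 \int_{e_i}v\,ds=0\Big\},$$ and $$C_6(\alpha,\theta)=\frac{\Big\{c_1^2+c_2^2+2c_1c_2\cos^2\theta+(c_1+c_2)\sqrt{c_1^2+c_2^2+2c_1c_2\cos 2\theta}\Big\}^{1/2}}{\sqrt2\,\sin\theta}.$$ *)

(* Defs.v *)
From HB Require Import structures.
From mathcomp Require Import all_boot all_order all_algebra.
From mathcomp Require Import all_classical all_reals all_analysis.

Set Implicit Arguments.
Unset Strict Implicit.
Unset Printing Implicit Defensive.

Import Order.TTheory GRing.Theory Num.Theory.
Import numFieldNormedType.Exports.

Local Open Scope classical_set_scope.
Local Open Scope ring_scope.

(* measurableTypeR R is R with its Borel sigma-algebra, the type on which
   lebesgue_measure is declared. *)
Definition area (R : realType) :
    {measure set (measurableTypeR R * measurableTypeR R) -> \bar R} :=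
  (@lebesgue_measure R \x @lebesgue_measure R)%E.

(* Elements of L_2 and H^1 are represented by Borel functions on the whole
   plane; values outside the domain U play no role. *)

Definition inL2 (R : realType) (U : set (R * R)) (v : R * R -> R) : Prop :=
  measurable_fun U v /\
  (@area R).-integrable U (EFin \o (fun x => v x ^+ 2)).

Definition L2norm (R : realType) (U : set (R * R)) (v : R * R -> R) : R :=
  Num.sqrt (\int[@area R]_(x in U) (v x ^+ 2)).

Definition dx (R : realType) : R * R := (1, 0).
Definition dy (R : realType) : R * R := (0, 1).

Fixpoint Ck (R : realType) (k : nat) (f : R * R -> R) : Prop :=
  continuous f /\
  if k is k'.+1 then
    [/\ forall x, derivable f x (dx R), forall x, derivable f x (dy R),
        Ck k' (fun x => 'D_(dx R) f x) & Ck k' (fun x => 'D_(dy R) f x)]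
  else True.

Definition smooth (R : realType) (f : R * R -> R) : Prop :=
  forall k, Ck k f.

Definition test_fun (R : realType) (U : set (R * R)) (f : R * R -> R) : Prop :=
  [/\ smooth f, compact (closure [set x | f x != 0])
    & closure [set x | f x != 0] `<=` U].

Definition is_weak_deriv (R : realType) (U : set (R * R)) (e : R * R)
    (v g : R * R -> R) : Prop :=
  inL2 U g /\
  forall f, test_fun U f ->
    \int[@area R]_(x in U) (v x * 'D_e f x)
    = - \int[@area R]_(x in U) (g x * f x).

Definition inH1 (R : realType) (U : set (R * R)) (v : R * R -> R) : Prop :=
  [/\ inL2 U v, exists g, is_weak_deriv U (dx R) v g
    & exists g, is_weak_deriv U (dy R) v g].

(* A representative of the weak derivative, which is unique a.e. *)
Definition weak_deriv (R : realType) (U : set (R * R)) (e : R * R)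
    (v : R * R -> R) : R * R -> R :=
  xget (fun=> 0) [set g | is_weak_deriv U e v g].

Definition H1semi (R : realType) (U : set (R * R)) (v : R * R -> R) : R :=
  Num.sqrt (L2norm U (weak_deriv U (dx R) v) ^+ 2
            + L2norm U (weak_deriv U (dy R) v) ^+ 2).

(* An edge is an ordered pair of endpoints. *)

Definition edge_length (R : realType) (e : (R * R) * (R * R)) : R :=
  Num.sqrt ((e.2.1 - e.1.1) ^+ 2 + (e.2.2 - e.1.2) ^+ 2).

Definition edge_point (R : realType) (e : (R * R) * (R * R)) (t : R) : R * R :=
  (e.1.1 + t * (e.2.1 - e.1.1), e.1.2 + t * (e.2.2 - e.1.2)).

Definition line_integral (R : realType) (e : (R * R) * (R * R))
    (w : R * R -> R) : R :=
  edge_length e * \int[@lebesgue_measure R]_(t in `[0, 1]) w (edge_point e t).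

Definition inL2_edge (R : realType) (e : (R * R) * (R * R))
    (w : R * R -> R) : Prop :=
  measurable_fun (`[0, 1] : set R) (w \o edge_point e) /\
  (@lebesgue_measure R).-integrable `[0, 1]
    (EFin \o (fun t => w (edge_point e t) ^+ 2)).

Definition L2norm_edge (R : realType) (e : (R * R) * (R * R))
    (w : R * R -> R) : R :=
  Num.sqrt (line_integral e (fun x => w x ^+ 2)).

(* w is the trace of v on e: the L_2(e)-limit of the restrictions to e of
   functions smooth up to the boundary of U that tend to v in H^1(U). *)
Definition is_trace (R : realType) (U : set (R * R)) (e : (R * R) * (R * R))
    (v w : R * R -> R) : Prop :=
  inL2_edge e w /\
  exists f : nat -> R * R -> R,
    [/\ forall n, smooth (f n),
        L2norm U (fun x => f n x - v x) @[n --> \oo] --> (0 : R),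
        L2norm U (fun x => 'D_(dx R) (f n) x - weak_deriv U (dx R) v x)
          @[n --> \oo] --> (0 : R),
        L2norm U (fun x => 'D_(dy R) (f n) x - weak_deriv U (dy R) v x)
          @[n --> \oo] --> (0 : R)
      & L2norm_edge e (fun x => f n x - w x) @[n --> \oo] --> (0 : R)].

Definition trace (R : realType) (U : set (R * R)) (e : (R * R) * (R * R))
    (v : R * R -> R) : R * R -> R :=
  xget (fun=> 0) [set w | is_trace U e v w].

Definition edge_integral (R : realType) (U : set (R * R))
    (e : (R * R) * (R * R)) (v : R * R -> R) : R :=
  line_integral e (trace U e v).

Definition vtxO (R : realType) : R * R := (0, 0).
Definition vtxA (R : realType) : R * R := (1, 0).
Definition vtxB (R : realType) (alpha theta : R) : R * R :=
  (alpha * cos theta, alpha * sin theta).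

(* The open triangle: strictly convex combinations of O, A and B. *)
Definition triangle (R : realType) (alpha theta : R) : set (R * R) :=
  [set x | exists s t : R, [/\ 0 < s, 0 < t, s + t < 1
    & x = (s * (vtxA R).1 + t * (vtxB alpha theta).1,
           s * (vtxA R).2 + t * (vtxB alpha theta).2)]].

(* The edges OA, OB, AB, oriented counterclockwise (for 0 < theta < pi). *)
Definition edge1 (R : realType) : (R * R) * (R * R) := (vtxO R, vtxA R).
Definition edge2 (R : realType) (alpha theta : R) : (R * R) * (R * R) :=
  (vtxB alpha theta, vtxO R).
Definition edge3 (R : realType) (alpha theta : R) : (R * R) * (R * R) :=
  (vtxA R, vtxB alpha theta).

(* The unit tangent rotated by - pi / 2; it points outward since the edges are
   oriented counterclockwise. *)
Definition edge_normal (R : realType) (e : (R * R) * (R * R)) : R * R :=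
  ((e.2.2 - e.1.2) / edge_length e, - (e.2.1 - e.1.1) / edge_length e).

Definition dot (R : realType) (a b : R * R) : R := a.1 * b.1 + a.2 * b.2.

Definition inH1v (R : realType) (U : set (R * R)) (q : R * R -> R * R) : Prop :=
  inH1 U (fst \o q) /\ inH1 U (snd \o q).

Definition L2normv (R : realType) (U : set (R * R)) (q : R * R -> R * R) : R :=
  Num.sqrt (L2norm U (fst \o q) ^+ 2 + L2norm U (snd \o q) ^+ 2).

Definition H1semiv (R : realType) (U : set (R * R)) (q : R * R -> R * R) : R :=
  Num.sqrt (H1semi U (fst \o q) ^+ 2 + H1semi U (snd \o q) ^+ 2).

Definition is_RT0 (R : realType) (qh : R * R -> R * R) : Prop :=
  exists a1 a2 a3 : R, qh = (fun x => (a1 + a3 * x.1, a2 + a3 * x.2)).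

Definition same_flux (R : realType) (U : set (R * R)) (e : (R * R) * (R * R))
    (qh q : R * R -> R * R) : Prop :=
  edge_integral U e (fun x => dot (qh x - q x) (edge_normal e)) = 0.

Definition is_fortin (R : realType) (alpha theta : R)
    (q qh : R * R -> R * R) : Prop :=
  let T := triangle alpha theta in
  [/\ is_RT0 qh, same_flux T (edge1 R) qh q,
      same_flux T (edge2 alpha theta) qh q
    & same_flux T (edge3 alpha theta) qh q].

Definition fortin (R : realType) (alpha theta : R) (q : R * R -> R * R) :
    R * R -> R * R :=
  xget (fun=> (0, 0)) [set qh | is_fortin alpha theta q qh].

Definition edge_const (R : realType) (U : set (R * R))
    (e : (R * R) * (R * R)) : R :=
  sup [set r | exists v, [/\ inH1 U v, ~ ae_eq (@area R) U v (fun=> 0),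
    edge_integral U e v = 0 & r = L2norm U v / H1semi U v]].

Definition C1 (R : realType) (alpha theta : R) : R :=
  edge_const (triangle alpha theta) (edge1 R).
Definition C2 (R : realType) (alpha theta : R) : R :=
  edge_const (triangle alpha theta) (edge2 alpha theta).

Definition C6 (R : realType) (alpha theta : R) : R :=
  let c1 := C1 alpha theta in
  let c2 := C2 alpha theta in
  Num.sqrt (c1 ^+ 2 + c2 ^+ 2 + 2 * c1 * c2 * cos theta ^+ 2
            + (c1 + c2)
              * Num.sqrt (c1 ^+ 2 + c2 ^+ 2 + 2 * c1 * c2 * cos (2 * theta)))
  / (Num.sqrt 2 * sin theta).

(* Main.v *)
Require Import Defs.
From HB Require Import structures.
From mathcomp Require Import all_boot all_order all_algebra.
From mathcomp Require Import all_classical all_reals all_analysis.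
From mathcomp Require Import measurable_realfun ring lra.

(* Let u = Pi q - q and p_i = u . n_i for the normals n_1, n_2 of the edges OA and OB. The edge
   integral of p_i over e_i vanishes, so ||p_i|| <= c_i |p_i|_1. As n_1 . n_2 = - cos theta,
   sin^2 theta ||u||^2 = ||p_1||^2 + ||p_2||^2 + 2 cos theta (p_1, p_2), and likewise for the
   gradients; with |(grad p_1, grad p_2)| <= |p_1|_1 |p_2|_1 the estimate ||u|| <= C_6 |u|_1
   becomes the positivity of a 2 x 2 quadratic form, of which C_6 sin theta is the critical
   parameter. All three fluxes of u vanish, so the integral of div u is 0; as grad (Pi q) is a
   constant multiple of the identity, this gives |u|_1 <= |q|_1.

   What this needs about H^1 of the triangle: smooth functions are dense, because averaging v over
   l x + (1 - l) supp eta, with l -> 1 and eta a test function, commutes with weak derivatives up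
   to the factor l; the divergence theorem, applied to squares times barycentric coordinates,
   bounds traces; integrating along segments inside the convex triangle gives the Poincare
   inequality. Together they make the traces and the Fortin interpolation exist and the
   suprema c_i finite, so that these are not junk values. *)

Set Implicit Arguments.
Unset Strict Implicit.
Unset Printing Implicit Defensive.

Import Order.TTheory GRing.Theory Num.Theory.
Import numFieldNormedType.Exports.

Local Open Scope classical_set_scope.
Local Open Scope ring_scope.

(** * The space L2 *)

(** Ordinary convolution would need values of v outside the triangle. The homothetic average does
    not: as a function of the integration variable its kernel is a test function of the triangle
    itself, so the definition of the weak derivative applies to it directly, while the average is
    smooth on the whole plane, as the definition of a trace demands. The price is a factor l ^ -1 in
    its L2 bound, harmless as l tends to 1. Origin of the constant: put k = |cos theta|, P =
    ||p_1||, Q = ||p_2||, A = |p_1|_1, B = |p_2|_1. Cauchy-Schwarz gives sin^2 theta ||u||^2 <= P^2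
    + Q^2 + 2 k P Q and sin^2 theta |u|_1^2 >= A^2 + B^2 - 2 k A B. After P <= c_1 A and Q <= c_2 B,
    the square of C_6 is the largest generalised eigenvalue of the first form relative to the
    second. The bound |u|_1 <= |q|_1 is Pythagoras: the product of the gradients of Pi q and u
    integrates to a multiple of the integral of div u, so these gradients are orthogonal. *)

Section L2.
Context d (T : measurableType d) (R : realType) (mu : {measure set T -> \bar R}).
Variables (D : set T) (mD : measurable D).
Implicit Types (f g h : T -> R).

Lemma integrableDR f g : mu.-integrable D (EFin \o f) ->
  mu.-integrable D (EFin \o g) ->
  mu.-integrable D (EFin \o (fun x => f x + g x)).
Proof.
move=> lf lg; have := integrableD mD lf lg.
by apply: eq_integrable => // x _; rewrite /= EFinD.
Qed.

Lemma integrableZR k f : mu.-integrable D (EFin \o f) ->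
  mu.-integrable D (EFin \o (fun x => k * f x)).
Proof.
move=> lf; have := integrableZl mD k lf.
by apply: eq_integrable => // x _; rewrite /= EFinM.
Qed.

Lemma integrableBR f g : mu.-integrable D (EFin \o f) ->
  mu.-integrable D (EFin \o g) ->
  mu.-integrable D (EFin \o (fun x => f x - g x)).
Proof.
move=> lf lg; have := integrableB mD lf lg.
by apply: eq_integrable => // x _; rewrite /= EFinB.
Qed.

Definition sq_integrable f := measurable_fun D f /\
  mu.-integrable D (EFin \o (fun x => f x ^+ 2)).

Definition l2norm f : R := Num.sqrt (\int[mu]_(x in D) (f x ^+ 2)).

Lemma l2norm_ge0 f : 0 <= l2norm f. Proof. exact: sqrtr_ge0. Qed.

Lemma int_sqr_ge0 f : 0 <= \int[mu]_(x in D) (f x ^+ 2).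
Proof. by apply: Rintegral_ge0 => x _; exact: sqr_ge0. Qed.

Lemma l2norm_sqr f : l2norm f ^+ 2 = \int[mu]_(x in D) (f x ^+ 2).
Proof. by rewrite sqr_sqrtr// int_sqr_ge0. Qed.

Lemma sq_integrableM f g : sq_integrable f -> sq_integrable g ->
  mu.-integrable D (EFin \o (fun x => f x * g x)).
Proof.
move=> [mf f2] [mg g2].
apply: (le_integrable mD _ _ (integrableDR f2 g2)).
- by apply/measurable_EFinP; exact: measurable_funM.
- move=> x Dx /=; rewrite lee_fin.
  rewrite [leRHS]ger0_norm ?addr_ge0 ?sqr_ge0//.
  have := sqr_ge0 (`|f x| - `|g x|).
  have := sqr_ge0 (f x); have := sqr_ge0 (g x).
  rewrite normrM -(real_normK (num_real (f x))) -(real_normK (num_real (g x))).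
  nra.
Qed.

Lemma sq_integrableD f g : sq_integrable f -> sq_integrable g ->
  sq_integrable (fun x => f x + g x).
Proof.
move=> lf lg; have fg := sq_integrableM lf lg.
case: lf lg => [mf f2] [mg g2]; split; first exact: measurable_funD.
have := integrableDR f2 (integrableDR (integrableZR 2 fg) g2).
by apply: eq_integrable => // x _ /=; congr EFin; ring.
Qed.

Lemma sq_integrableZ k f : sq_integrable f -> sq_integrable (fun x => k * f x).
Proof.
move=> [mf f2]; split; first exact: measurable_funM.
have := integrableZR (k ^+ 2) f2.
by apply: eq_integrable => // x _ /=; rewrite exprMn.
Qed.

Lemma sq_integrableN f : sq_integrable f -> sq_integrable (fun x => - f x).
Proof.
move=> /(sq_integrableZ (-1)); congr sq_integrable.
by apply/funext => x; rewrite mulN1r.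
Qed.

Lemma sq_integrableB f g : sq_integrable f -> sq_integrable g ->
  sq_integrable (fun x => f x - g x).
Proof. by move=> lf /sq_integrableN; exact: sq_integrableD. Qed.

Lemma l2normZ k f : sq_integrable f ->
  l2norm (fun x => k * f x) = `|k| * l2norm f.
Proof.
move=> lf; rewrite /l2norm -sqrtr_sqr -sqrtrM ?sqr_ge0//; congr Num.sqrt.
under eq_Rintegral do rewrite exprMn.
by rewrite RintegralZl//; case: lf.
Qed.

Lemma eq_l2norm f g : {in D, f =1 g} -> l2norm f = l2norm g.
Proof.
by move=> fg; congr Num.sqrt; apply: eq_Rintegral => x Dx; rewrite fg.
Qed.

Lemma l2normC f g : l2norm (fun x => f x - g x) = l2norm (fun x => g x - f x).
Proof.
by congr Num.sqrt; apply: eq_Rintegral => x _; rewrite -sqrrN opprB.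
Qed.

(** Pointwise 2 |f g| <= t f ^ 2 + t^-1 g ^ 2, with t left free: optimising it afterwards yields
    Cauchy-Schwarz. *)
Lemma int_mul_AMGM f g (t : R) : 0 < t -> sq_integrable f -> sq_integrable g ->
  2 * `|\int[mu]_(x in D) (f x * g x)| <= t * l2norm f ^+ 2 + t^-1 * l2norm g ^+ 2.
Proof.
move=> t0 lf lg; have fg := sq_integrableM lf lg.
have [mf f2] := lf; have [mg g2] := lg.
have nfg : mu.-integrable D (EFin \o (fun x => `|f x * g x|)).
  exact: (integrable_norm fg).
apply: (@le_trans _ _ (2 * \int[mu]_(x in D) `|f x * g x|)).
  by rewrite ler_pM2l//; exact: le_normr_Rintegral.
rewrite !l2norm_sqr -!RintegralZl// -RintegralD//; last 2 first.
- exact: (integrableZR t f2).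
- exact: (integrableZR t^-1 g2).
apply: le_Rintegral => //.
- exact: (integrableZR 2 nfg).
- exact: (integrableDR (integrableZR t f2) (integrableZR t^-1 g2)).
- move=> x _; rewrite normrM.
  rewrite -(real_normK (num_real (f x))) -(real_normK (num_real (g x))).
  set a := `|f x|; set b := `|g x|.
  have : 0 <= t^-1 * (t * a - b) ^+ 2 by rewrite mulr_ge0 ?sqr_ge0 ?invr_ge0 ?ltW.
  have -> : t^-1 * (t * a - b) ^+ 2 = t * a ^+ 2 + t^-1 * b ^+ 2 - 2 * (a * b).
    by field; rewrite gt_eqF.
  by rewrite subr_ge0.
Qed.

Lemma cauchy_schwarz f g : sq_integrable f -> sq_integrable g ->
  `|\int[mu]_(x in D) (f x * g x)| <= l2norm f * l2norm g.
Proof.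
move=> lf lg; have I0 := normr_ge0 (\int[mu]_(x in D) (f x * g x)).
have := fun t t0 => @int_mul_AMGM f g t t0 lf lg.
move: I0; move: (`|_|) => I I0 AG.
have {}AG t : 0 < t -> 2 * I <= t * l2norm f ^+ 2 + t^-1 * l2norm g ^+ 2.
  by move=> t0; exact: AG.
have a0 := l2norm_ge0 f; have b0 := l2norm_ge0 g.
move: a0 b0 AG; move: (l2norm f) (l2norm g) => a b a0 b0 AG.
have key e : 0 < e -> I <= (a + e) * (b + e).
  move=> e0; have ae : 0 < a + e by rewrite ltr_wpDl.
  have be : 0 < b + e by rewrite ltr_wpDl.
  have := AG ((b + e) / (a + e)) (divr_gt0 be ae); rewrite invf_div.
  have H1 : (b + e) / (a + e) * a ^+ 2 <= (b + e) * (a + e).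
    rewrite -mulrA ler_pM2l// mulrC ler_pdivrMr//.
    by rewrite -expr2 ler_pXn2r ?nnegrE ?lerDl// ltW.
  have H2 : (a + e) / (b + e) * b ^+ 2 <= (a + e) * (b + e).
    rewrite -mulrA ler_pM2l// mulrC ler_pdivrMr//.
    by rewrite -expr2 ler_pXn2r ?nnegrE ?lerDl// ltW.
  move=> H; nra.
apply/ler_addgt0Pr => e e0.
(* (a + d') (b + d') exceeds a b by d' (a + b + d'), which is at most d' (a + b + 1) <= e because d'
   <= 1. *)
pose d' := Num.min 1 (e / (a + b + 1)).
have ab : 0 < a + b + 1 by rewrite ltr_wpDl// addr_ge0.
have d0 : 0 < d' by rewrite /d' lt_min ltr01 divr_gt0.
apply: (le_trans (key _ d0)).
have d1 : d' <= 1 by rewrite /d' ge_min lexx.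
have de : d' * (a + b + 1) <= e.
  by rewrite -ler_pdivlMr// /d' ge_min lexx orbT.
nra.
Qed.

Lemma l2norm_triangle f g : sq_integrable f -> sq_integrable g ->
  l2norm (fun x => f x + g x) <= l2norm f + l2norm g.
Proof.
move=> lf lg; have fg := sq_integrableM lf lg.
have cs := cauchy_schwarz lf lg.
have [mf f2] := lf; have [mg g2] := lg.
rewrite -(@ler_pXn2r _ 2)// ?nnegrE ?addr_ge0 ?l2norm_ge0//.
rewrite sqrrD !l2norm_sqr.
have -> : \int[mu]_(x in D) ((f x + g x) ^+ 2) =
  \int[mu]_(x in D) (f x ^+ 2) + (2 * \int[mu]_(x in D) (f x * g x)
  + \int[mu]_(x in D) (g x ^+ 2)).
  have i2 : mu.-integrable D (EFin \o (fun x => 2 * (f x * g x))).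
    exact: (integrableZR 2 fg).
  rewrite -RintegralZl// -RintegralD// -RintegralD//.
    by apply: eq_Rintegral => x _; ring.
  exact: (integrableDR i2 g2).
rewrite -[leRHS]addrA lerD2l lerD2r mulr_natl lerMn2r/=.
exact: le_trans (ler_norm _) cs.
Qed.

Lemma l2norm_triangleB f g h : sq_integrable (fun x => f x - g x) ->
  sq_integrable (fun x => g x - h x) ->
  l2norm (fun x => f x - h x) <=
  l2norm (fun x => f x - g x) + l2norm (fun x => g x - h x).
Proof.
move=> lf lg; apply: le_trans (l2norm_triangle lf lg).
by rewrite le_eqVlt; apply/orP; left; apply/eqP/eq_l2norm => x _; ring.
Qed.

Lemma l2norm_eq0 f : sq_integrable f -> l2norm f = 0 -> ae_eq mu D f (cst 0).
Proof.
move=> [mf f2] f0.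
have I0 : (\int[mu]_(x in D) `|(f x ^+ 2)%:E| = 0)%E.
  under eq_integral do rewrite gee0_abs ?lee_fin ?sqr_ge0//.
  have := l2norm_sqr f; rewrite f0 expr0n/= => /esym.
  rewrite /Rintegral => H; rewrite -(fineK (integrable_fin_num mD f2)).
  by rewrite H.
have [mf2 _] := integrableP _ _ _ f2.
have := (ae_eq_integral_abs mu mD mf2).1 I0.
apply: filterS => x /= H Dx; have [] := H Dx => /eqP.
by rewrite sqrf_eq0 => /eqP.
Qed.

Lemma ae_eq_l2norm f g : measurable_fun D f -> measurable_fun D g ->
  ae_eq mu D f g -> l2norm f = l2norm g.
Proof.
move=> mf mg fg; congr Num.sqrt; rewrite /Rintegral; congr fine.
apply: ae_eq_integral => //.
- by apply/measurable_EFinP; exact: measurable_funX.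
- by apply/measurable_EFinP; exact: measurable_funX.
- by apply: filterS fg => x /= fgx Dx; rewrite (fgx Dx).
Qed.

Lemma sq_integrable_le f g : measurable_fun D f ->
  sq_integrable g -> (forall x, D x -> `|f x| <= `|g x|) -> sq_integrable f.
Proof.
move=> mf [mg g2] fg; split => //.
apply: (le_integrable mD _ _ g2).
  by apply/measurable_EFinP; exact: measurable_funX.
move=> x Dx /=; rewrite lee_fin !normrX.
by rewrite ler_pXn2r ?nnegrE// fg.
Qed.

Lemma dominated_l2 (f_ : nat -> T -> R) f g :
  (forall n, measurable_fun D (f_ n)) -> measurable_fun D f ->
  sq_integrable g ->
  {ae mu, forall x, D x -> f_ n x @[n --> \oo] --> f x} ->
  (forall n x, D x -> `|f_ n x - f x| <= g x) ->
  l2norm (fun x => f_ n x - f x) @[n --> \oo] --> 0.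
Proof.
move=> mf_ mf [mg g2] cvf dom.
have H : [/\ mu.-integrable D (EFin \o cst (0 : R)),
  [sequence (\int[mu]_(x in D) `|((f_ n x - f x) ^+ 2)%:E - (cst (0 : R) x)%:E|)%E]_n
     @ \oo --> 0%E & True].
  have [] := (@dominated_convergence _ _ _ mu D mD
      (fun n x => ((f_ n x - f x) ^+ 2)%:E) (EFin \o cst 0)
      (fun x => (g x ^+ 2)%:E)).
  - by move=> n; apply/measurable_EFinP/measurable_funX; exact: measurable_funB.
  - by apply/measurable_EFinP; exact: measurable_cst.
  - apply: filterS cvf => x /= cvfx Dx.
    apply: cvg_EFin; first by near=> n.
    have h := cvfx Dx.
    have : (f_ n x - f x) @[n --> \oo] --> f x - f x.
      by apply: cvgB => //; exact: cvg_cst.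
    rewrite subrr => h0; have := cvgM h0 h0; rewrite mul0r; exact.
  - exact: g2.
  - apply: aeW => x n Dx.
    rewrite /= lee_fin ger0_norm ?sqr_ge0// -(real_normK (num_real (f_ n x - f x))).
    by rewrite ler_pXn2r ?nnegrE ?dom// (le_trans _ (dom n x Dx)).
  by move=> *; split.
case: H => _ H _.
have int_n n : mu.-integrable D (EFin \o (fun x => (f_ n x - f x) ^+ 2)).
  apply: (le_integrable mD _ _ g2).
    by apply/measurable_EFinP/measurable_funX; exact: measurable_funB.
  move=> x Dx /=; rewrite lee_fin !normrX ler_pXn2r ?nnegrE//.
  by rewrite (le_trans (dom n x Dx))// ler_norm.
have {}H : \int[mu]_(x in D) ((f_ n x - f x) ^+ 2) @[n --> \oo] --> 0.
  apply: fine_cvg; apply: cvg_trans H; apply: near_eq_cvg; near=> n.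
  apply: eq_integral => x _ /=.
  by rewrite subr0 ger0_norm ?sqr_ge0.
rewrite -(@sqrtr0 R); apply: continuous_cvg => //.
exact: sqrt_continuous.
Unshelve. all: by end_near. Qed.

(** Fatou's lemma for the squares. It yields membership in L2 together with the bound, which is how
    [l2_complete] controls the distance to an almost everywhere limit. *)
Lemma sq_integrable_fatou (f_ : nat -> T -> R) f C :
  (forall n, sq_integrable (f_ n)) -> measurable_fun D f ->
  {ae mu, forall x, D x -> f_ n x @[n --> \oo] --> f x} ->
  (forall n, l2norm (f_ n) <= C) ->
  sq_integrable f /\ l2norm f <= C.
Proof.
move=> lf_ mf cvf bnd.
have C0 : 0 <= C by apply: le_trans (bnd 0%N); exact: l2norm_ge0.
have mf2 : measurable_fun D (EFin \o (fun x => f x ^+ 2)).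
  by apply/measurable_EFinP; exact: measurable_funX.
have mf_2 n : measurable_fun D (fun x => ((f_ n x) ^+ 2)%:E).
  by apply/measurable_EFinP; apply: measurable_funX; case: (lf_ n).
have intE : (\int[mu]_(x in D) (f x ^+ 2)%:E <= (C ^+ 2)%:E)%E.
  have -> : (\int[mu]_(x in D) (f x ^+ 2)%:E =
      \int[mu]_(x in D) limn_einf (fun n => (f_ n x ^+ 2)%:E))%E.
    apply: ae_eq_integral => //.
      rewrite (_ : (fun x => _) =
          (fun x => - limn_esup (fun n => - (f_ n x ^+ 2)%:E))%E).
        apply: measurableT_comp => //.
        apply: measurable_fun_limn_esup => n.
        exact: measurableT_comp.
      apply/funext => x; rewrite -limn_einfN; congr limn_einf.
      by apply/funext => n; rewrite /= opprK.
    apply: filterS cvf => x /= cvfx Dx; apply/esym.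
    have h := cvfx Dx.
    have h2 : ((f_ n x ^+ 2)%:E) @[n --> \oo] --> (f x ^+ 2)%:E.
      apply: cvg_EFin; first by near=> n.
      by have := cvgM h h; rewrite -expr2; exact.
    by rewrite (cvg_limn_einf_sup h2).1.
  apply: (le_trans (@fatou _ _ _ mu D mD (fun n x => (f_ n x ^+ 2)%:E) mf_2 _)).
    by move=> n x _; rewrite lee_fin sqr_ge0.
  have le n : (\int[mu]_(x in D) (f_ n x ^+ 2)%:E <= (C ^+ 2)%:E)%E.
    rewrite -(fineK (integrable_fin_num mD (lf_ n).2)) lee_fin.
    rewrite -[leLHS]/(\int[mu]_(x in D) (f_ n x ^+ 2)) -l2norm_sqr.
    by rewrite ler_pXn2r ?nnegrE ?l2norm_ge0.
  rewrite limn_einf_lim; apply: lime_le; first exact: is_cvg_einfs.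
  near=> n; apply: le_trans (le n); apply: ereal_inf_lbound.
  by exists n => //=.
have int2 : mu.-integrable D (EFin \o (fun x => f x ^+ 2)).
  apply/integrableP; split => //; apply: le_lt_trans (ltry (C ^+ 2)).
  apply: le_trans intE; rewrite le_eqVlt; apply/orP; left; apply/eqP.
  by apply: eq_integral => x _ /=; rewrite ger0_norm ?sqr_ge0.
split=> //; rewrite -(@ler_pXn2r _ 2)// ?nnegrE ?l2norm_ge0// l2norm_sqr.
by rewrite -lee_fin /Rintegral fineK ?integrable_fin_num.
Unshelve. all: by end_near. Qed.

(** Riesz-Fischer for a sequence that is Cauchy at a geometric rate: it converges almost everywhere
    without extraction of a subsequence, and Fatou's lemma turns this into convergence in the
    norm. *)
Lemma l2_complete (f_ : nat -> T -> R) :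
  (forall n, sq_integrable (f_ n)) ->
  (forall n m, (n <= m)%N -> l2norm (fun x => f_ m x - f_ n x) <= 4^-1 ^+ n) ->
  exists2 f, sq_integrable f & l2norm (fun x => f_ n x - f x) @[n --> \oo] --> 0.
Proof.
move=> lf_ cau.
(* The squared norms of the increments are at most 16 ^ -n, so the weight 2 ^ n still leaves a
   summable series of integrals; where the sum of [h] is finite, the increments decay
   geometrically. *)
pose h n x := (2 ^+ n) * (f_ n.+1 x - f_ n x) ^+ 2.
have h0 n x : 0 <= h n x by rewrite mulr_ge0 ?sqr_ge0 ?exprn_ge0.
have lh n : sq_integrable (fun x => f_ n.+1 x - f_ n x) by exact: sq_integrableB.
have mh n : measurable_fun D (EFin \o h n).
  apply/measurable_EFinP; apply: measurable_funM => //.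
  by apply: measurable_funX; case: (lh n).
have ih n : (\int[mu]_(x in D) (h n x)%:E <= (2^-1 ^+ n)%:E)%E.
  have ii := integrableZR (2 ^+ n) (lh n).2.
  rewrite -(fineK (integrable_fin_num mD ii)) lee_fin.
  rewrite -[leLHS]/(\int[mu]_(x in D) (2 ^+ n * (f_ n.+1 x - f_ n x) ^+ 2)).
  rewrite RintegralZl//; last by case: (lh n).
  rewrite -l2norm_sqr.
  have : l2norm (fun x => f_ n.+1 x - f_ n x) ^+ 2 <= (4^-1 ^+ n) ^+ 2.
    by rewrite ler_pXn2r ?nnegrE ?l2norm_ge0 ?cau// exprn_ge0// invr_ge0.
  move=> H; apply: (@le_trans _ _ (2 ^+ n * (4^-1 ^+ n) ^+ 2)).
    by rewrite ler_wpM2l// exprn_ge0.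
  have -> : 2 ^+ n * (4^-1 ^+ n) ^+ 2 = (2^-1 * 4^-1) ^+ n :> R.
    rewrite -exprM mulnC exprM -exprMn; congr (_ ^+ n); by field.
  by apply: lerXn2r; rewrite ?nnegrE ?invr_ge0 ?mulr_ge0//; lra.
have aefin : {ae mu, forall x, D x -> (\sum_(0 <= n <oo) (h n x)%:E \is a fin_num)%E}.
  apply: (@integrable_ae _ _ _ mu D mD); apply/integrableP; split.
    apply: (ge0_emeasurable_sum (h := fun n x => (h n x)%:E)) => [n x _ _|n _].
      by rewrite lee_fin.
    exact: mh.
  have -> : (\int[mu]_(x in D) `|\sum_(0 <= n <oo) (h n x)%:E| =
            \sum_(0 <= n <oo) \int[mu]_(x in D) (h n x)%:E)%E.
    rewrite -integral_nneseries//; last by move=> n x _; rewrite lee_fin.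
    by apply: eq_integral => x _; rewrite gee0_abs// nneseries_ge0// => n _ _; rewrite lee_fin.
  apply: (@le_lt_trans _ _ (\sum_(0 <= n <oo) (2^-1 ^+ n)%:E)%E).
    apply: lee_nneseries => [n _ _|n _]; last exact: ih.
    by apply: integral_ge0 => x _; rewrite lee_fin.
  have cg : series (fun n => (2^-1 : R) ^+ n) n @[n --> \oo] --> ((1 - 2^-1)^-1 : R).
    rewrite -[X in _ --> X]mul1r.
    have -> : (fun n => (2^-1 : R) ^+ n) = geometric 1 2^-1.
      by apply/funext => n; rewrite /geometric/= mul1r.
    by apply: cvg_geometric_series; rewrite ger0_norm ?invr_ge0//; lra.
  have -> : (\sum_(0 <= n <oo) (2^-1 ^+ n)%:E = ((1 - 2^-1)^-1 : R)%:E)%E.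
    apply: cvg_lim => //; under eq_fun do rewrite sumEFin.
    by apply: cvg_EFin; [near=> n|exact: cg].
  exact: ltry.
have aecv : {ae mu, forall x, D x -> cvgn (fun n => f_ n x)}.
  apply: filterS aefin => x /= fx Dx; move: (fx Dx) => {}fx.
  set M := fine (\sum_(0 <= n <oo) (h n x)%:E)%E.
  have hM n : h n x <= M.
    rewrite -lee_fin fineK//.
    have H : (\sum_(0 <= i < n.+1) (h i x)%:E <= \sum_(0 <= i <oo) (h i x)%:E)%E.
      by apply: nneseries_lim_ge => k _ _; rewrite lee_fin.
    apply: (@le_trans _ _ (\sum_(0 <= i < n.+1) (h i x)%:E)%E).
      rewrite big_nat_recr//= lee_paddl//.
      by apply: sume_ge0 => i _; rewrite lee_fin.
    exact: H.
  have M0 : 0 <= M by apply: le_trans (hM 0%N); exact: h0.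
  (* [h n x <= M] reads |f_{n+1} - f_n| <= sqrt M q ^ n, a geometric bound with q < 1. *)
  pose q := Num.sqrt (2^-1 : R).
  have q0 : 0 <= q by exact: sqrtr_ge0.
  have q1 : q < 1 by rewrite -sqrtr1 ltr_sqrt//; lra.
  have dif n : `|f_ n.+1 x - f_ n x| <= Num.sqrt M * q ^+ n.
    rewrite -(@ler_pXn2r _ 2)// ?nnegrE ?mulr_ge0 ?sqrtr_ge0 ?exprn_ge0//.
    rewrite real_normK ?num_real// exprMn sqr_sqrtr// -exprM mulnC exprM.
    rewrite sqr_sqrtr ?invr_ge0// exprVn ler_pdivlMr ?exprn_gt0//.
    by rewrite mulrC; exact: hM.
  have cs : cvgn (series (fun n => f_ n.+1 x - f_ n x)).
    apply: normed_cvg; apply: (series_le_cvg _ _ dif) => //.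
      by move=> n; rewrite mulr_ge0 ?sqrtr_ge0 ?exprn_ge0.
    have -> : (fun n => Num.sqrt M * q ^+ n) = geometric (Num.sqrt M) q by [].
    by apply: is_cvg_geometric_series; rewrite ger0_norm.
  have -> : (fun n => f_ n x) =
     (fun n => f_ 0%N x + series (fun n => f_ n.+1 x - f_ n x) n).
    apply/funext => n; rewrite /series/= telescope_sumr//.
    by rewrite addrC subrK.
  by apply: is_cvgD => //; exact: is_cvg_cst.
have [f mf cvf] : exists2 f : T -> R, measurable_fun D f &
    {ae mu, forall x, D x -> f_ n x @[n --> \oo] --> f x}.
  (* The upper limit is measurable everywhere; off the convergence set its value is arbitrary. *)
  exists (fun x => fine (limn_esup (fun n => (f_ n x)%:E))).
    apply: (measurableT_comp (f := fine)) => //.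
    apply: measurable_fun_limn_esup => n.
    by apply/measurable_EFinP; case: (lf_ n).
  apply: filterS aecv => x /= cx Dx; have {}cx := cx Dx.
  have h2 : ((f_ n x)%:E) @[n --> \oo] --> (limn (fun n => f_ n x))%:E.
    by apply: cvg_EFin; first by near=> n.
  by rewrite (cvg_limn_einf_sup h2).2.
(* f - f_n is the almost everywhere limit of f_{m+n} - f_n in m, and these have norm at most 4 ^
   -n. *)
have key n : sq_integrable (fun x => f x - f_ n x) /\
    l2norm (fun x => f x - f_ n x) <= 4^-1 ^+ n.
  apply: (@sq_integrable_fatou (fun m x => f_ (m + n)%N x - f_ n x)).
  - by move=> m; exact: sq_integrableB.
  - by apply: measurable_funB => //; case: (lf_ n).
  - apply: filterS cvf => x /= cx Dx; have {}cx := cx Dx.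
    by apply: cvgB; [rewrite (cvg_shiftn n (fun k => f_ k x))|exact: cvg_cst].
  - by move=> m; apply: cau; exact: leq_addl.
exists f.
  have := sq_integrableD (key 0%N).1 (lf_ 0%N).
  by congr sq_integrable; apply/funext => x; rewrite subrK.
apply: (@squeeze_cvgr _ _ _ _ (fun=> 0) (fun n => (4^-1 : R) ^+ n)).
- near=> n; rewrite l2norm_ge0 l2normC; exact: (key n).2.
- exact: cvg_cst.
- by apply: cvg_expr; rewrite ger0_norm ?invr_ge0//; lra.
Unshelve. all: by end_near. Qed.

End L2.

(** * Affine substitution on the real line *)

Section leb_affine.
Variable R : realType.
Notation leb := (@lebesgue_measure R).

(** Lebesgue measure is |a| times its image under x |-> a x + b: both measures agree on half-open
    intervals, and uniqueness does the rest. For a < 0 the preimage is closed on the other side,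
    with the same length. *)
Lemma ge0_leb_affine (a b : R) (F : measurableTypeR R -> \bar R) : a != 0 ->
  measurable_fun setT F -> (forall x, 0 <= F x)%E ->
  (\int[leb]_x F (a * x + b)%R = (`|a|^-1)%:E * \int[leb]_x F x)%E.
Proof.
move=> a0 mF F0.
pose phi := (fun x => a * x + b) : measurableTypeR R -> measurableTypeR R.
have mphi : measurable_fun setT phi.
  apply: measurable_funD; last exact: measurable_cst.
  by apply: measurable_funM; [exact: measurable_cst|exact: measurable_id].
pose m0 := mscale (NngNum (normr_ge0 a)) (pushforward leb phi) : {measure set (measurableTypeR R) -> \bar R}.
pose m' := m0 mphi.
have E : forall A, measurable A -> leb A = m' A.
  apply: lebesgue_measure_unique => X [[l r] _ <-].
  change (leb `]l, r] = `|a|%:E * leb (phi @^-1` `]l, r]))%E.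
  have [an|ap|/eqP] := ltgtP a 0; last by rewrite (negbTE a0).
  - have -> : phi @^-1` `]l, r] = `[(r - b) / a, (l - b) / a[%classic.
      apply/seteqP; split => x /=; rewrite !in_itv/= /phi => /andP[h1 h2];
      apply/andP; move: h1 h2;
      rewrite ?ltr_ndivlMr ?ler_ndivrMr// mulrC ?ltrBlDr ?lerBrDr ?ltrBrDr ?lerBlDr => h1 h2;
      by split => //; move: h1 h2; rewrite mulrC.
    rewrite !lebesgue_measure_itv/= !lte_fin ltr_nM2r ?invr_lt0// ltrD2r.
    case: ifPn => _; last by rewrite mule0.
    by rewrite -!EFinB -EFinM (ltr0_norm an); congr EFin; field.
  - have -> : phi @^-1` `]l, r] = `](l - b) / a, (r - b) / a]%classic.
      apply/seteqP; split => x /=; rewrite !in_itv/= /phi => /andP[h1 h2];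
      apply/andP; move: h1 h2;
      rewrite ?ltr_pdivrMr ?ler_pdivlMr// mulrC ?ltrBlDr ?lerBrDr => h1 h2; split => //.
    rewrite !lebesgue_measure_itv/= !lte_fin ltr_pM2r ?invr_gt0// ltrD2r.
    case: ifPn => _; last by rewrite mule0.
    by rewrite -!EFinB -EFinM (gtr0_norm ap); congr EFin; field.
rewrite [in RHS](eq_measure_integral m'); last by move=> A mA _; exact: E.
rewrite ge0_integral_mscale//= ge0_integral_pushforward//=.
by rewrite preimage_setT muleA -EFinM mulVf ?mul1e// normr_eq0.
Qed.

End leb_affine.

(** * Measurability and affine substitutions in the plane *)

Section plane.
Variable R : realType.
Notation M := (measurableTypeR R).
Notation leb := (@lebesgue_measure R).
Notation area := (@area R).

(** The sigma-algebra here is generated by rectangles, so the open set is written as a countable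
    union of squares with rational centre and radius. *)
Lemma open_measurable2 (U : set (R * R)) : open U -> measurable (U : set (M * M)).
Proof.
move=> oU.
pose B (q : rat * rat * rat) : set (M * M) :=
  [set p | `|p.1 - ratr q.1.1| < ratr q.2 /\ `|p.2 - ratr q.1.2| < ratr q.2].
have mB q : measurable (B q).
  have -> : B q = `](ratr q.1.1 - ratr q.2), (ratr q.1.1 + ratr q.2)[%classic `*`
                  `](ratr q.1.2 - ratr q.2), (ratr q.1.2 + ratr q.2)[%classic.
    apply/seteqP; split => -[x y] /=.
      by rewrite !in_itv/= -!ltr_distl.
    by rewrite !in_itv/= -!ltr_distl.
  by apply: measurableX; exact: measurable_itv.
have -> : U = \bigcup_(q in [set q | B q `<=` U]) B q.
  apply/seteqP; split=> [p Up|p [q /= qU] /qU//].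
  have [e /= e0 eU] : exists2 e, 0 < e & ball p e `<=` U.
    by move/nbhs_ballP : (oU p Up) => [e e0 eU]; exists e.
  (* With the centre within e / 4 of p and the radius between e / 4 and e / 2, the square contains p
     and lies in the ball of radius e. *)
  have [r] := @rat_in_itvoo R (e / 4) (e / 2) ltac:(lra).
  rewrite in_itv/= => /andP[r1 r2].
  have [q1] := @rat_in_itvoo R (p.1 - e / 4) (p.1 + e / 4) ltac:(lra).
  rewrite in_itv/= -ltr_distl => q1p.
  have [q2] := @rat_in_itvoo R (p.2 - e / 4) (p.2 + e / 4) ltac:(lra).
  rewrite in_itv/= -ltr_distl => q2p.
  exists (q1, q2, r) => /=; last first.
    by rewrite /B/= distrC (lt_trans q1p)// distrC (lt_trans q2p).
  move=> z [/= z1 z2]; apply: eU; split; rewrite /ball/=.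
    rewrite -(subrK (ratr q1) p.1) -addrA (le_lt_trans (ler_normD _ _))//.
    rewrite distrC in q1p; rewrite distrC in z1.
    move: z1 q1p r2; lra.
  rewrite -(subrK (ratr q2) p.2) -addrA (le_lt_trans (ler_normD _ _))//.
  rewrite distrC in q2p; rewrite distrC in z2.
  move: z2 q2p r2; lra.
rewrite bigcup_mkcond; apply: countable_bigcupT_measurable => //.
by move=> q; case: ifP.
Qed.

Lemma continuous_measurable2 (D : set (R * R)) (f : R * R -> R) :
  measurable (D : set (M * M)) ->
  continuous f -> measurable_fun (D : set (M * M)) f.
Proof.
move=> mD cf; apply: (@measurable_funS _ _ _ _ setT) => //.
apply: (measurability _ (RGenOInfty.measurableE R)) => _ [_ [x ->] <-].
rewrite setTI; apply: open_measurable2; apply: open_comp; last exact: interval_open.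
by move=> p _; exact: cf.
Qed.

(** The map is triangular, so Tonelli reduces it to two substitutions on the line, the inner one
    with a shift that depends on y. This shape covers both the homotheties of the mollifier and the
    chart of the triangle. *)
Lemma ge0_area_affine (a c d b1 b2 : R) (F : M * M -> \bar R) : a != 0 -> d != 0 ->
  measurable_fun setT F -> (forall x, 0 <= F x)%E ->
  (\int[area]_p F (a * p.1 + c * p.2 + b1, d * p.2 + b2)%R =
   (`|a * d|^-1)%:E * \int[area]_p F p)%E.
Proof.
move=> a0 d0 mF F0.
have mphi : measurable_fun (setT : set (M * M))
    (fun p : M * M => (a * p.1 + c * p.2 + b1, d * p.2 + b2)%R : M * M).
  have m1 : measurable_fun (setT : set (M * M)) (fun p : M * M => p.1 : R) by exact: measurable_fst.
  have m2 : measurable_fun (setT : set (M * M)) (fun p : M * M => p.2 : R) by exact: measurable_snd.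
  apply: measurable_fun_pair.
    by do ! apply: measurable_funD => //; apply: measurable_funM.
  by do ! apply: measurable_funD => //; apply: measurable_funM.
rewrite /area fubini_tonelli2//; last exact: measurableT_comp.
rewrite fubini_tonelli2// /fubini_G /=.
transitivity (\int[leb]_y ((`|a|^-1)%:E * \int[leb]_x F (x, d * y + b2)%R))%E.
  apply: eq_integral => y _.
  under eq_integral do rewrite -addrA.
  rewrite (@ge0_leb_affine _ a (c * y + b1) (fun x => F (x, d * y + b2)%R))//.
  by apply: measurableT_comp => //; exact: measurable_pair2.
have mG := @measurable_fun_fubini_tonelli_G _ _ _ _ _ leb F mF F0.
have G0 y : (0 <= \int[leb]_x F (x, y))%E by apply: integral_ge0.
rewrite ge0_integralZl//; last first.
  apply: (measurableT_comp mG).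
  by apply: measurable_funD => //; apply: measurable_funM.
rewrite (@ge0_leb_affine _ d b2 (fun y => \int[leb]_x F (x, y))%E)//.
by rewrite muleA -EFinM normrM invfM.
Qed.

End plane.

(** * Smooth functions *)

Section Ck_theory.
Variable R : realType.
Implicit Types (f g : R * R -> R) (k : nat).
Notation Dx := (fun f => (fun x => 'D_(@dx R) f x)).
Notation Dy := (fun f => (fun x => 'D_(@dy R) f x)).

Lemma Ck_cont k f : Ck k f -> continuous f. Proof. by case: k => [|k] []. Qed.

Lemma CkS k f : Ck k.+1 f -> Ck k f.
Proof.
elim: k f => [|k IH] f; first by case.
move=> [cf [dfx dfy cx cy]]; split; first exact: cf.
by split; [exact: dfx|exact: dfy|exact: IH cx|exact: IH cy].
Qed.

Lemma smoothDx f : smooth f -> smooth (Dx f).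
Proof. by move=> sf k; case: (sf k.+1) => _ []. Qed.

Lemma smoothDy f : smooth f -> smooth (Dy f).
Proof. by move=> sf k; case: (sf k.+1) => _ []. Qed.

Lemma smooth_cont f : smooth f -> continuous f.
Proof. by move=> /(_ 0%N); exact: Ck_cont. Qed.

Lemma smooth_derx f : smooth f -> forall x, derivable f x (@dx R).
Proof. by move=> /(_ 1%N) [_ []]. Qed.

Lemma smooth_dery f : smooth f -> forall x, derivable f x (@dy R).
Proof. by move=> /(_ 1%N) [_ []]. Qed.

Lemma Ck_cst k (c : R) : Ck k (fun=> c).
Proof.
elim: k c => [|k IH] c; split => //; try by move=> x; exact: cvg_cst.
have E e : (fun x => 'D_e (fun=> c) x) = (fun=> 0) :> (R * R -> R).
  by apply/funext => x; exact: derive_cst.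
split; try by move=> x; exact: derivable_cst.
- by rewrite E.
- by rewrite E.
Qed.

Lemma CkD k f g : Ck k f -> Ck k g -> Ck k (fun x => f x + g x).
Proof.
elim: k f g => [|k IH] f g; move=> [cf df] [cg dg]; split => //;
  try by move=> x; apply: cvgD; [exact: cf|exact: cg].
case: df => dfx dfy cfx cfy; case: dg => dgx dgy cgx cgy.
split; try by move=> x; exact: derivableD.
- rewrite (_ : (fun x => _) = (fun x => Dx f x + Dx g x)); first exact: IH.
  by apply/funext => x; exact: deriveD.
- rewrite (_ : (fun x => _) = (fun x => Dy f x + Dy g x)); first exact: IH.
  by apply/funext => x; exact: deriveD.
Qed.

Lemma CkM k f g : Ck k f -> Ck k g -> Ck k (fun x => f x * g x).
Proof.
elim: k f g => [|k IH] f g Cf Cg; have [cf df] := Cf; have [cg dg] := Cg; split => //;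
  try by move=> x; apply: cvgM; [exact: cf|exact: cg].
case: df => dfx dfy cfx cfy; case: dg => dgx dgy cgx cgy.
have Cfk := CkS Cf; have Cgk := CkS Cg.
split; try by move=> x; exact: derivableM.
- rewrite (_ : (fun x => _) = (fun x => f x * Dx g x + g x * Dx f x)).
    by apply: CkD; exact: IH.
  by apply/funext => x; rewrite deriveM.
- rewrite (_ : (fun x => _) = (fun x => f x * Dy g x + g x * Dy f x)).
    by apply: CkD; exact: IH.
  by apply/funext => x; rewrite deriveM.
Qed.

Lemma smooth_cst (c : R) : smooth (fun=> c). Proof. by move=> k; exact: Ck_cst. Qed.
Lemma smoothD f g : smooth f -> smooth g -> smooth (fun x => f x + g x).
Proof. by move=> sf sg k; exact: CkD. Qed.
Lemma smoothM f g : smooth f -> smooth g -> smooth (fun x => f x * g x).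
Proof. by move=> sf sg k; exact: CkM. Qed.
Lemma smoothZ (c : R) f : smooth f -> smooth (fun x => c * f x).
Proof. by move=> sf; apply: smoothM => //; exact: smooth_cst. Qed.
Lemma smoothN f : smooth f -> smooth (fun x => - f x).
Proof.
move=> /(smoothZ (-1)); congr smooth.
by apply/funext => x; rewrite mulN1r.
Qed.
Lemma smoothB f g : smooth f -> smooth g -> smooth (fun x => f x - g x).
Proof. by move=> sf /smoothN; exact: smoothD. Qed.

(** Along p + t v the inner affine form is affine in t, so the difference quotient in the plane is
    one on the line. *)
Lemma is_derive_lin (c1 c2 c0 : R) (h : R -> R) (dh : R -> R) (p v : R * R) :
  (forall s : R, is_derive s (1 : R) h (dh s)) ->
  is_derive p v (fun q : R * R => h (c1 * q.1 + c2 * q.2 + c0))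
    ((c1 * v.1 + c2 * v.2) * dh (c1 * p.1 + c2 * p.2 + c0)).
Proof.
move=> hd; set s0 := c1 * p.1 + c2 * p.2 + c0; set w := c1 * v.1 + c2 * v.2.
have dl : is_derive (0 : R) (1 : R) (fun t : R => h (t * w + s0)) (w * dh s0).
  have H := hd ((0 : R) * w + s0).
  have l : is_derive (0 : R) (1 : R) (fun t : R => t * w + s0) w.
    have l0 := is_deriveD (is_deriveZ w (is_derive_id (0 : R) (1 : R)))
                  (is_derive_cst s0 (0 : R) (1 : R)).
    have -> : (fun t : R => t * w + s0) = (w \*: id + cst s0).
      by apply/funext => t; rewrite /= mulrC.
    by apply: is_derive_eq l0 _; rewrite addr0 /GRing.scale /= mulr1.
  have := @is_derive1_comp _ h (fun t : R => t * w + s0) 0 _ _ H l.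
  by rewrite mul0r add0r mulrC.
have [d1 d2] := dl.
have E : (fun t : R => t^-1 *: (h (c1 * (t *: v + p).1 + c2 * (t *: v + p).2 + c0)
      - h s0)) =
   (fun t : R => t^-1 *: (h ((t *: (1 : R) + 0) * w + s0) - h (0 * w + s0))).
  apply/funext => t; rewrite mul0r add0r; congr (_ *: (h _ - _)).
  by rewrite /s0 /w /=; rewrite /GRing.scale/=; ring.
split.
  by rewrite /derivable /= E; exact: d1.
by rewrite /derive /= E; exact: d2.
Qed.

(** A family of functions of one variable whose derivatives are finite linear combinations of its
    members is smooth along any affine form, by a single induction. [F i] lists the coefficients and
    members in the derivative of [h i]. *)
Lemma Ck_lin k (c1 c2 c0 : R) (I : Type) (h : I -> R -> R) (dh : I -> R -> R)
    (F : I -> seq (R * I)) :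
  (forall i (s : R), is_derive s (1 : R) (h i) (\sum_(ai <- F i) ai.1 * h ai.2 s)) ->
  forall i, Ck k (fun q : R * R => h i (c1 * q.1 + c2 * q.2 + c0)).
Proof.
move=> hd; elim: k => [|k IH] i; split => //.
- move=> p; apply: (@continuous_comp _ _ _ (fun q : R * R => c1 * q.1 + c2 * q.2 + c0) (h i)).
    apply: cvgD; last exact: cvg_cst.
    by apply: cvgD; apply: cvgM; [exact: cvg_cst|exact: cvg_fst|exact: cvg_cst|exact: cvg_snd].
  apply: differentiable_continuous; apply/derivable1_diffP.
  by case: (hd i (c1 * p.1 + c2 * p.2 + c0)).
- move=> p; apply: (@continuous_comp _ _ _ (fun q : R * R => c1 * q.1 + c2 * q.2 + c0) (h i)).
    apply: cvgD; last exact: cvg_cst.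
    by apply: cvgD; apply: cvgM; [exact: cvg_cst|exact: cvg_fst|exact: cvg_cst|exact: cvg_snd].
  apply: differentiable_continuous; apply/derivable1_diffP.
  by case: (hd i (c1 * p.1 + c2 * p.2 + c0)).
have H v p := @is_derive_lin c1 c2 c0 (h i) (fun s => \sum_(ai <- F i) ai.1 * h ai.2 s) p v (hd i).
have S v : Ck k (fun x : R * R => 'D_v (fun q : R * R => h i (c1 * q.1 + c2 * q.2 + c0)) x).
  rewrite (_ : (fun x => _) = (fun p : R * R => (c1 * v.1 + c2 * v.2) *
     \sum_(ai <- F i) ai.1 * h ai.2 (c1 * p.1 + c2 * p.2 + c0))).
    apply: CkM; first exact: Ck_cst.
    elim: (F i) => [|[a j] l IHl].
      rewrite (_ : (fun p => _) = fun=> 0); first exact: Ck_cst.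
      by apply/funext => p; rewrite big_nil.
    rewrite (_ : (fun p => _) = (fun p : R * R => a * h j (c1 * p.1 + c2 * p.2 + c0) +
        \sum_(ai <- l) ai.1 * h ai.2 (c1 * p.1 + c2 * p.2 + c0))).
      apply: CkD => //; apply: CkM; [exact: Ck_cst|exact: IH].
    by apply/funext => p; rewrite big_cons.
  by apply/funext => p; case: (H v p).
split; [by move=> p; case: (H (@dx R) p)|by move=> p; case: (H (@dy R) p)|exact: S|exact: S].
Qed.

Lemma smooth_affine (c1 c2 c0 : R) : smooth (fun q : R * R => c1 * q.1 + c2 * q.2 + c0).
Proof.
move=> k; apply: (@Ck_lin k c1 c2 c0 bool (fun b s => if b then s else 1)
   (fun _ _ => 0) (fun b => if b then [:: (1, false)] else [::]) _ true).
case=> s.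
  rewrite big_cons big_nil /= mul1r addr0; exact: is_derive_id.
by rewrite big_nil; exact: is_derive_cst.
Qed.

(** The intermediate point is located by its distance from x, so that x and y may come in either
    order. *)
Lemma mvt_abs (h dh : R -> R) : (forall s : R, is_derive s (1 : R) h (dh s)) ->
  forall x y, exists2 c, `|c - x| <= `|y - x| & h y - h x = dh c * (y - x).
Proof.
move=> hd x y.
have ch z : {for z, continuous h}.
  apply: differentiable_continuous; apply/derivable1_diffP.
  by case: (hd z).
have cw a b : {within `[a, b], continuous h}.
  by apply: continuous_subspaceT => z; exact: ch.
have [xy|yx] := leP x y.
  have [c + E] := @MVT_segment R h dh x y xy (fun z _ => hd z) (cw x y).
  rewrite in_itv/= => /andP[c1 c2]; exists c => //.
  by rewrite !ger0_norm ?subr_ge0// lerD2r.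
have [c + E] := @MVT_segment R h dh y x (ltW yx) (fun z _ => hd z) (cw y x).
rewrite in_itv/= => /andP[c1 c2]; exists c.
  by rewrite !ler0_norm ?subr_le0 ?(ltW yx)// lerN2 lerD2r.
by rewrite -opprB E -mulrN opprB.
Qed.

(** [Ck] provides derivatives along the two axes only. The increment along v is split into a
    horizontal and a vertical step; the mean value theorem on each and the continuity of the partial
    derivatives give every direction. *)
Lemma is_derive_C1 f (p v : R * R) : Ck 1 f ->
  is_derive p v f (v.1 * Dx f p + v.2 * Dy f p).
Proof.
move=> [cf [dfx dfy [cx _] [cy _]]].
have Hx (q : R * R) (s : R) :
    is_derive s (1 : R) (fun t : R => f (t, q.2)) (Dx f (s, q.2)).
  have [d1 d2] : is_derive (s, q.2) (@dx R) f (Dx f (s, q.2)).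
    exact/derivableP/dfx.
  have E : (fun h : R => h^-1 *: (f (h *: (1 : R) + s, q.2) - f (s, q.2))) =
     (fun h : R => h^-1 *: (f (h *: (@dx R) + (s, q.2)) - f (s, q.2))).
    apply/funext => h; congr (_ *: (f _ - _)).
    by rewrite /dx /=; congr pair; rewrite /= scaler0 add0r.
  by split; [rewrite /derivable /= E|rewrite /derive /= E].
have Hy (q : R * R) (s : R) :
    is_derive s (1 : R) (fun t : R => f (q.1, t)) (Dy f (q.1, s)).
  have [d1 d2] : is_derive (q.1, s) (@dy R) f (Dy f (q.1, s)).
    exact/derivableP/dfy.
  have E : (fun h : R => h^-1 *: (f (q.1, h *: (1 : R) + s) - f (q.1, s))) =
     (fun h : R => h^-1 *: (f (h *: (@dy R) + (q.1, s)) - f (q.1, s))).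
    apply/funext => h; congr (_ *: (f _ - _)).
    by rewrite /dy /=; congr pair; rewrite /= scaler0 add0r.
  by split; [rewrite /derivable /= E|rewrite /derive /= E].
suff L : h^-1 *: (f (h *: v + p) - f p) @[h --> 0^'] -->
    v.1 * Dx f p + v.2 * Dy f p.
  by split; [exact: (cvgP _ L)|exact: (cvg_lim _ L)].
apply/cvgrPdist_lt => e e0.
(* The summand 1 keeps N positive when v = 0 and makes the final estimate strict. *)
pose N := `|v.1| + `|v.2| + 1.
have N0 : 0 < N by rewrite /N ltr_wpDl// addr_ge0.
have eN : 0 < e / N by rewrite divr_gt0.
have [d1 /= d10 D1] : exists2 d, 0 < d & forall q, ball p d q -> `|Dx f p - Dx f q| < e / N.
  have /cvgrPdist_lt/(_ _ eN) := cx p.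
  by move=> /nbhs_ballP[d d0 H]; exists d => // q; exact: H.
have [d2 /= d20 D2] : exists2 d, 0 < d & forall q, ball p d q -> `|Dy f p - Dy f q| < e / N.
  have /cvgrPdist_lt/(_ _ eN) := cy p.
  by move=> /nbhs_ballP[d d0 H]; exists d => // q; exact: H.
pose d := Num.min d1 d2.
have d0 : 0 < d by rewrite lt_min d10.
near=> h.
have h0 : h != 0 by near: h; exact: nbhs_dnbhs_neq.
have hN : `|h| * N < d.
  rewrite -ltr_pdivlMr//; near: h.
  apply: (@cvg_within _ (nbhs (0 : R)) _).
  have := @nbhs0_lt R R (d / N) (divr_gt0 d0 N0); exact.
have hv1 : `|h * v.1| < d.
  by apply: le_lt_trans hN; rewrite normrM ler_wpM2l// /N -addrA lerDl addr_ge0.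
have hv2 : `|h * v.2| < d.
  apply: le_lt_trans hN; rewrite normrM ler_wpM2l// /N addrAC lerDr addr_ge0//.
pose q : R * R := (h * v.1 + p.1, h * v.2 + p.2).
have [c1 c1p E1] := mvt_abs (Hx q) p.1 q.1.
have [c2 c2p E2] := mvt_abs (Hy p) p.2 q.2.
rewrite /q /= !addrK in c1p E1 c2p E2.
have B1 : `|Dx f p - Dx f (c1, q.2)| < e / N.
  apply: D1; split; rewrite /ball/= distrC.
    by rewrite (le_lt_trans c1p)// (lt_le_trans hv1)// ge_min lexx.
  by rewrite addrK (lt_le_trans hv2)// ge_min lexx.
have B2 : `|Dy f p - Dy f (p.1, c2)| < e / N.
  apply: D2; split; rewrite /ball/= distrC.
    by rewrite subrr normr0.
  by rewrite (le_lt_trans c2p)// (lt_le_trans hv2)// ge_min lexx orbT.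
have E : f (h *: v + p) - f p = Dx f (c1, q.2) * (h * v.1) + Dy f (p.1, c2) * (h * v.2).
  rewrite -E1 -E2; have -> : h *: v + p = q by [].
  have -> : f p = f (p.1, p.2) by rewrite -surjective_pairing.
  by rewrite addrA subrK.
rewrite E /GRing.scale/=.
have -> : v.1 * Dx f p + v.2 * Dy f p -
    h^-1 * (Dx f (c1, q.2) * (h * v.1) + Dy f (p.1, c2) * (h * v.2)) =
    v.1 * (Dx f p - Dx f (c1, q.2)) + v.2 * (Dy f p - Dy f (p.1, c2)).
  by field.
rewrite (le_lt_trans (ler_normD _ _))// !normrM.
apply: (@le_lt_trans _ _ (`|v.1| * (e / N) + `|v.2| * (e / N))).
  by apply: lerD; rewrite ler_wpM2l// ltW.
rewrite -mulrDl mulrCA -[ltRHS]mulr1 ltr_pM2l// ltr_pdivrMr// mul1r /N ltrDl//.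
Unshelve. all: by end_near. Qed.

Lemma smooth_lineE f (p v : R * R) (s : R) : smooth f ->
  is_derive s (1 : R) (fun t : R => f (p.1 + t * v.1, p.2 + t * v.2))
    (v.1 * Dx f (p.1 + s * v.1, p.2 + s * v.2) +
     v.2 * Dy f (p.1 + s * v.1, p.2 + s * v.2)).
Proof.
move=> sf; set q := (p.1 + s * v.1, p.2 + s * v.2).
have [d1 d2] := @is_derive_C1 f q v (sf 1%N).
have E : (fun h : R => h^-1 *: (f (p.1 + (h *: (1 : R) + s) * v.1, p.2 + (h *: (1 : R) + s) * v.2) - f q)) =
     (fun h : R => h^-1 *: (f (h *: v + q) - f q)).
  apply/funext => h; congr (_ *: (f _ - _)).
  have -> : h *: v + q = (h * v.1 + q.1, h * v.2 + q.2) by [].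
  by rewrite /q /GRing.scale/= mulr1; congr pair; ring.
by split; [rewrite /derivable /= E|rewrite /derive /= E].
Qed.

End Ck_theory.

Lemma closure_sub_closed (T : topologicalType) (A B : set T) :
  closed B -> A `<=` B -> closure A `<=` B.
Proof. by move=> cB AB; rewrite closureE; exact: smallest_sub. Qed.

Lemma continuous_pair (T U V : topologicalType) (f : T -> U) (g : T -> V) :
  continuous f -> continuous g -> continuous (fun x => (f x, g x)).
Proof. by move=> cf cg x; apply: (cvg_pair (cf x) (cg x)). Qed.

Lemma continuous_lin (R : realType) (c1 c2 c0 : R) :
  continuous (fun q : R * R => c1 * q.1 + c2 * q.2 + c0).
Proof. by apply: smooth_cont; exact: smooth_affine. Qed.

Lemma continuous_scale (R : realType) (a b1 b2 : R) :
  continuous (fun q : R * R => (a * q.1 + b1, a * q.2 + b2)).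
Proof.
apply: continuous_pair.
  rewrite (_ : (fun q => _) = (fun q : R * R => a * q.1 + 0 * q.2 + b1)).
    exact: continuous_lin.
  by apply/funext => q; rewrite mul0r addr0.
rewrite (_ : (fun q => _) = (fun q : R * R => 0 * q.1 + a * q.2 + b2)).
  exact: continuous_lin.
by apply/funext => q; rewrite mul0r add0r.
Qed.

(** * Test functions *)

Section bump.
Variable R : realType.

(* The powers of 1 / u make the family stable under derivation. *)
Definition flat k (u : R) : R := if 0 < u then u^-1 ^+ k * expR (- u^-1) else 0.

Lemma flat_ge0 k u : 0 <= flat k u.
Proof.
rewrite /flat; case: ifPn => // u0.
by rewrite mulr_ge0 ?expR_ge0// exprn_ge0// invr_ge0 ltW.
Qed.

Lemma flat_gt0 u : (flat 0 u != 0) = (0 < u).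
Proof.
rewrite /flat; case: ifPn => [u0|]; last by rewrite eqxx.
by rewrite expr0 mul1r gt_eqF ?expR_gt0.
Qed.

(** The exponential series bounds exp (1 / u) from below by the term of order k + 2. A quadratic
    bound at 0 is what makes the derivative there exist and vanish. *)
Lemma flat_le_sqr k : exists2 C, 0 <= C & forall u, flat k u <= C * u ^+ 2.
Proof.
exists (k.+2)`!%:R => // u; rewrite /flat; case: ifPn => u0; last first.
  by rewrite mulr_ge0 ?sqr_ge0.
have v0 : 0 < u^-1 by rewrite invr_gt0.
have H := @expR_ge1Dxn R (u^-1) k.+1 (ltW v0).
have H2 : u^-1 ^+ k.+2 / k.+2`!%:R <= expR u^-1.
  by apply: le_trans H; rewrite lerDr.
rewrite expRN ler_pdivrMr ?expR_gt0//.
apply: le_trans (_ : k.+2`!%:R * u ^+ 2 * (u^-1 ^+ k.+2 / k.+2`!%:R) <= _); last first.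
  by rewrite ler_wpM2l// mulr_ge0 ?sqr_ge0.
have f0 : k.+2`!%:R != 0 :> R by rewrite pnatr_eq0 -lt0n fact_gt0.
rewrite !exprS le_eqVlt; apply/orP; left; apply/eqP.
by move: (u^-1 ^+ k) => w; field; rewrite f0 lt0r_neq0.
Qed.

Lemma is_derive_flat k (s : R) :
  is_derive s (1 : R) (flat k) (flat k.+2 s - k%:R * flat k.+1 s).
Proof.
have [s0|s0|s0] := ltgtP s 0.
- have E : \forall a \near s, flat k a = cst 0 a.
    near=> a; rewrite /flat /= ifN// -leNgt ltW//.
    by near: a; exact: lt_nbhsl.
  have z j : flat j s = 0 by rewrite /flat ifN// -leNgt ltW.
  rewrite !z mulr0 subr0; have [h1 h2] := is_derive_cst (0 : R) s (1 : R).
  split.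
    by apply: near_eq_derivable h1; apply: filterS E => a ->.
  by rewrite (near_eq_derive _ E).
- have n0 : s != 0 by rewrite gt_eqF.
  have E : \forall a \near s, flat k a = (fun u : R => u^-1 ^+ k * expR (- u^-1)) a.
    near=> a; rewrite /flat /= ifT//.
    by near: a; exact: lt_nbhsr.
  have dV : is_derive s (1 : R) (fun u : R => u^-1) (- s^-1 ^+ 2).
    apply: is_derive_eq; first exact: is_deriveV.
    by rewrite /GRing.scale/= mulr1 exprVn.
  have dE : is_derive s (1 : R) (fun u : R => expR (- u^-1)) (expR (- s^-1) * s^-1 ^+ 2).
    have := @is_derive1_comp _ expR (fun u : R => - u^-1) s _ _ (is_derive_expR _) (is_deriveN dV).
    by rewrite opprK.
  have dX : is_derive s (1 : R) (fun u : R => u^-1 ^+ k) (- (k%:R * s^-1 ^+ k.+1)).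
    elim: k {E} => [|k IH].
      by rewrite mul0r oppr0; exact: is_derive_cst.
    have := is_deriveM dV IH; congr is_derive.
      by apply/funext => u; rewrite exprS.
    by rewrite /GRing.scale/= !exprS -natr1; ring.
  have z j : flat j s = s^-1 ^+ j * expR (- s^-1) by rewrite /flat s0.
  have [h1 h2] := is_deriveM dX dE.
  split.
    by apply: near_eq_derivable h1; apply: filterS E => a ->.
  rewrite (near_eq_derive _ E) [LHS]h2 !z /GRing.scale/=.
  by rewrite !exprS; ring.
- rewrite s0; have z j : flat j 0 = 0 by rewrite /flat ltxx.
  rewrite !z mulr0 subr0.
  suff L : h^-1 *: (flat k (h *: (1 : R) + 0) - flat k 0) @[h --> 0^'] --> (0 : R).
    by split; [exact: (cvgP _ L)|exact: (cvg_lim _ L)].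
  have [C C0 HC] := flat_le_sqr k.
  apply/cvgrPdist_lt => e e0.
  near=> h.
  have h0 : h != 0 by near: h; exact: nbhs_dnbhs_neq.
  have hN : `|h| < e / (C + 1).
    near: h; apply: (@cvg_within _ (nbhs (0 : R)) _).
    have := @nbhs0_lt R R (e / (C + 1)) (divr_gt0 e0 (ltr_wpDl C0 ltr01)); exact.
  rewrite z subr0 sub0r normrN {1}/GRing.scale/= addr0 /GRing.scale/= mulr1.
  rewrite normrM normfV (ger0_norm (flat_ge0 _ _)).
  apply: (@le_lt_trans _ _ (`|h|^-1 * (C * h ^+ 2))).
    by rewrite ler_wpM2l ?HC.
  rewrite -(real_normK (num_real h)) expr2.
  have nh : `|h| != 0 by rewrite normr_eq0.
  have -> : `|h|^-1 * (C * (`|h| * `|h|)) = C * `|h| by field.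
  rewrite ltr_pdivlMr ?ltr_wpDl// in hN.
  rewrite mulrC; apply: le_lt_trans hN; by rewrite ler_wpM2l// lerDl.
Unshelve. all: by end_near. Qed.

Lemma smooth_flat_lin k (c1 c2 c0 : R) :
  smooth (fun q : R * R => flat k (c1 * q.1 + c2 * q.2 + c0)).
Proof.
move=> j; apply: (@Ck_lin R j c1 c2 c0 nat flat
  (fun _ _ => 0) (fun k => [:: (1, k.+2); (- k%:R, k.+1)]) _ k) => i s.
have := is_derive_flat i s; congr is_derive.
by rewrite !big_cons big_nil /= mul1r addr0 mulNr.
Qed.

Lemma bump (U : set (R * R)) (p : R * R) : open U -> U p ->
  exists eta : R * R -> R, [/\ test_fun U eta, forall x, 0 <= eta x & 0 < eta p].
Proof.
move=> oU Up.
have [e /= e0 eU] : exists2 e, 0 < e & ball p e `<=` U.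
  by move/nbhs_ballP : (oU p Up) => [e e0 eU]; exists e.
pose r := e / 2.
have r0 : 0 < r by rewrite divr_gt0.
(* A product of four one-sided factors, positive exactly on the open square of half-side r around
   p. *)
pose eta (q : R * R) := flat 0 (1 * q.1 + 0 * q.2 + (r - p.1)) *
  flat 0 (- 1 * q.1 + 0 * q.2 + (r + p.1)) *
  (flat 0 (0 * q.1 + 1 * q.2 + (r - p.2)) *
   flat 0 (0 * q.1 + -1 * q.2 + (r + p.2))).
pose B : set (R * R) := `[p.1 - r, p.1 + r]%classic `*` `[p.2 - r, p.2 + r]%classic.
have cB : compact B.
  by apply: compact_setX; exact: segment_compact.
have clB : closed B.
  by apply: compact_closed => //; exact: norm_hausdorff.
have sB : closure [set x | eta x != 0] `<=` B.
  apply: closure_sub_closed => // q /=.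
  rewrite /eta !mulf_eq0 !negb_or !flat_gt0 => /andP[/andP[h1 h2] /andP[h3 h4]].
  by split; rewrite /= in_itv/=; apply/andP; split; lra.
exists eta; split.
- split.
  + by do ! apply: smoothM; exact: smooth_flat_lin.
  + by apply: (subclosed_compact _ cB sB); exact: closed_closure.
  + apply: (subset_trans sB) => q [/=]; rewrite !in_itv/= -!ler_distl => h1 h2.
    apply: eU; split; rewrite /ball/= distrC.
      by apply: le_lt_trans h1 _; rewrite /r; lra.
    by apply: le_lt_trans h2 _; rewrite /r; lra.
- by move=> q; rewrite !mulr_ge0 ?flat_ge0.
- rewrite lt_neqAle !mulr_ge0 ?flat_ge0// andbT eq_sym.
  by rewrite !mulf_eq0 !negb_or !flat_gt0; apply/andP; split; apply/andP; split; lra.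
Qed.

End bump.

Section test_functions.
Variable R : realType.
Implicit Types (f : R * R -> R) (U : set (R * R)).
Notation Dx := (fun f => (fun x => 'D_(@dx R) f x)).
Notation Dy := (fun f => (fun x => 'D_(@dy R) f x)).

Lemma support_derive f (v : R * R) :
  closure [set x | 'D_v f x != 0] `<=` closure [set x | f x != 0].
Proof.
apply: closure_sub_closed; first exact: closed_closure.
move=> x /=; apply: contraPP => nx; apply/negP; rewrite negbK; apply/eqP.
have : open (~` closure [set x | f x != 0]) by apply: closed_openC; exact: closed_closure.
move=> /(_ x nx) H.
have E : \forall a \near x, f a = cst 0 a.
  near=> a; have : (~` closure [set x | f x != 0]) a by near: a.
  move=> na /=; apply/eqP; apply: contra_notT na => fa.
  exact: subset_closure.
by rewrite (near_eq_derive _ E); exact: derive_cst.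
Unshelve. all: by end_near. Qed.

Lemma test_funDx U f : test_fun U f -> test_fun U (Dx f).
Proof.
move=> [sf cf fU]; split; first exact: smoothDx.
  apply: (subclosed_compact _ cf); first exact: closed_closure.
  exact: support_derive.
by apply: subset_trans fU; exact: support_derive.
Qed.

Lemma test_funDy U f : test_fun U f -> test_fun U (Dy f).
Proof.
move=> [sf cf fU]; split; first exact: smoothDy.
  apply: (subclosed_compact _ cf); first exact: closed_closure.
  exact: support_derive.
by apply: subset_trans fU; exact: support_derive.
Qed.

Lemma test_fun_out U f x : test_fun U f -> ~ U x -> f x = 0.
Proof.
move=> [_ _ fU] Ux; apply/eqP; apply: contra_notT Ux => fx.
by apply: fU; exact: subset_closure.
Qed.

Lemma continuous_compact_bounded (K : set (R * R)) f : compact K -> continuous f ->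
  exists2 M, 0 < M & forall x, K x -> `|f x| <= M.
Proof.
move=> cK cf.
have cfK : compact (f @` K).
  apply: continuous_compact => //; exact: continuous_subspaceT.
have [M [Mr HM]] := compact_bounded cfK.
exists (`|M| + 1); first by rewrite ltr_wpDl.
move=> x Kx; apply: (HM (`|M| + 1)); last by exists x.
by rewrite (le_lt_trans (ler_norm _))// ltrDl.
Qed.

Lemma test_fun_bounded U f : test_fun U f -> exists2 M, 0 < M & forall x, `|f x| <= M.
Proof.
move=> [sf cf fU].
have [M M0 HM] := continuous_compact_bounded cf (smooth_cont sf).
exists M => // x; have [->|fx] := eqVneq (f x) 0; first by rewrite normr0 ltW.
by apply: HM; exact: subset_closure.
Qed.

Lemma test_fun_mul_smooth U f g : test_fun U f -> smooth g ->
  test_fun U (fun x => g x * f x).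
Proof.
move=> [sf cf fU] sg.
have S : closure [set x | g x * f x != 0] `<=` closure [set x | f x != 0].
  by apply: closureS => x /=; rewrite mulf_eq0 negb_or => /andP[].
split; first exact: smoothM.
  by apply: (subclosed_compact _ cf) => //; exact: closed_closure.
exact: subset_trans fU.
Qed.

Lemma derive_scale f (a b1 b2 : R) (v p : R * R) : smooth f ->
  is_derive p v (fun w : R * R => f (a * w.1 + b1, a * w.2 + b2))
    (a * (v.1 * Dx f (a * p.1 + b1, a * p.2 + b2) +
          v.2 * Dy f (a * p.1 + b1, a * p.2 + b2))).
Proof.
move=> sf; set q : R * R := (a * p.1 + b1, a * p.2 + b2).
have [h1 h2] := @smooth_lineE R f q (a * v.1, a * v.2) 0 sf.
have E : (fun h : R => h^-1 *: (f (a * (h *: v + p).1 + b1, a * (h *: v + p).2 + b2) - f q)) =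
  (fun h : R => h^-1 *: (f (q.1 + (h *: (1 : R) + 0) * (a * v.1), q.2 + (h *: (1 : R) + 0) * (a * v.2)) -
     f (q.1 + 0 * (a * v.1), q.2 + 0 * (a * v.2)))).
  apply/funext => h; congr (_ *: (f _ - f _)).
    have -> : h *: v + p = (h * v.1 + p.1, h * v.2 + p.2) by [].
    by rewrite /q /GRing.scale/= mulr1 addr0; congr pair; ring.
  by rewrite !mul0r !addr0 -surjective_pairing.
split.
  by rewrite /derivable /= E; exact: h1.
transitivity ('D_(1 : R) (fun t : R =>
    f (q.1 + t * (a * v.1, a * v.2).1, q.2 + t * (a * v.1, a * v.2).2)) 0).
  by rewrite /derive /= E.
have qE : (q.1, q.2) = q by [].
by rewrite h2 !mul0r !addr0 qE /= mulrDr !mulrA.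
Qed.

Lemma smooth_scale f (a b1 b2 : R) : smooth f ->
  smooth (fun w : R * R => f (a * w.1 + b1, a * w.2 + b2)).
Proof.
have cc f' : smooth f' -> continuous (fun w : R * R => f' (a * w.1 + b1, a * w.2 + b2)).
  move=> sf' p; apply: (@continuous_comp _ _ _ (fun w : R * R => (a * w.1 + b1, a * w.2 + b2)) f').
    exact: continuous_scale.
  exact: smooth_cont.
move=> sf k; elim: k f sf => [|k IH] f sf; split; [exact: cc|by []|exact: cc|].
split.
- by move=> p; case: (derive_scale a b1 b2 (@dx R) p sf).
- by move=> p; case: (derive_scale a b1 b2 (@dy R) p sf).
- rewrite (_ : (fun x => _) = (fun w : R * R => a * Dx f (a * w.1 + b1, a * w.2 + b2))).
    apply: CkM; first exact: Ck_cst.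
    by apply: (IH (Dx f)); exact: smoothDx.
  apply/funext => p; case: (derive_scale a b1 b2 (@dx R) p sf) => _ ->.
  by rewrite /dx /= mul1r mul0r addr0.
- rewrite (_ : (fun x => _) = (fun w : R * R => a * Dy f (a * w.1 + b1, a * w.2 + b2))).
    apply: CkM; first exact: Ck_cst.
    by apply: (IH (Dy f)); exact: smoothDy.
  apply/funext => p; case: (derive_scale a b1 b2 (@dy R) p sf) => _ ->.
  by rewrite /dy /= mul1r mul0r add0r.
Qed.

(* The support of the scaled function is the homothetic image of the support. *)
Lemma test_fun_scale U f (l : R) (x : R * R) : 0 < l < 1 ->
  (forall y, U y -> U (l * x.1 + (1 - l) * y.1, l * x.2 + (1 - l) * y.2)) ->
  test_fun U f ->
  test_fun U (fun w => f ((1 - l)^-1 * w.1 + - (l * x.1 / (1 - l)),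
                          (1 - l)^-1 * w.2 + - (l * x.2 / (1 - l)))).
Proof.
move=> /andP[l0 l1] hU [sf cf fU].
have m0 : 1 - l != 0 by rewrite gt_eqF// subr_gt0.
pose L := fun w : R * R => ((1 - l)^-1 * w.1 + - (l * x.1 / (1 - l)),
                          (1 - l)^-1 * w.2 + - (l * x.2 / (1 - l))).
pose I := fun y : R * R => (l * x.1 + (1 - l) * y.1, l * x.2 + (1 - l) * y.2).
have cI : continuous I.
  have -> : I = fun y : R * R => ((1 - l) * y.1 + l * x.1, (1 - l) * y.2 + l * x.2).
    by apply/funext => y; rewrite /I; congr pair; rewrite addrC.
  exact: continuous_scale.
have IL w : I (L w) = w.
  by rewrite [RHS]surjective_pairing /I /L /=; congr pair; field.
have cK : compact (I @` closure [set x | f x != 0]).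
  by apply: continuous_compact => //; exact: continuous_subspaceT.
have S : closure [set w | f (L w) != 0] `<=` I @` closure [set x | f x != 0].
  apply: closure_sub_closed; first by apply: compact_closed => //; exact: norm_hausdorff.
  by move=> w /= fw; exists (L w); [exact: subset_closure|exact: IL].
split; first exact: smooth_scale.
  by apply: (subclosed_compact _ cK) => //; exact: closed_closure.
by apply: (subset_trans S) => _ [y Ky <-]; apply: hU; exact: fU.
Qed.

End test_functions.

Lemma Rintegral_lin2 d (T : measurableType d) (R : realType)
    (mu : {measure set T -> \bar R}) (D : set T) (k l : R) (f g : T -> R) :
  measurable D -> mu.-integrable D (EFin \o f) -> mu.-integrable D (EFin \o g) ->
  \int[mu]_(x in D) (k * f x + l * g x) =
  k * \int[mu]_(x in D) f x + l * \int[mu]_(x in D) g x.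
Proof.
move=> mD lf lg; rewrite -!RintegralZl// -RintegralD//.
  exact: integrableZR.
exact: integrableZR.
Qed.

(** * Mollification on a bounded convex set *)

Section kernel_smooth.
Variable R : realType.
Notation M := (measurableTypeR R).
Notation mu := (@area R).
Implicit Types (phi v : R * R -> R) (x y e : R * R).
Notation Dx := (fun f => (fun x => 'D_(@dx R) f x)).
Notation Dy := (fun f => (fun x => 'D_(@dy R) f x)).

Lemma lipschitz_continuous2 (G : R * R -> R) L :
  (forall x y, `|G x - G y| <= L * (`|x.1 - y.1| + `|x.2 - y.2|)) -> continuous G.
Proof.
move=> HL x; apply/cvgrPdist_lt => e e0.
pose L1 := `|L| + 1.
have L0 : 0 < L1 by rewrite ltr_wpDl.
have d0 : 0 < e / (2 * L1) by rewrite divr_gt0// mulr_gt0.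
apply: (filterS _ (nbhsx_ballx x _ d0)) => y [] /=.
rewrite /ball/= => y1 y2.
apply: (le_lt_trans (HL x y)).
apply: (@le_lt_trans _ _ (L1 * (`|x.1 - y.1| + `|x.2 - y.2|))).
  by rewrite ler_wpM2r ?addr_ge0// /L1 (le_trans (ler_norm _))// lerDl.
rewrite mulrC -ltr_pdivlMr//.
have -> : e / L1 = e / (2 * L1) + e / (2 * L1) by field; exact: lt0r_neq0.
exact: ltrD.
Qed.

Lemma test_fun_lipschitz V phi : test_fun V phi ->
  exists2 L, 0 < L & forall x y, `|phi x - phi y| <= L * (`|x.1 - y.1| + `|x.2 - y.2|).
Proof.
move=> tphi; have [sphi _ _] := tphi.
have [M1 M10 H1] := test_fun_bounded (test_funDx tphi).
have [M2 M20 H2] := test_fun_bounded (test_funDy tphi).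
exists (M1 + M2); first exact: addr_gt0.
move=> x y.
have [c1 _ E1] := mvt_abs (fun s => @smooth_lineE R phi (0, x.2) (@dx R) s sphi) y.1 x.1.
have [c2 _ E2] := mvt_abs (fun s => @smooth_lineE R phi (y.1, 0) (@dy R) s sphi) y.2 x.2.
move: E1 E2; rewrite /dx /dy /= !(mulr0, mulr1, addr0, add0r, mul0r, mul1r) -!surjective_pairing => E1 E2.
have -> : phi x - phi y = (phi x - phi (y.1, x.2)) + (phi (y.1, x.2) - phi y).
  by rewrite addrA subrK.
rewrite E1 E2 (le_trans (ler_normD _ _))// !normrM mulrDl !mulrDr.
have := H1 (c1, x.2); have := H2 (y.1, c2); rewrite /dx /dy => h2 h1.
have n1 := normr_ge0 (x.1 - y.1); have n2 := normr_ge0 (x.2 - y.2).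
move: n1 n2 h1 h2; move: `|x.1 - y.1| `|x.2 - y.2| => A B A0 B0.
move: (`|_|) => P P1; move: (`|_|) => Q Q1; nra.
Qed.

Variables (U : set (R * R)) (mU : measurable (U : set (M * M))).
Variables (v : R * R -> R).
Hypothesis iv : mu.-integrable (U : set (M * M)) (EFin \o v).
Variables (a c : R).

(** The mollifier uses a = - l / (1 - l) and c = 1 / (1 - l). Only [phi] sees x, so these functions,
    with [phi] running over test functions, are closed under differentiation in x up to the factor
    a. *)
Definition kint phi x : R :=
  \int[mu]_(w in U) (v w * phi (a * x.1 + c * w.1, a * x.2 + c * w.2)).

Lemma measurable_kint phi x : continuous phi ->
  measurable_fun (U : set (M * M)) (fun w : M * M => phi (a * x.1 + c * w.1, a * x.2 + c * w.2)).
Proof.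
move=> cphi; apply: (@continuous_measurable2 R U) => // p.
apply: (@continuous_comp _ _ _ (fun w : R * R => (a * x.1 + c * w.1, a * x.2 + c * w.2)) phi).
  rewrite (_ : (fun w => _) = fun w : R * R => (c * w.1 + a * x.1, c * w.2 + a * x.2)).
    exact: continuous_scale.
  by apply/funext => w; congr pair; rewrite addrC.
exact: cphi.
Qed.

Lemma integrable_kint V phi x : test_fun V phi ->
  mu.-integrable (U : set (M * M))
    (EFin \o (fun w => v w * phi (a * x.1 + c * w.1, a * x.2 + c * w.2))).
Proof.
move=> tphi; have [B B0 HB] := test_fun_bounded tphi.
have miv := measurable_int mu iv.
apply: (le_integrable mU _ _ (integrableZR mU B (integrable_norm iv))).
  apply/measurable_EFinP; apply: measurable_funM.
    exact/measurable_EFinP.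
  by apply: measurable_kint; apply: smooth_cont; case: tphi.
move=> w Uw /=; rewrite lee_fin !normrM normr_id mulrC.
by apply: ler_pM => //; rewrite (gtr0_norm B0).
Qed.

Lemma continuous_kint V phi : test_fun V phi -> continuous (kint phi).
Proof.
move=> tphi; have [L L0 HL] := test_fun_lipschitz tphi.
have nv := integrable_norm iv.
apply: (@lipschitz_continuous2 _ (L * `|a| * \int[mu]_(w in U) `|v w|)) => x y.
rewrite /kint -RintegralB//; [|exact: (integrable_kint x tphi)|exact: (integrable_kint y tphi)].
under eq_Rintegral do rewrite -mulrBr.
have iB : mu.-integrable (U : set (M * M)) (EFin \o (fun w => v w *
   (phi (a * x.1 + c * w.1, a * x.2 + c * w.2) - phi (a * y.1 + c * w.1, a * y.2 + c * w.2)))).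
  have := integrableBR mU (integrable_kint x tphi) (integrable_kint y tphi).
  by apply: eq_integrable => // w _ /=; rewrite mulrBr.
apply: (le_trans (le_normr_Rintegral mU iB)).
pose C := L * `|a| * (`|x.1 - y.1| + `|x.2 - y.2|).
rewrite [leRHS](_ : _ = \int[mu]_(w in U) (C * `|v w|)); last first.
  by rewrite RintegralZl// /C; ring.
apply: le_Rintegral => //.
- exact: (integrable_norm iB).
- exact: (integrableZR mU C nv).
move=> w Uw; rewrite normrM mulrC ler_wpM2r//.
apply: (le_trans (HL _ _)) => /=.
have -> : a * x.1 + c * w.1 - (a * y.1 + c * w.1) = a * (x.1 - y.1) by ring.
have -> : a * x.2 + c * w.2 - (a * y.2 + c * w.2) = a * (x.2 - y.2) by ring.
by rewrite !normrM -mulrDr /C mulrA.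
Qed.

(** Differentiation under the integral in the parameter t of the line x + t e. The partial
    derivatives of [phi] are bounded, so a multiple of |v| dominates and integrability of v
    suffices. *)
Lemma is_derive_kint V phi x e : test_fun V phi ->
  is_derive x e (kint phi)
    (a * (e.1 * kint (Dx phi) x + e.2 * kint (Dy phi) x)).
Proof.
move=> tphi; have [sphi _ _] := tphi.
have tx := test_funDx tphi; have ty := test_funDy tphi.
have [M1 M10 H1] := test_fun_bounded tx.
have [M2 M20 H2] := test_fun_bounded ty.
pose p (w : R * R) : R * R := (a * x.1 + c * w.1, a * x.2 + c * w.2).
pose q (t : R) (w : R * R) : R * R := ((p w).1 + t * (a * e.1), (p w).2 + t * (a * e.2)).
pose f (t : R) (w : M * M) := v w * phi (q t w).
pose f' (t : R) (w : R * R) := v w * (a * e.1 * Dx phi (q t w) + a * e.2 * Dy phi (q t w)).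
have df t w : is_derive t (1 : R) (fun s => f s w) (f' t w).
  have := is_deriveZ (v w) (@smooth_lineE R phi (p w) (a * e.1, a * e.2) t sphi).
  exact.
have df1 t w : partial1of2 f t w = f' t w.
  by rewrite /partial1of2 derive1E; case: (df t w).
have qE t w : q t w = (a * (x.1 + t * e.1) + c * w.1, a * (x.2 + t * e.2) + c * w.2).
  by rewrite /q /p /=; congr pair; ring.
have int_f t : mu.-integrable (U : set (M * M)) (EFin \o f t).
  have := integrable_kint (x.1 + t * e.1, x.2 + t * e.2) tphi.
  by apply: eq_integrable => // w _ /=; rewrite /f qE.
pose B := `|a * e.1| * M1 + `|a * e.2| * M2.
have B0 : 0 <= B by rewrite addr_ge0// mulr_ge0// ltW.
have iG := integrableZR mU B (integrable_norm iv).
have I01 : `](-1 : R), 1[%classic 0 by rewrite /= in_itv/= ltrN10 ltr01.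
have := @cvg_differentiation_under_integral R _ _ mu f U mU 0 (-1) 1 I01
  (fun t _ => int_f t) (fun t w _ _ => @ex_derive _ _ _ _ _ _ _ (df t w))
  (fun w => B * `|v w|) (fun w => mulr_ge0 B0 (normr_ge0 _)) iG.
move=> H.
have {}H : h^-1 *: (\int[mu]_(w in U) f (h + 0) w - \int[mu]_(w in U) f 0 w) @[h --> 0^'] -->
    \int[mu]_(w in U) f' 0 w.
  have -> : \int[mu]_(w in U) f' 0 w = \int[mu]_(w in U) partial1of2 f 0 w.
    by apply: eq_Rintegral => w _; rewrite df1.
  apply: H => t w _ Uw; rewrite df1 /f' normrM mulrC ler_wpM2r//.
  rewrite (le_trans (ler_normD _ _))// /B; by apply: lerD; rewrite [leLHS]normrM ler_wpM2l//.
have E : (fun h : R => h^-1 *: (kint phi (h *: e + x) - kint phi x)) =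
  (fun h : R => h^-1 *: (\int[mu]_(w in U) f (h + 0) w - \int[mu]_(w in U) f 0 w)).
  apply/funext => h; congr (_ *: (_ - _)).
    apply: eq_Rintegral => w _; rewrite /f qE.
    have -> : h *: e + x = (h * e.1 + x.1, h * e.2 + x.2) by [].
    by rewrite addr0 /= ![_ + h * _]addrC.
  by apply: eq_Rintegral => w _; rewrite /f qE !mul0r !addr0.
have D0 : \int[mu]_(w in U) f' 0 w = a * (e.1 * kint (Dx phi) x + e.2 * kint (Dy phi) x).
  have ix := integrable_kint x tx; have iy := integrable_kint x ty.
  have := Rintegral_lin2 (a * e.1) (a * e.2) mU ix iy.
  rewrite -/(kint (Dx phi) x) -/(kint (Dy phi) x).
  move: (kint (Dx phi) x) (kint (Dy phi) x) => A B' L.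
  have -> : a * (e.1 * A + e.2 * B') = a * e.1 * A + a * e.2 * B' by ring.
  apply: etrans L.
  apply: eq_Rintegral => w _; rewrite /f' qE !mul0r !addr0.
  by move: ('D_ _ _ _) ('D_ _ _ _) (v w) => ? ? ?; ring.
rewrite -D0; split.
  by rewrite /derivable /= E; exact: (cvgP _ H).
by rewrite /derive /= E; exact: (cvg_lim _ H).
Qed.

Lemma smooth_kint V phi : test_fun V phi -> smooth (kint phi).
Proof.
move=> tphi k; elim: k phi tphi => [|k IH] phi tphi; split;
  [exact: continuous_kint tphi|by []|exact: continuous_kint tphi|].
have H e x := is_derive_kint x e tphi.
split.
- by move=> x; case: (H (@dx R) x).
- by move=> x; case: (H (@dy R) x).
- rewrite (_ : (fun x => _) = (fun x => a * kint (Dx phi) x)).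
    apply: CkM; first exact: Ck_cst.
    by apply: IH; exact: test_funDx tphi.
  apply/funext => x; case: (H (@dx R) x) => _ ->.
  by rewrite /dx /= mul1r mul0r addr0.
- rewrite (_ : (fun x => _) = (fun x => a * kint (Dy phi) x)).
    apply: CkM; first exact: Ck_cst.
    by apply: IH; exact: test_funDy tphi.
  apply/funext => x; case: (H (@dy R) x) => _ ->.
  by rewrite /dy /= mul1r mul0r add0r.
Qed.

End kernel_smooth.

(** * Tonelli's theorem with the plane as a factor *)

Section tonelli_area.
Variable R : realType.
Notation M := (measurableTypeR R).
Notation mu := (@area R).
(** A copy of [area] that carries the sigma-finite structure required by Tonelli's theorem. *)
Definition areaf : set (M * M) -> \bar R := fun A => mu A.
HB.instance Definition _ := Measure.copy areaf mu.
Lemma area_rect (A B : set M) : measurable A -> measurable B ->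
  mu (A `*` B) = (@lebesgue_measure R A * @lebesgue_measure R B)%E.
Proof. by move=> mA mB; exact: product_measure1E. Qed.

Lemma areaf_sigma_finite : sigma_finite setT areaf.
Proof.
pose F (n : nat) : set M := `[- n%:R, n%:R]%classic.
have mF n : measurable (F n) by exact: measurable_itv.
have inF (x : R) n : (Num.truncn `|x| < n)%N -> F n x.
  move=> h; rewrite /F /= in_itv/= -ler_norml.
  apply: (le_trans (ltW (truncnS_gt `|x|))).
  by rewrite ler_nat.
exists (fun n => F n `*` F n).
  apply/esym; rewrite -subTset => -[x y] _.
  exists (maxn (Num.truncn `|x|).+1 (Num.truncn `|y|).+1) => //.
  by split; apply: inF; rewrite /= leq_max ltnS leqnn ?orbT.
move=> n; split; first exact: measurableX.
rewrite /areaf area_rect// /F lebesgue_measure_itv/=.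
by case: ifPn => _; rewrite ?mule0// -EFinB -EFinM ltry.
Qed.
HB.instance Definition _ := Measure_isSigmaFinite.Build _ _ R areaf areaf_sigma_finite.
Definition area_sf : {sigma_finite_measure set (M * M)%type -> \bar R} := areaf.
Lemma measurable_int_area d (T : measurableType d) (H : T * (M * M) -> \bar R) :
  measurable_fun setT H -> (forall p, 0 <= H p)%E ->
  measurable_fun setT (fun x => \int[mu]_y H (x, y))%E.
Proof.
by move=> mH H0; exact: (@measurable_fun_fubini_tonelli_F _ _ _ _ _ area_sf H mH H0).
Qed.

Lemma tonelli_area d (T : measurableType d)
    (m : {sigma_finite_measure set T -> \bar R}) (H : T * (M * M) -> \bar R) :
  measurable_fun setT H -> (forall p, 0 <= H p)%E ->
  (\int[m]_x \int[mu]_y H (x, y) = \int[mu]_y \int[m]_x H (x, y))%E.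
Proof. by move=> mH H0; exact: (@fubini_tonelli _ _ _ _ _ m area_sf H mH H0). Qed.

Lemma tonelli_area2 (H : (M * M) * (M * M) -> \bar R) :
  measurable_fun setT H -> (forall p, 0 <= H p)%E ->
  (\int[mu]_x \int[mu]_y H (x, y) = \int[mu]_y \int[mu]_x H (x, y))%E.
Proof. by move=> mH H0; exact: (@tonelli_area _ _ area_sf H mH H0). Qed.

End tonelli_area.

(** * Homothetic averages and their bounds in L2 *)

Section approx_id.
Variable R : realType.
Notation M := (measurableTypeR R).
Notation mu := (@area R).
Implicit Types (v g : R * R -> R) (x y w : R * R).
Notation Dx := (fun f => (fun x => 'D_(@dx R) f x)).
Notation Dy := (fun f => (fun x => 'D_(@dy R) f x)).

Variables (U : set (R * R)) (D : R).
Hypothesis oU : open U.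
Hypothesis cvxU : forall x y l, U x -> U y -> 0 < l < 1 ->
  U (l * x.1 + (1 - l) * y.1, l * x.2 + (1 - l) * y.2).
Hypothesis bU : forall x, U x -> `|x.1| <= D /\ `|x.2| <= D.

Variable eta : R * R -> R.
Hypothesis teta : test_fun U eta.
Hypothesis eta0 : forall x, 0 <= eta x.
Hypothesis eta1 : (\int[mu]_p (eta p)%:E = 1)%E.

Notation U' := (U : set (M * M)).

Lemma mU : measurable U'. Proof. exact: open_measurable2. Qed.

Lemma area_lty : (mu U' < +oo)%E.
Proof.
pose B : set (M * M) := `[- D, D]%classic `*` `[- D, D]%classic.
have mB : measurable B by apply: measurableX; exact: measurable_itv.
apply: (@le_lt_trans _ _ (mu B)).
  apply: le_measure; rewrite ?inE//; first exact: mU.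
  by move=> x /bU[h1 h2]; split; rewrite /= in_itv/= -ler_norml.
rewrite /B area_rect; [|exact: measurable_itv|exact: measurable_itv].
rewrite lebesgue_measure_itv/=.
by case: ifPn => _; rewrite ?mule0// -EFinB -EFinM ltry.
Qed.

Lemma integrable_cstU (k : R) : mu.-integrable U' (EFin \o (fun=> k)).
Proof.
apply/integrableP; split; first by apply/measurable_EFinP; exact: measurable_cst.
rewrite (eq_integral (cst (`|k|%:E))%E)// integral_cst; last exact: mU.
have := area_lty; rewrite -ge0_fin_numE// => /fineK <-.
by rewrite -EFinM ltry.
Qed.

Lemma sq_integrable_int v : sq_integrable mu U' v -> mu.-integrable U' (EFin \o v).
Proof.
move=> [mv v2]; apply: (le_integrable mU _ _ (integrableDR mU (integrable_cstU 1) v2)).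
  exact/measurable_EFinP.
move=> x Ux /=; rewrite lee_fin [leRHS]ger0_norm ?addr_ge0 ?sqr_ge0//.
rewrite -(real_normK (num_real (v x))); have := normr_ge0 (v x).
move: (`|v x|) => t t0; nra.
Qed.

(* The substitution w = l x + (1 - l) z turns ker l x into the density eta, so that moll l v x
   averages v over l x + (1 - l) supp eta, which stays inside the convex set U. *)
Definition ker l x w : R := (1 - l) ^- 2 *
  eta ((- (l / (1 - l))) * x.1 + (1 - l)^-1 * w.1, (- (l / (1 - l))) * x.2 + (1 - l)^-1 * w.2).

Definition moll l v x : R := \int[mu]_(w in U') (v w * ker l x w).

Lemma ker_ge0 l x w : 0 <= ker l x w.
Proof. by rewrite mulr_ge0// invr_ge0 sqr_ge0. Qed.

Lemma mollE l v x : mu.-integrable U' (EFin \o v) ->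
  moll l v x = (1 - l) ^- 2 * kint U v (- (l / (1 - l))) ((1 - l)^-1) eta x.
Proof.
move=> iv; have ik := integrable_kint mU iv (- (l / (1 - l))) ((1 - l)^-1) x teta.
rewrite /kint -RintegralZl//; last exact: mU.
by apply: eq_Rintegral => w _; rewrite /ker mulrCA.
Qed.

Lemma smooth_moll l v : mu.-integrable U' (EFin \o v) -> smooth (moll l v).
Proof.
move=> iv; rewrite (_ : moll l v = fun x => (1 - l) ^- 2 * kint U v (- (l / (1 - l))) ((1 - l)^-1) eta x).
  by apply: smoothZ; exact: (smooth_kint mU iv _ _ teta).
by apply/funext => x; exact: mollE.
Qed.

Lemma ker_scaleE l x : ker l x = fun w => (1 - l) ^- 2 *
  eta ((1 - l)^-1 * w.1 + - (l * x.1 / (1 - l)), (1 - l)^-1 * w.2 + - (l * x.2 / (1 - l))).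
Proof.
apply/funext => w; rewrite /ker; congr (_ * eta _); congr pair.
  by rewrite addrC mulNr mulrAC.
by rewrite addrC mulNr mulrAC.
Qed.

(** Convexity keeps the homothetic image of the support of [eta] inside U. Hence the kernel, as a
    function of w, may be inserted in the definition of a weak derivative. *)
Lemma test_fun_ker l x : 0 < l < 1 -> U x -> test_fun U (ker l x).
Proof.
move=> l01 Ux; rewrite ker_scaleE; apply: test_fun_mul_smooth; last exact: smooth_cst.
by apply: test_fun_scale => // y Uy; exact: cvxU.
Qed.

Lemma measurable_eta : measurable_fun (setT : set (M * M)) eta.
Proof.
by apply: (@continuous_measurable2 R setT) => //; apply: smooth_cont; case: teta.
Qed.

Lemma int_ker l x : 0 < l < 1 -> (\int[mu]_w (ker l x w)%:E = 1)%E.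
Proof.
move=> /andP[l0 l1]; have m0 : 1 - l != 0 by rewrite gt_eqF// subr_gt0.
rewrite ker_scaleE; under eq_integral do rewrite EFinM.
rewrite ge0_integralZl//; last 3 first.
- apply/measurable_EFinP; apply: (measurableT_comp measurable_eta).
  apply: measurable_fun_pair; apply: measurable_funD => //; apply: measurable_funM => //.
- by move=> w _; rewrite lee_fin.
- by rewrite lee_fin invr_ge0 sqr_ge0.
have := @ge0_area_affine R ((1 - l)^-1) 0 ((1 - l)^-1) (- (l * x.1 / (1 - l)))
  (- (l * x.2 / (1 - l))) (fun p => (eta p)%:E).
rewrite invr_eq0 m0 => /(_ isT isT) H.
rewrite [X in (_ * X)%E](_ : _ = \int[mu]_p (eta ((1 - l)^-1 * p.1 + 0 * p.2 + - (l * x.1 / (1 - l)), (1 - l)^-1 * p.2 + - (l * x.2 / (1 - l))))%:E)%E; last first.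
  by apply: eq_integral => p _; rewrite mul0r addr0.
rewrite H; last 2 first.
- by apply/measurable_EFinP; exact: measurable_eta.
- by move=> p; rewrite lee_fin.
rewrite eta1 mule1 -EFinM; congr EFin.
rewrite ger0_norm; last by rewrite mulr_ge0// invr_ge0 subr_ge0 ltW.
by field.
Qed.

(** In the variable x the argument of [eta] is scaled by l / (1 - l) instead of 1 / (1 - l); this is
    why the mass is l ^ -2 and not 1. *)
Lemma int_ker2 l w : 0 < l < 1 -> (\int[mu]_x (ker l x w)%:E = (l ^- 2)%:E)%E.
Proof.
move=> /andP[l0 l1]; have m0 : 1 - l != 0 by rewrite gt_eqF// subr_gt0.
have l0' : l != 0 by rewrite gt_eqF.
under eq_integral do rewrite /ker EFinM.
rewrite ge0_integralZl//; last 3 first.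
- apply/measurable_EFinP; apply: (measurableT_comp measurable_eta).
  apply: measurable_fun_pair; apply: measurable_funD => //; apply: measurable_funM => //.
- by move=> x _; rewrite lee_fin.
- by rewrite lee_fin invr_ge0 sqr_ge0.
have := @ge0_area_affine R (- (l / (1 - l))) 0 (- (l / (1 - l))) ((1 - l)^-1 * w.1)
  ((1 - l)^-1 * w.2) (fun p => (eta p)%:E).
rewrite oppr_eq0 mulf_eq0 invr_eq0 negb_or m0 l0' => /(_ isT isT) H.
rewrite [X in (_ * X)%E](_ : _ = \int[mu]_p (eta ((- (l / (1 - l))) * p.1 + 0 * p.2 + (1 - l)^-1 * w.1, (- (l / (1 - l))) * p.2 + (1 - l)^-1 * w.2))%:E)%E; last first.
  by apply: eq_integral => p _; rewrite mul0r addr0.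
rewrite H; last 2 first.
- by apply/measurable_EFinP; exact: measurable_eta.
- by move=> p; rewrite lee_fin.
rewrite eta1 mule1 -EFinM; congr EFin.
rewrite mulrNN ger0_norm; last first.
  by rewrite !mulr_ge0 ?invr_ge0 ?subr_ge0 ?(ltW l0) ?(ltW l1).
by field; rewrite m0 l0'.
Qed.

Lemma int_kerU l x : 0 < l < 1 -> U x -> \int[mu]_(w in U') ker l x w = 1.
Proof.
move=> l01 Ux; rewrite Rintegral_mkcond /Rintegral.
rewrite (_ : (\int[mu]_w ((ker l x \_ U') w)%:E) = 1)%E//.
rewrite -(int_ker x l01); apply: eq_integral => w _.
rewrite patchE; case: ifPn => // /negP; rewrite inE => nU.
by rewrite (test_fun_out (test_fun_ker l01 Ux) nU).
Qed.

Lemma integrable_ker l x v : mu.-integrable U' (EFin \o v) ->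
  mu.-integrable U' (EFin \o (fun w => v w * ker l x w)).
Proof.
move=> iv; have := integrableZR mU ((1 - l) ^- 2) (integrable_kint mU iv (- (l / (1 - l))) ((1 - l)^-1) x teta).
by apply: eq_integrable => //; [exact: mU|move=> w _ /=; rewrite /ker mulrCA].
Qed.

Lemma moll_lin l x (a b : R) v g :
  mu.-integrable U' (EFin \o v) -> mu.-integrable U' (EFin \o g) ->
  moll l (fun w => a * v w + b * g w) x = a * moll l v x + b * moll l g x.
Proof.
move=> iv ig; rewrite /moll -(Rintegral_lin2 a b mU (integrable_ker l x iv) (integrable_ker l x ig)).
by apply: eq_Rintegral => w _; rewrite mulrDl !mulrA.
Qed.

Lemma moll_cst l x (k : R) : 0 < l < 1 -> U x -> moll l (fun=> k) x = k.
Proof.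
move=> l01 Ux; rewrite /moll RintegralZl ?int_kerU ?mulr1//; first exact: mU.
have := integrable_ker l x (integrable_cstU 1).
by apply: eq_integrable; [exact: mU|move=> w _ /=; rewrite mul1r].
Qed.

(* Jensen's inequality for the probability density [ker l x]. *)
Lemma moll_sqr_le l x v : 0 < l < 1 -> U x -> sq_integrable mu U' v ->
  (moll l v x) ^+ 2 <= \int[mu]_(w in U') (v w ^+ 2 * ker l x w).
Proof.
move=> l01 Ux lv; have iv := sq_integrable_int lv.
set m := moll l v x.
have i1 := integrable_ker l x iv.
have i2 := integrable_ker l x lv.2.
have i0 := integrable_ker l x (integrable_cstU 1).
(* The variance around m is nonnegative, and it equals the difference of the two sides because the
   kernel has mass 1. *)
have H : 0 <= \int[mu]_(w in U') ((v w - m) ^+ 2 * ker l x w).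
  by apply: Rintegral_ge0 => w _; rewrite mulr_ge0 ?sqr_ge0 ?ker_ge0.
have E : \int[mu]_(w in U') ((v w - m) ^+ 2 * ker l x w) =
    \int[mu]_(w in U') (v w ^+ 2 * ker l x w) - m ^+ 2.
  have := Rintegral_lin2 1 1 mU i2
    (integrableDR mU (integrableZR mU (- 2 * m) i1) (integrableZR mU (m ^+ 2) i0)).
  have -> := Rintegral_lin2 (- 2 * m) (m ^+ 2) mU i1 i0.
  rewrite -/(moll l v x) -/m -/(moll l (fun=> 1) x) moll_cst// !mul1r => L.
  apply: etrans (_ : _ = \int[mu]_(w in U') (1 * (v w ^+ 2 * ker l x w) +
     1 * (- 2 * m * (v w * ker l x w) + m ^+ 2 * (1 * ker l x w)))) _.
    by apply: eq_Rintegral => w _; move: (ker l x w) (v w) => ? ?; ring.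
  rewrite L; move: (\int[mu]_(w in U') _) => J; ring.
by rewrite -subr_ge0 -E.
Qed.

(** Jensen bounds the square of the average by the average of the square; after Tonelli the integral
    of the kernel over x is l ^ -2, uniformly in w. *)
Lemma moll_bound l v : 0 < l < 1 -> sq_integrable mu U' v ->
  sq_integrable mu U' (moll l v) /\ l2norm mu U' (moll l v) <= l^-1 * l2norm mu U' v.
Proof.
move=> l01 lv; have iv := sq_integrable_int lv; have [l0 l1] := andP l01.
have [mv v2] := lv.
have mm : measurable_fun U' (moll l v).
  by apply: (@continuous_measurable2 R U) => //; [exact: mU|apply: smooth_cont; exact: smooth_moll].
(* The square of v extended by 0, measurable on the whole plane as Tonelli requires. *)
pose h := ((fun w => v w ^+ 2) \_ U') : M * M -> R.
have mh : measurable_fun setT h.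
  by apply/(measurable_restrictT (fun w => v w ^+ 2) mU); exact: measurable_funX.
have h0 w : 0 <= h w by rewrite /h patchE; case: ifPn => // _; exact: sqr_ge0.
pose H (p : (M * M) * (M * M)) : \bar R := (h p.2 * ker l p.1 p.2)%:E.
have mH : measurable_fun setT H.
  apply/measurable_EFinP; apply: measurable_funM.
    exact: (measurableT_comp mh).
  apply: measurable_funM => //; apply: (measurableT_comp measurable_eta).
  have m11 : measurable_fun (setT : set ((M * M) * (M * M))) (fun p => p.1.1 : R).
    by apply: (measurableT_comp measurable_fst); exact: measurable_fst.
  have m12 : measurable_fun (setT : set ((M * M) * (M * M))) (fun p => p.1.2 : R).
    by apply: (measurableT_comp measurable_snd); exact: measurable_fst.
  have m21 : measurable_fun (setT : set ((M * M) * (M * M))) (fun p => p.2.1 : R).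
    by apply: (measurableT_comp measurable_fst); exact: measurable_snd.
  have m22 : measurable_fun (setT : set ((M * M) * (M * M))) (fun p => p.2.2 : R).
    by apply: (measurableT_comp measurable_snd); exact: measurable_snd.
  by apply: measurable_fun_pair; apply: measurable_funD; apply: measurable_funM.
have H0 p : (0 <= H p)%E by rewrite lee_fin mulr_ge0 ?ker_ge0.
have le1 : (\int[mu]_(x in U') ((moll l v x) ^+ 2)%:E <= (l ^- 2)%:E * \int[mu]_(w in U') (v w ^+ 2)%:E)%E.
  apply: (@le_trans _ _ (\int[mu]_(x in U') \int[mu]_w H (x, w))%E).
    apply: ge0_le_integral => //.
    - exact: mU.
    - by move=> x _; rewrite lee_fin sqr_ge0.
    - by apply/measurable_EFinP; exact: measurable_funX.
    - apply: measurable_funTS.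
      exact: (measurable_int_area mH H0).
    - move=> x Ux; apply: (@le_trans _ _ (\int[mu]_(w in U') (v w ^+ 2 * ker l x w))%:E).
        by rewrite lee_fin; exact: moll_sqr_le.
      rewrite /Rintegral fineK; last first.
        by apply: integrable_fin_num; [exact: mU|exact: (integrable_ker l x v2)].
      rewrite integral_mkcond; apply: ge0_le_integral => //.
      - by move=> w _; rewrite patchE; case: ifPn => // _; rewrite lee_fin mulr_ge0 ?sqr_ge0 ?ker_ge0.
      - apply/(measurable_restrictT _ mU).
        by have := measurable_int _ (integrable_ker l x v2).
      - by apply: (measurableT_comp mH); exact: measurable_pair1.
      - by move=> w _; rewrite /H /h /= !patchE; case: ifPn => // _; rewrite mul0r.
  apply: (@le_trans _ _ (\int[mu]_x \int[mu]_w H (x, w))%E).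
    apply: ge0_subset_integral => //; first exact: mU.
    - exact: (measurable_int_area mH H0).
    - by move=> x _; exact: integral_ge0.
  rewrite tonelli_area2//.
  rewrite [leLHS](_ : _ = \int[mu]_w ((l ^- 2)%:E * (h w)%:E))%E; last first.
    apply: eq_integral => w _; rewrite /H /=; under eq_integral do rewrite EFinM.
    rewrite ge0_integralZl//; last 3 first.
    - apply/measurable_EFinP; apply: measurable_funM => //.
      apply: (measurableT_comp measurable_eta).
      apply: measurable_fun_pair; apply: measurable_funD => //; apply: measurable_funM => //.
    - by move=> x _; rewrite lee_fin ker_ge0.
    - by rewrite lee_fin.
    by rewrite int_ker2// muleC.
  rewrite ge0_integralZl//; last 3 first.
  - exact/measurable_EFinP.
  - by move=> w _; rewrite lee_fin.
  - by rewrite lee_fin invr_ge0 sqr_ge0.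
  rewrite [in leRHS]integral_mkcond le_eqVlt; apply/orP; left; apply/eqP; congr (_ * _)%E.
  by apply: eq_integral => w _; rewrite /h !patchE; case: ifPn.
have fv2 := integrable_fin_num mU v2.
have sm : sq_integrable mu U' (moll l v).
  split => //; apply/integrableP; split.
    by apply/measurable_EFinP; exact: measurable_funX.
  under eq_integral do rewrite gee0_abs ?lee_fin ?sqr_ge0//.
  apply: (le_lt_trans le1).
  by rewrite -(fineK fv2) -EFinM ltry.
split => //.
rewrite -(@ler_pXn2r _ 2)// ?nnegrE ?l2norm_ge0//; last first.
  by rewrite mulr_ge0 ?l2norm_ge0// invr_ge0 ltW.
rewrite exprMn exprVn !l2norm_sqr /Rintegral -lee_fin EFinM fineK; last first.
  by apply: integrable_fin_num; [exact: mU|case: sm].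
by rewrite fineK; [exact: le1|exact: fv2].
Qed.

(** Starting at 1 / 2 keeps the factor l ^ -1 of [moll_bound] at most 2 along the whole sequence. *)
Definition lam (n : nat) : R := 1 - n.+2%:R^-1.

Lemma lam01 n : 0 < lam n < 1.
Proof.
rewrite /lam subr_gt0 ltrBlDr ltrDl invr_gt0 ltr0n andbT.
by rewrite invf_lt1 ?ltr1n ?ltr0n.
Qed.

Lemma lam_ge n : (lam n)^-1 <= 2.
Proof.
have /andP[l0 _] := lam01 n.
rewrite -[leRHS]invrK lef_pV2 ?posrE//.
rewrite /lam lerBrDr.
have : n.+2%:R^-1 <= 2^-1 :> R by rewrite lef_pV2 ?posrE ?ltr0n// ler_nat.
by move: (_%:R^-1) => t; lra.
Qed.

Lemma cvg_lam : lam n @[n --> \oo] --> (1 : R).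
Proof.
rewrite -[X in _ --> X]subr0; apply: cvgB; first exact: cvg_cst.
have := @cvg_harmonic R; rewrite -(cvg_shiftS (@harmonic R)).
exact.
Qed.

(* By Jensen, moll (lam n) is uniformly bounded on L2; hence this class is closed in L2. It
   contains the bounded continuous functions, and then, by Dynkin's pi-lambda theorem started
   at open quadrants, all indicators, hence all of L2. *)
Definition mcv v := l2norm mu U' (fun x => moll (lam n) v x - v x) @[n --> \oo] --> (0 : R).

Lemma mcv_lin (a b : R) v g : sq_integrable mu U' v -> sq_integrable mu U' g ->
  mcv v -> mcv g -> mcv (fun x => a * v x + b * g x).
Proof.
move=> lv lg cv cg.
have iv := sq_integrable_int lv; have ig := sq_integrable_int lg.
have sv n : sq_integrable mu U' (fun x => moll (lam n) v x - v x).
  by apply: sq_integrableB => //; [exact: mU|exact: (moll_bound (lam01 n) lv).1].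
have sg n : sq_integrable mu U' (fun x => moll (lam n) g x - g x).
  by apply: sq_integrableB => //; [exact: mU|exact: (moll_bound (lam01 n) lg).1].
apply: (@squeeze_cvgr _ _ _ _ (fun=> 0)
   (fun n => `|a| * l2norm mu U' (fun x => moll (lam n) v x - v x) +
             `|b| * l2norm mu U' (fun x => moll (lam n) g x - g x))).
- near=> n; rewrite l2norm_ge0/= -!l2normZ//; try exact: mU.
  apply: le_trans (l2norm_triangle mU (sq_integrableZ mU a (sv n)) (sq_integrableZ mU b (sg n))).
  rewrite le_eqVlt; apply/orP; left; apply/eqP/eq_l2norm => x _.
  rewrite moll_lin//; move: (moll _ v x) (moll _ g x) (v x) (g x) => ? ? ? ?; ring.
- exact: cvg_cst.
- rewrite -[X in _ --> X](_ : `|a| * 0 + `|b| * 0 = 0); last by rewrite !mulr0 addr0.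
  by apply: cvgD; apply: cvgM => //; exact: cvg_cst.
Unshelve. all: by end_near. Qed.

Lemma mcv_closed v : sq_integrable mu U' v ->
  (forall e, 0 < e -> exists g, [/\ sq_integrable mu U' g, mcv g &
     l2norm mu U' (fun x => g x - v x) <= e]) -> mcv v.
Proof.
move=> lv H; apply/cvgrPdist_le => e e0.
(* The error for v is split into the average of v - g, the error for g, and g - v; the first costs
   twice e / 4 by the uniform bound. *)
have [g [lg cg ge]] := H (e / 4) ltac:(by rewrite divr_gt0).
have e4 : 0 < e / 4 by rewrite divr_gt0.
have iv := sq_integrable_int lv; have ig := sq_integrable_int lg.
have sv n : sq_integrable mu U' (moll (lam n) v) by exact: (moll_bound (lam01 n) lv).1.
have sg n : sq_integrable mu U' (moll (lam n) g) by exact: (moll_bound (lam01 n) lg).1.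
move/cvgrPdist_le : cg => /(_ _ e4) cg.
near=> n.
have : `|0 - l2norm mu U' (fun x => moll (lam n) g x - g x)| <= e / 4 by near: n.
rewrite !sub0r !normrN !ger0_norm ?l2norm_ge0// => c1.
apply: (le_trans (l2norm_triangleB mU (f := moll (lam n) v) (g := g) (h := v) _ _)).
- exact: (sq_integrableB mU).
- exact: (sq_integrableB mU).
have c2 : l2norm mu U' (fun x => moll (lam n) v x - g x) <=
   l2norm mu U' (fun x => moll (lam n) v x - moll (lam n) g x) +
   l2norm mu U' (fun x => moll (lam n) g x - g x).
  by apply: (l2norm_triangleB mU); exact: (sq_integrableB mU).
have c3 : l2norm mu U' (fun x => moll (lam n) v x - moll (lam n) g x) <= 2 * (e / 4).
  have lgv := sq_integrableB mU lg lv.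
  have := (moll_bound (lam01 n) lgv).2.
  rewrite (_ : l2norm mu U' (moll (lam n) (fun x => g x - v x)) =
     l2norm mu U' (fun x => moll (lam n) v x - moll (lam n) g x)); last first.
    rewrite l2normC; apply: eq_l2norm => x _.
    have := moll_lin (lam n) x 1 (-1) ig iv; rewrite mul1r mulN1r => <-.
    by apply: eq_Rintegral => w _; rewrite mul1r mulN1r.
  move=> h; apply: (le_trans h); apply: ler_pM => //.
  - by rewrite invr_ge0; have /andP[/ltW] := lam01 n.
  - exact: l2norm_ge0.
  - exact: lam_ge.
have -> : e = 2 * (e / 4) + e / 4 + e / 4 by field.
by apply: lerD => //; apply: (le_trans c2); exact: lerD.
Unshelve. all: by end_near. Qed.

(** Where the kernel is nonzero, w = l x + (1 - l) y with y in U, so x - w = (1 - l) (x - y), and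
    each coordinate of x - y is at most 2 D in absolute value. *)
Lemma ker_near l x w : 0 < l < 1 -> U x -> ker l x w != 0 ->
  `|x.1 - w.1| <= (1 - l) * (2 * D) /\ `|x.2 - w.2| <= (1 - l) * (2 * D).
Proof.
move=> /andP[l0 l1] Ux; have m0 : 1 - l != 0 by rewrite gt_eqF// subr_gt0.
rewrite ker_scaleE mulf_eq0 negb_or => /andP[_].
set y := (_, _) => ey.
have [D1 D2] := bU Ux.
have Uy : U y by apply: contrapT => /(test_fun_out teta) h; rewrite h eqxx in ey.
have [E1 E2] := bU Uy.
have -> : x.1 - w.1 = (1 - l) * (x.1 - y.1) by rewrite /y /=; field.
have -> : x.2 - w.2 = (1 - l) * (x.2 - y.2) by rewrite /y /=; field.
have l0' : 0 <= 1 - l by rewrite subr_ge0 ltW.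
by rewrite !normrM !(ger0_norm l0'); split; apply: ler_wpM2l => //;
  rewrite (le_trans (ler_normB _ _))// mulr2n mulrDl !mul1r lerD.
Qed.

(** The kernel shrinks to the point x as l tends to 1, so continuity gives pointwise convergence;
    the bound B on v provides the dominating constant 2 B. *)
Lemma mcv_cont v (B : R) : continuous v -> (forall x, `|v x| <= B) -> mcv v.
Proof.
move=> cv bv.
have B0 : 0 <= B by apply: le_trans (bv (0, 0)).
have mv : measurable_fun U' v by apply: (@continuous_measurable2 R U) => //; exact: mU.
have lB k : sq_integrable mu U' (fun=> k).
  by split; [exact: measurable_cst|exact: integrable_cstU].
have lv : sq_integrable mu U' v.
  apply: (sq_integrable_le mU mv (lB B)) => x _.
  by rewrite (ger0_norm B0).
have iv := sq_integrable_int lv.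
(* As the kernel has mass 1, the error is the average of v w - v x over those w where the kernel is
   nonzero. *)
have key l x e : 0 < l < 1 -> U x -> (forall w, ker l x w != 0 -> `|v w - v x| <= e) ->
    `|moll l v x - v x| <= e.
  move=> l01 Ux H.
  have i1 := integrable_ker l x (integrable_cstU 1).
  have i2 := integrable_ker l x iv.
  have i3 := integrable_ker l x (integrableBR mU iv (integrable_cstU (v x))).
  have -> : moll l v x - v x = \int[mu]_(w in U') ((v w - v x) * ker l x w).
    have := moll_lin l x 1 (- v x) iv (integrable_cstU 1).
    rewrite moll_cst// mul1r mulr1 => <-.
    by rewrite /moll; apply: eq_Rintegral => w _; rewrite mul1r.
  apply: (le_trans (le_normr_Rintegral mU i3)).
  apply: (@le_trans _ _ (\int[mu]_(w in U') (e * (1 * ker l x w)))).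
    apply: le_Rintegral.
    - exact: mU.
    - exact: (integrable_norm i3).
    - exact: (integrableZR mU e i1).
    move=> w _; rewrite normrM (ger0_norm (ker_ge0 _ _ _)) mul1r.
    have [->|kn] := eqVneq (ker l x w) 0; first by rewrite !mulr0.
    by rewrite ler_wpM2r ?ker_ge0// H.
  rewrite RintegralZl//; last exact: mU.
  by rewrite -/(moll l (fun=> 1) x) moll_cst// mulr1.
apply: (dominated_l2 mU _ mv (lB (B + B))).
- by move=> n; case: (moll_bound (lam01 n) lv) => -[].
- apply: aeW => x Ux; apply/cvgrPdist_le => e e0.
  have /cvgrPdist_le/(_ _ e0)/nbhs_ballP[d /= d0 Hd] := cv x.
  have Dp : 0 < 2 * `|D| + 1 by rewrite ltr_wpDl// mulr_ge0.
  have cl : 1 - lam n @[n --> \oo] --> (0 : R).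
    rewrite -(subrr (1 : R)); apply: cvgB; [exact: cvg_cst|exact: cvg_lam].
  move/cvgrPdist_lt : cl => /(_ _ (divr_gt0 d0 Dp)) cl.
  near=> n.
  have : `|0 - (1 - lam n)| < d / (2 * `|D| + 1) by near: n.
  have /andP[l0 l1] := lam01 n.
  rewrite sub0r normrN ger0_norm ?subr_ge0 ?(ltW l1)// ltr_pdivlMr// => hl.
  have hl' : (1 - lam n) * (2 * D) < d.
    apply: le_lt_trans hl; rewrite ler_wpM2l ?subr_ge0 ?(ltW l1)//.
    by have := ler_norm D; lra.
  rewrite distrC; apply: key => //; first exact: lam01.
  move=> w kw; rewrite distrC; apply: Hd.
  have [n1 n2] := ker_near (lam01 n) Ux kw.
  by split; rewrite /ball/=; [apply: (le_lt_trans n1)|apply: (le_lt_trans n2)].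
- move=> n x Ux; apply: key => //; first exact: lam01.
  by move=> w _; rewrite (le_trans (ler_normB _ _))// lerD.
Unshelve. all: by end_near. Qed.

End approx_id.

Import HBSimple HBNNSimple.

(** * Convergence of the averages for every function in L2 *)

Section density.
Variable R : realType.
Notation M := (measurableTypeR R).
Notation mu := (@area R).
Implicit Types (v g : R * R -> R) (x y w : R * R).
Notation Dx := (fun f => (fun x => 'D_(@dx R) f x)).
Notation Dy := (fun f => (fun x => 'D_(@dy R) f x)).

Definition quadrants : set (set (M * M)) :=
  [set A | exists a b : R, A = `]a, +oo[%classic `*` `]b, +oo[%classic].

Lemma setI_quadrants : setI_closed quadrants.
Proof.
move=> A B [a1 [b1 ->]] [a2 [b2 ->]].
exists (Num.max a1 a2), (Num.max b1 b2); apply/seteqP; split => -[p q] /=;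
  rewrite !in_itv/= !andbT !gt_max.
  by move=> [[h1 h2] [h3 h4]]; rewrite h1 h2 h3 h4.
by move=> [/andP[h1 h2] /andP[h3 h4]].
Qed.

(** The work lies in one inclusion: both coordinates are measurable for the sigma-algebra of the
    quadrants, since a half-plane bounded by a line parallel to an axis is a countable union of
    quadrants. *)
Lemma measurable_quadrants : @measurable _ (M * M)%type = <<s quadrants >>.
Proof.
pose T := g_sigma_algebraType quadrants.
have mq a b : @measurable _ T (`]a, +oo[%classic `*` `]b, +oo[%classic : set (M * M)).
  by apply: sub_sigma_algebra; exists a, b.
have m1 : measurable_fun (setT : set T) (fun p : T => (p : R * R).1 : R).
  apply: (measurability _ (RGenOInfty.measurableE R)) => _ [_ [x ->] <-].
  rewrite setTI (_ : _ @^-1` _ = \bigcup_(n : nat) (`]x, +oo[%classic `*` `](- n%:R), +oo[%classic)).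
    by apply: bigcup_measurable => n _; exact: mq.
  apply/seteqP; split => [[p q] /= h|[p q] [n _] [/= h _]]//.
  exists (Num.truncn `|q|).+1 => //; split => //=; rewrite in_itv/= andbT.
  by rewrite ltrNl (le_lt_trans _ (truncnS_gt `|q|))// -normrN ler_norm.
have m2 : measurable_fun (setT : set T) (fun p : T => (p : R * R).2 : R).
  apply: (measurability _ (RGenOInfty.measurableE R)) => _ [_ [x ->] <-].
  rewrite setTI (_ : _ @^-1` _ = \bigcup_(n : nat) (`](- n%:R), +oo[%classic `*` `]x, +oo[%classic)).
    by apply: bigcup_measurable => n _; exact: mq.
  apply/seteqP; split => [[p q] /= h|[p q] [n _] [/= _ h]]//.
  exists (Num.truncn `|p|).+1 => //; split => //=; rewrite in_itv/= andbT.
  by rewrite ltrNl (le_lt_trans _ (truncnS_gt `|p|))// -normrN ler_norm.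
apply/seteqP; split.
  apply: smallest_sub; first exact: smallest_sigma_algebra.
  rewrite subUset; split => _ [B mB <-].
    exact: (m1 measurableT B mB).
  exact: (m2 measurableT B mB).
apply: smallest_sub; first exact: sigma_algebra_measurable.
move=> _ [a [b ->]]; apply: measurableX; exact: measurable_itv.
Qed.

Variables (U : set (R * R)) (D : R).
Hypothesis oU : open U.
Hypothesis cvxU : forall x y l, U x -> U y -> 0 < l < 1 ->
  U (l * x.1 + (1 - l) * y.1, l * x.2 + (1 - l) * y.2).
Hypothesis bU : forall x, U x -> `|x.1| <= D /\ `|x.2| <= D.

Variable eta : R * R -> R.
Hypothesis teta : test_fun U eta.
Hypothesis eta0 : forall x, 0 <= eta x.
Hypothesis eta1 : (\int[mu]_p (eta p)%:E = 1)%E.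

Notation U' := (U : set (M * M)).
Let mU' : measurable U' := mU oU.
Notation mcv := (mcv U eta).
Let closed := mcv_closed oU cvxU bU teta eta0 eta1.
Let lin := mcv_lin oU cvxU bU teta eta0 eta1.

Lemma sq_integrable_cstU k : sq_integrable mu U' (fun=> k).
Proof. by split; [exact: measurable_cst|exact: (integrable_cstU oU bU)]. Qed.

Lemma sq_integrable_indic (A : set (M * M)) : measurable A -> sq_integrable mu U' (\1_A : M * M -> R).
Proof.
move=> mA; apply: (sq_integrable_le mU' _ (sq_integrable_cstU 1)).
  exact: measurable_indic.
by move=> x _; rewrite indicE normr1; case: (_ \in _); rewrite ?normr1 ?normr0.
Qed.

Lemma mcv_limit (g_ : nat -> R * R -> R) v : sq_integrable mu U' v ->
  (forall n, sq_integrable mu U' (g_ n)) -> (forall n, mcv (g_ n)) ->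
  l2norm mu U' (fun x => g_ n x - v x) @[n --> \oo] --> (0 : R) -> mcv v.
Proof.
move=> lv lg cg cv; apply: closed => // e e0.
move/cvgrPdist_le : cv => /(_ _ e0)[n _ /(_ n (leqnn n))].
rewrite /= sub0r normrN ger0_norm ?l2norm_ge0// => h.
by exists (g_ n).
Qed.

Lemma mcv_quadrant (A : set (M * M)) : quadrants A -> mcv \1_A.
Proof.
move=> [a [b AE]].
(* For k > 0, a continuous ramp that vanishes up to c and reaches 1 at c + 1 / k; as k grows it
   tends to the indicator of t > c. *)
pose r (k : nat) (c t : R) : R := Num.min 1 (k%:R * Num.max 0 (t - c)).
have r0 k c t : 0 <= r k c t.
  by rewrite /r le_min ler01/= mulr_ge0// le_max lexx.
have r1 k c t : r k c t <= 1 by rewrite /r ge_min lexx.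
have rc k c : continuous (r k c).
  have c1 : continuous (fun t : R => Num.max 0 (t - c)).
    move=> t; apply: (@continuous_max R R (fun=> 0) (fun t => t - c)).
      exact: cvg_cst.
    by apply: cvgB; [exact: cvg_id|exact: cvg_cst].
  move=> t; apply: (@continuous_min R R (fun=> 1) (fun t => k%:R * Num.max 0 (t - c))).
    exact: cvg_cst.
  by apply: cvgM; [exact: cvg_cst|exact: c1].
pose u k (x : R * R) := r k a x.1 * r k b x.2.
have mA : measurable A by rewrite AE; apply: measurableX; exact: measurable_itv.
have cu k : continuous (u k).
  move=> x; apply: cvgM.
    by apply: (@continuous_comp _ _ _ (@fst R R) (r k a)); [exact: cvg_fst|exact: rc].
  by apply: (@continuous_comp _ _ _ (@snd R R) (r k b)); [exact: cvg_snd|exact: rc].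
have u0 k x : 0 <= u k x by exact: mulr_ge0.
have u1 k x : u k x <= 1 by apply: mulr_ile1.
have bu k x : `|u k x| <= 1 by rewrite ger0_norm.
have mu_ k : measurable_fun U' (u k) by exact: (@continuous_measurable2 R U).
have lu k : sq_integrable mu U' (u k).
  by apply: (sq_integrable_le mU' (mu_ k) (sq_integrable_cstU 1)) => x _; rewrite normr1.
have lim (c t : R) : r k c t @[k --> \oo] --> (if c < t then 1 else 0 : R).
  case: ltP => ct.
    apply: cvg_near_cst; near=> k.
    rewrite /r; apply/min_idPl.
    rewrite (max_idPr _) ?subr_ge0 ?(ltW ct)// -ler_pdivrMr ?subr_gt0// mul1r.
    near: k; exact: nbhs_infty_ger.
  apply: cvg_near_cst; near=> k.
  by rewrite /r (max_idPl _) ?subr_le0// mulr0; apply/min_idPr.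
apply: (mcv_limit (sq_integrable_indic mA) lu).
  by move=> k; apply: (mcv_cont oU cvxU bU teta eta0 eta1 (cu k)); exact: bu.
apply: (dominated_l2 mU' mu_ _ (sq_integrable_cstU 2)).
- exact: measurable_indic.
- apply: aeW => x _.
  have -> : \1_A x = (if a < x.1 then 1 else 0) * (if b < x.2 then 1 else 0) :> R.
    rewrite indicE AE; case: ifPn => h1; case: ifPn => h2; rewrite ?mulr1 ?mulr0 ?mul0r.
    - by rewrite mem_set//; split; rewrite /= in_itv/= ?h1 ?h2.
    - by rewrite memNset// => -[/= _]; rewrite in_itv/= andbT (negbTE h2).
    - by rewrite memNset// => -[/=]; rewrite in_itv/= andbT (negbTE h1).
    - by rewrite memNset// => -[/=]; rewrite in_itv/= andbT (negbTE h1).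
  by apply: cvgM; exact: lim.
- move=> k x _; apply: (le_trans (ler_normB _ _)).
  by rewrite -[leRHS]/(1 + 1) lerD// indicE; case: (_ \in _); rewrite ?normr1 ?normr0.
Unshelve. all: by end_near. Qed.

Lemma mcv_indic (A : set (M * M)) : measurable A -> mcv \1_A.
Proof.
have c1 : mcv (fun=> 1).
  by apply: (mcv_cont oU cvxU bU teta eta0 eta1 (B := 1)) => [x|x]; [exact: cvg_cst|rewrite normr1].
rewrite {1}measurable_quadrants.
apply: (@dynkin_induction _ (M * M)%type quadrants (fun A => mcv \1_A)).
- exact: measurable_quadrants.
- exact: setI_quadrants.
- by rewrite indicT.
- exact: mcv_quadrant.
- move=> S mS cS.
  rewrite (_ : \1_(~` S) = fun x : R * R => 1 * 1 + (- 1) * \1_S x).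
    apply: lin => //; [exact: sq_integrable_cstU|exact: sq_integrable_indic].
  apply/funext => x; rewrite !indicE in_setC; case: (x \in S) => /=; lra.
- move=> F mF tF cF.
  (* Disjointness makes the indicators of the finite unions additive, so linearity applies; they
     converge, boundedly and pointwise, to the indicator of the whole union. *)
  pose G n := \big[setU/set0]_(i < n) F i.
  have mG n : measurable (G n) by exact: bigsetU_measurable.
  have cG n : mcv (\1_(G n)).
    elim: n => [|n IH].
      rewrite /G big_ord0 indic0.
      by apply: (mcv_cont oU cvxU bU teta eta0 eta1 (B := 1)) => [x|x]; [exact: cvg_cst|rewrite normr0].
    rewrite (_ : \1_(G n.+1) = fun x : R * R => 1 * \1_(G n) x + 1 * \1_(F n) x).
      apply: lin => //; exact: sq_integrable_indic.
    apply/funext => x; rewrite !mul1r !indicE /G big_ord_recr/= in_setU.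
    case: (boolP (x \in F n)) => [xF|]; last by rewrite orbF addr0.
    have /negbTE -> : x \notin \big[setU/set0]_(i < n) F i.
      apply/negP; rewrite inE -bigcup_mkord => -[i /= ilt Fi].
      move: tF => /trivIsetP/(_ i n I I); rewrite ltn_eqF// => /(_ isT).
      by move=> /seteqP[/(_ x) + _]; apply; split => //; move: xF; rewrite inE.
    by rewrite orbT add0r.
  apply: (mcv_limit _ (fun n => sq_integrable_indic (mG n)) cG).
    apply: sq_integrable_indic; exact: bigcup_measurable.
  apply: (dominated_l2 mU' _ _ (sq_integrable_cstU 2)).
  + by move=> n; exact: measurable_indic.
  + by apply: measurable_indic; exact: bigcup_measurable.
  + apply: aeW => x _; apply: cvg_near_cst.
    have [[i _ Fi]|nF] := pselect ((\bigcup_i F i) x).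
      near=> n; rewrite !indicE [in RHS]mem_set; last by exists i.
      rewrite mem_set// /G -bigcup_mkord; exists i => //=.
      near: n; exact: nbhs_infty_gt.
    near=> n; rewrite !indicE [in RHS]memNset// memNset// /G -bigcup_mkord => -[i _ Fi].
    by apply: nF; exists i.
  + move=> k x _; apply: (le_trans (ler_normB _ _)).
    by rewrite -[leRHS]/(1 + 1) lerD// indicE; case: (_ \in _); rewrite ?normr1 ?normr0.
Unshelve. all: by end_near. Qed.

Lemma mcv_nnsfun (f : {nnsfun (M * M)%type >-> R}) : sq_integrable mu U' f /\ mcv f.
Proof.
have -> : (f : M * M -> R) = (fun x : R * R =>
    \sum_(y <- finmap.enum_fset (fset_set (range f))) y * \1_(f @^-1` [set y]) x).
  apply/funext => x; rewrite fimfunE fsbig_finite//=; exact: fimfunP.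
elim: (finmap.enum_fset _) => [|y s [IH1 IH2]].
  rewrite (_ : (fun x => _) = fun=> 0); last by apply/funext => x; rewrite big_nil.
  split; first exact: sq_integrable_cstU.
  by apply: (mcv_cont oU cvxU bU teta eta0 eta1 (B := 1)) => [x|x]; [exact: cvg_cst|rewrite normr0].
have mA : measurable (f @^-1` [set y]) by exact: measurable_sfunP.
rewrite (_ : (fun x => _) = fun x : R * R => y * \1_(f @^-1` [set y]) x +
   1 * \sum_(z <- s) z * \1_(f @^-1` [set z]) x); last first.
  by apply/funext => x; rewrite big_cons mul1r.
have lA := sq_integrable_indic mA.
split; last by apply: lin => //; exact: mcv_indic.
by apply: (sq_integrableD mU'); exact: (sq_integrableZ mU').
Qed.

Lemma mcv_ge0 v : sq_integrable mu U' v -> (forall x, 0 <= v x) -> mcv v.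
Proof.
move=> lv v0; have [mv v2] := lv.
have [g [gnd gcv]] := approximation mU' ((measurable_EFinP _ _).2 mv) (fun t _ => v0 t).
have gc x : U x -> g n x @[n --> \oo] --> v x.
  move=> Ux; have /fine_cvgP[_] := gcv x Ux; exact.
apply: (mcv_limit lv (fun n => (mcv_nnsfun (g n)).1) (fun n => (mcv_nnsfun (g n)).2)).
apply: (dominated_l2 mU' _ mv lv).
- by move=> n; have [] := (mcv_nnsfun (g n)).1.
- exact: aeW.
- move=> n x Ux; have gle : g n x <= v x.
    have nd : nondecreasing_seq (fun n => g n x).
      by move=> i j ij; have /lefP := gnd i j ij; exact.
    have := nondecreasing_cvgn_le nd (cvgP _ (gc x Ux)) n.
    by rewrite (cvg_lim _ (gc x Ux)).
  by rewrite ler0_norm ?subr_le0// opprB lerBlDr lerDl.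
Qed.

Theorem mcv_L2 v : sq_integrable mu U' v -> mcv v.
Proof.
move=> lv; have [mv v2] := lv.
pose p x := Num.max (v x) 0; pose q x := Num.max (- v x) 0.
have lp : sq_integrable mu U' p.
  apply: (sq_integrable_le mU' _ lv).
    by apply: measurable_maxr => //; exact: measurable_cst.
  move=> x _; rewrite /p; case: (leP (v x) 0) => h.
    by rewrite normr0.
  by [].
have lq : sq_integrable mu U' q.
  apply: (sq_integrable_le mU' _ lv).
    by apply: measurable_maxr; [exact: measurableT_comp|exact: measurable_cst].
  move=> x _; rewrite /q; case: (leP (- v x) 0) => h.
    by rewrite normr0.
  by rewrite normrN.
have -> : v = fun x => 1 * p x + (- 1) * q x.
  apply/funext => x; rewrite mul1r mulN1r /p /q.
  case: (leP (v x) 0) => h1; case: (leP (- v x) 0) => h2; lra.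
by apply: lin => //; apply: mcv_ge0 => // x; rewrite /p /q le_max lexx orbT.
Qed.

End density.

(** * Weak derivatives *)

Section weak_derivatives.
Variable R : realType.
Notation M := (measurableTypeR R).
Notation mu := (@area R).
Implicit Types (v g : R * R -> R) (x y w : R * R).
Notation Dx := (fun f => (fun x => 'D_(@dx R) f x)).
Notation Dy := (fun f => (fun x => 'D_(@dy R) f x)).

Variables (U : set (R * R)) (D : R).
Hypothesis oU : open U.
Hypothesis cvxU : forall x y l, U x -> U y -> 0 < l < 1 ->
  U (l * x.1 + (1 - l) * y.1, l * x.2 + (1 - l) * y.2).
Hypothesis bU : forall x, U x -> `|x.1| <= D /\ `|x.2| <= D.
Variable p0 : R * R.
Hypothesis Up0 : U p0.

Notation U' := (U : set (M * M)).
Let mU' : measurable U' := mU oU.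

Lemma mollifier_exists : exists eta : R * R -> R,
  [/\ test_fun U eta, forall x, 0 <= eta x & (\int[mu]_p (eta p)%:E = 1)%E].
Proof.
have [h [th h0 hp]] := bump oU Up0.
have ch : continuous h by apply: smooth_cont; case: th.
have mh : measurable_fun (setT : set (M * M)) h by exact: (@continuous_measurable2 R setT).
have mhE : measurable_fun (setT : set (M * M)) (fun x => (h x)%:E) by exact/measurable_EFinP.
have [B B0 hB] := test_fun_bounded th.
pose c := (\int[mu]_x (h x)%:E)%E.
have c_fin : (c < +oo)%E.
  apply: (@le_lt_trans _ _ (\int[mu]_(x in U') B%:E)%E).
    rewrite [leRHS]integral_mkcond; apply: ge0_le_integral => //.
    - by move=> x _; rewrite lee_fin.
    - by apply/(measurable_restrictT _ mU'); exact: measurable_cst.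
    - move=> x _; rewrite patchE; case: ifPn => [_|/negP]; rewrite ?inE ?lee_fin.
        by rewrite (le_trans (ler_norm _)).
      by move=> /(test_fun_out th) ->.
  rewrite integral_cst//.
  have := area_lty oU bU; rewrite -ge0_fin_numE// => /fineK <-.
  by rewrite -EFinM ltry.
(* By continuity h exceeds h p0 / 2 on a square around p0, which has positive area. *)
have c_pos : (0 < c)%E.
  have hp2 : 0 < h p0 / 2 by rewrite divr_gt0.
  have /cvgrPdist_lt/(_ _ hp2)/nbhs_ballP[r /= r0 Hr] := ch p0.
  pose A : set (M * M) := `](p0.1 - r), (p0.1 + r)[%classic `*` `](p0.2 - r), (p0.2 + r)[%classic.
  have mA : measurable A by apply: measurableX; exact: measurable_itv.
  apply: (@lt_le_trans _ _ (\int[mu]_(x in A) (h p0 / 2)%:E)%E).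
    rewrite integral_cst// /A area_rect; [|exact: measurable_itv|exact: measurable_itv].
    rewrite !lebesgue_measure_itv/= !lte_fin !ltrD2l.
    have -> : - r < r by lra.
    rewrite -!EFinB -!EFinM lte_fin !mulr_gt0 ?invr_gt0//; lra.
  rewrite /c [leLHS]integral_mkcond; apply: ge0_le_integral => //.
  - by move=> x _; rewrite patchE; case: ifPn => // _; rewrite lee_fin ltW.
  - by apply/(measurable_restrictT _ mA); exact: measurable_cst.
  - move=> x _; rewrite patchE; case: ifPn => [|_]; last by rewrite lee_fin.
    rewrite inE => -[/=]; rewrite !in_itv/= -!ltr_distl => x1 x2.
    have : `|h p0 - h x| < h p0 / 2 by apply: Hr; split; rewrite /ball/= distrC.
    rewrite lee_fin => /(le_lt_trans (ler_norm _)); lra.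
have cf : c = (fine c)%:E by rewrite fineK// ge0_fin_numE// ltW.
have c0 : 0 < fine c by rewrite fine_gt0// c_pos.
exists (fun x => (fine c)^-1 * h x); split.
- by apply: test_fun_mul_smooth => //; exact: smooth_cst.
- by move=> x; rewrite mulr_ge0// invr_ge0 ltW.
- under eq_integral do rewrite EFinM.
  rewrite ge0_integralZl//; last 2 first.
  + by move=> x _; rewrite lee_fin.
  + by rewrite lee_fin invr_ge0 ltW.
  by rewrite -/c cf /= -EFinM mulVf// gt_eqF.
Qed.

(** The kernel of the mollifier is itself a test function, so every average of h vanishes on U,
    while the averages converge to h. *)
Lemma test_orthogonal_eq0 (h : R * R -> R) : inL2 U h ->
  (forall f, test_fun U f -> \int[mu]_(x in U') (h x * f x) = 0) ->
  ae_eq mu U' h (cst 0).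
Proof.
move=> lh orth; have [eta [teta eta0 eta1]] := mollifier_exists.
have cv := mcv_L2 oU cvxU bU teta eta0 eta1 lh.
apply: (l2norm_eq0 mU' lh).
have E n : l2norm mu U' (fun x => moll U eta (lam R n) h x - h x) = l2norm mu U' h.
  rewrite -[RHS]mul1r -(normrN1 R) -(l2normZ mU')//.
  apply: eq_l2norm => x; rewrite inE => Ux.
  rewrite /moll orth ?sub0r ?mulN1r//.
  by apply: (test_fun_ker cvxU teta) => //; exact: lam01.
move: cv; rewrite /mcv (_ : (fun n => _) = fun=> l2norm mu U' h); last exact/funext.
by move=> /(cvg_lim (@norm_hausdorff _ _)); rewrite lim_cst.
Qed.

Lemma weak_deriv_unique e v g g' : is_weak_deriv U e v g -> is_weak_deriv U e v g' ->
  ae_eq mu U' g g'.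
Proof.
move=> [lg Hg] [lg' Hg'].
have lgg := sq_integrableB mU' lg lg'.
have := @test_orthogonal_eq0 (fun x => g x - g' x) lgg.
have H f : test_fun U f -> \int[mu]_(x in U') ((g x - g' x) * f x) = 0.
  move=> tf.
  have lf : sq_integrable mu U' f.
    have [B B0 hB] := test_fun_bounded tf.
    apply: (sq_integrable_le mU' _ (sq_integrable_cstU oU bU B)) => [|x _].
      by apply: (@continuous_measurable2 R U) => //; apply: smooth_cont; case: tf.
    by rewrite (gtr0_norm B0).
  have i1 := sq_integrableM mU' lg lf; have i2 := sq_integrableM mU' lg' lf.
  have := Rintegral_lin2 1 (-1) mU' i1 i2.
  rewrite mul1r mulN1r.
  have -> : \int[mu]_(x in U') (g x * f x) = \int[mu]_(x in U') (g' x * f x).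
    by apply: oppr_inj; rewrite -[LHS](Hg f tf) -[RHS](Hg' f tf).
  rewrite subrr => <-; apply: eq_Rintegral => x _.
  by rewrite mul1r mulN1r mulrBl.
move=> /(_ H); apply: filterS => x /= E Ux; apply/eqP.
by rewrite -subr_eq0; apply/eqP; exact: E.
Qed.

(** The kernel depends on w - l x only, so a derivative in x is - l times the derivative in w, the
    variable in which a weak derivative of v can be tested. *)
Lemma is_derive_moll eta l v x e : test_fun U eta -> 0 < l < 1 -> U x -> inL2 U v ->
  is_derive x e (moll U eta l v)
   (- l * \int[mu]_(w in U') (v w * 'D_e (ker eta l x) w)).
Proof.
move=> teta l01 Ux lv; have iv := sq_integrable_int oU bU lv.
have m0 : 1 - l != 0 by move/andP: l01 => [_ l1]; rewrite gt_eqF// subr_gt0.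
pose a := - (l / (1 - l)); pose c := (1 - l)^-1.
have -> : moll U eta l v = (1 - l) ^- 2 \*: kint U v a c eta.
  by apply/funext => z; exact: mollE.
have [seta _ _] := teta.
have H := is_deriveZ ((1 - l) ^- 2) (is_derive_kint mU' iv a c x e teta).
apply: is_derive_eq H _.
have ix := integrable_kint mU' iv a c x (test_funDx teta).
have iy := integrable_kint mU' iv a c x (test_funDy teta).
have E w : 'D_e (ker eta l x) w = (1 - l) ^- 2 * c * (e.1 * Dx eta (a * x.1 + c * w.1, a * x.2 + c * w.2)
   + e.2 * Dy eta (a * x.1 + c * w.1, a * x.2 + c * w.2)).
  have := derive_scale c (a * x.1) (a * x.2) e w seta.
  move=> /(is_deriveZ ((1 - l) ^- 2)) [_ K].
  have kE : ker eta l x = (1 - l) ^- 2 \*: (fun w : R * R => eta (c * w.1 + a * x.1, c * w.2 + a * x.2)).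
    by apply/funext => z; rewrite /ker /= -/a -/c; congr (_ * eta (_, _)); rewrite addrC.
  rewrite kE K /GRing.scale/= mulrA ![c * w.1 + _]addrC ![c * w.2 + _]addrC.
  by [].
have -> : \int[mu]_(w in U') (v w * 'D_e (ker eta l x) w) =
   (1 - l) ^- 2 * c * (e.1 * kint U v a c (Dx eta) x + e.2 * kint U v a c (Dy eta) x).
  have := Rintegral_lin2 ((1 - l) ^- 2 * c * e.1) ((1 - l) ^- 2 * c * e.2) mU' ix iy.
  rewrite -/(kint U v a c (Dx eta) x) -/(kint U v a c (Dy eta) x).
  move: (kint U v a c (Dx eta) x) (kint U v a c (Dy eta) x) => A B L.
  have -> : (1 - l) ^- 2 * c * (e.1 * A + e.2 * B) =
    (1 - l) ^- 2 * c * e.1 * A + (1 - l) ^- 2 * c * e.2 * B by ring.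
  apply: etrans L; apply: eq_Rintegral => w _; rewrite E.
  move: ('D_ _ _ _) ('D_ _ _ _) (v w) => A' B' C'; move: ((1 - l) ^- 2) => t; ring.
rewrite /GRing.scale/=.
move: (kint _ _ _ _ _ _) (kint _ _ _ _ _ _) => A B.
by rewrite /a /c; field.
Qed.

(** On U the derivative of the average of v is l times the average of the weak derivative, so the
    same convergence result serves v and both derivatives. *)
Theorem smooth_dense v gx gy : inL2 U v ->
  is_weak_deriv U (@dx R) v gx -> is_weak_deriv U (@dy R) v gy ->
  exists f : nat -> R * R -> R,
    [/\ forall n, smooth (f n),
        L2norm U (fun x => f n x - v x) @[n --> \oo] --> (0 : R),
        L2norm U (fun x => 'D_(@dx R) (f n) x - gx x) @[n --> \oo] --> (0 : R) &
        L2norm U (fun x => 'D_(@dy R) (f n) x - gy x) @[n --> \oo] --> (0 : R)].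
Proof.
move=> lv wx wy; have [eta [teta eta0 eta1]] := mollifier_exists.
have iv := sq_integrable_int oU bU lv.
suff key e g : is_weak_deriv U e v g ->
    L2norm U (fun x => 'D_e (moll U eta (lam R n) v) x - g x) @[n --> \oo] --> (0 : R).
  exists (fun n => moll U eta (lam R n) v); split; [| |exact: key|exact: key].
    by move=> n; exact: smooth_moll.
  exact: (mcv_L2 oU cvxU bU teta eta0 eta1 lv).
move=> [lg Hg]; have ig := sq_integrable_int oU bU lg.
have cg := mcv_L2 oU cvxU bU teta eta0 eta1 lg.
have E n x : U x -> 'D_e (moll U eta (lam R n) v) x = lam R n * moll U eta (lam R n) g x.
  move=> Ux; have [_ ->] := is_derive_moll e teta (lam01 R n) Ux lv.
  have T := test_fun_ker cvxU teta (lam01 R n) Ux.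
  rewrite mulNr -mulrN; congr (_ * _).
  by rewrite -[RHS]opprK; congr (- _); exact: (Hg _ T).
have sg n : sq_integrable mu U' (fun x => moll U eta (lam R n) g x - g x).
  by apply: (sq_integrableB mU') => //; exact: (moll_bound oU cvxU bU teta eta0 eta1 (lam01 R n) lg).1.
(* With m the average of g, l m - g = l (m - g) - (1 - l) g, and both summands tend to 0 in norm. *)
apply: (@squeeze_cvgr _ _ _ _ (fun=> 0)
   (fun n => lam R n * l2norm mu U' (fun x => moll U eta (lam R n) g x - g x) +
             (1 - lam R n) * l2norm mu U' g)).
- near=> n; rewrite sqrtr_ge0/=; have /andP[l0 l1] := lam01 R n.
  have -> : L2norm U (fun x => 'D_e (moll U eta (lam R n) v) x - g x) =
     l2norm mu U' (fun x => lam R n * (moll U eta (lam R n) g x - g x) + (lam R n - 1) * g x).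
    apply: (@eq_l2norm _ _ _ mu U') => x; rewrite inE => Ux; rewrite E//.
    by move: (moll _ _ _ _ _) (g x) => A B; ring.
  apply: (le_trans (l2norm_triangle mU' (sq_integrableZ mU' _ (sg n)) (sq_integrableZ mU' _ lg))).
  rewrite (l2normZ mU' _ (sg n)) (l2normZ mU' _ lg).
  by rewrite (gtr0_norm l0) ler0_norm ?opprB// subr_le0 ltW.
- exact: cvg_cst.
- rewrite -[X in _ --> X](_ : 1 * 0 + (1 - 1) * l2norm mu U' g = 0).
    by apply: cvgD; apply: cvgM; [exact: cvg_lam|exact: cg|apply: cvgB; [exact: cvg_cst|exact: cvg_lam]|exact: cvg_cst].
  by rewrite subrr mulr0 mul0r addr0.
Unshelve. all: by end_near. Qed.

End weak_derivatives.

(** * The divergence theorem on a triangle *)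

Section triangle.
Variable R : realType.
Notation M := (measurableTypeR R).
Notation mu := (@area R).
Notation leb := (@lebesgue_measure R).
Implicit Types (f g F G : R * R -> R) (x y p : R * R).

Lemma continuous_bounded_on (U : set (R * R)) (D : R) F :
  (forall x, U x -> `|x.1| <= D /\ `|x.2| <= D) -> continuous F ->
  exists2 B, 0 < B & forall x, U x -> `|F x| <= B.
Proof.
move=> bU cF.
have cK : compact (`[- D, D]%classic `*` `[- D, D]%classic : set (R * R)).
  by apply: compact_setX; exact: segment_compact.
have [B B0 HB] := continuous_compact_bounded cK cF.
exists B => // x /bU [x1 x2]; apply: HB.
by split; rewrite /= in_itv/= -ler_norml.
Qed.

Lemma continuous_integrable (U : set (R * R)) (D : R) F : open U ->
  (forall x, U x -> `|x.1| <= D /\ `|x.2| <= D) -> continuous F ->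
  mu.-integrable (U : set (M * M)) (EFin \o F).
Proof.
move=> oU bU cF; have [B B0 HB] := continuous_bounded_on bU cF.
have mU := mU oU.
apply: (le_integrable mU _ _ (integrable_cstU oU bU B)).
  by apply/measurable_EFinP; exact: continuous_measurable2.
by move=> x Ux /=; rewrite lee_fin (gtr0_norm B0); exact: HB.
Qed.

Lemma ftc_patch (h dh : R -> R) (l : R) : 0 < l -> continuous dh ->
  (forall t : R, is_derive t (1 : R) h (dh t)) ->
  (\int[leb]_t ((EFin \o dh) \_ (`]0%R, l[%classic : set R)) t)%E = (h l - h 0)%:E.
Proof.
move=> l0 cdh dhE.
have ch : continuous h.
  by move=> t; apply: differentiable_continuous; apply/derivable1_diffP; case: (dhE t).
rewrite -integral_mkcond -(@integral_itv_bndoo R 0 l _ true false); last first.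
  apply/measurable_EFinP; apply: measurable_funTS.
  exact: continuous_measurable_fun.
rewrite (@continuous_FTC2 R dh h 0 l l0) ?EFinB//.
- exact: continuous_subspaceT.
- split.
  + by move=> t _; case: (dhE t).
  + by apply: cvg_at_right_filter; exact: ch.
  + by apply: cvg_at_left_filter; exact: ch.
- by move=> t _; rewrite derive1E; case: (dhE t).
Qed.

Definition reftri : set (R * R) := [set p | [/\ 0 < p.1, 0 < p.2 & p.1 + p.2 < 1]].

Lemma open_lin (c1 c2 c0 : R) : open [set p : R * R | 0 < c1 * p.1 + c2 * p.2 + c0].
Proof.
rewrite (_ : [set _ | _] = (fun p : R * R => c1 * p.1 + c2 * p.2 + c0) @^-1` [set u | 0 < u]) //.
apply: open_comp; last exact: open_gt.
by move=> p _; exact: continuous_lin.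
Qed.

Lemma open_reftri : open reftri.
Proof.
rewrite (_ : reftri = [set p : R * R | 0 < 1 * p.1 + 0 * p.2 + 0] `&`
  [set p : R * R | 0 < 0 * p.1 + 1 * p.2 + 0] `&` [set p : R * R | 0 < -1 * p.1 + -1 * p.2 + 1]).
  by do 2?apply: openI; exact: open_lin.
by apply/seteqP; split=> p; rewrite /reftri/= => -[]; [move=> ? ? ?; split; [split|]|move=> -[] ? ? ?; split]; lra.
Qed.

Lemma bounded_reftri x : reftri x -> `|x.1| <= 1 /\ `|x.2| <= 1.
Proof. by case=> h1 h2 h3; rewrite !ler_norml; split; lra. Qed.

(** Fubini with vertical sections and the fundamental theorem on each; outside 0 < s < 1 the section
    is empty. The next lemma exchanges the axes. *)
Lemma ftc_reftri_y G g : continuous g -> continuous G ->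
  (forall s t : R, is_derive t (1 : R) (fun t => G (s, t)) (g (s, t))) ->
  \int[mu]_(x in (reftri : set (M * M))) g x = \int[leb]_(s in `[0, 1]) (G (s, 1 - s) - G (s, 0)).
Proof.
move=> cg cG dG; rewrite /Rintegral; congr fine.
have mT : measurable (reftri : set (M * M)) := mU open_reftri.
have ig := continuous_integrable open_reftri bounded_reftri cg.
move/(integrable_mkcond _ mT) : ig => ig.
rewrite [LHS]integral_mkcond -[LHS](integral12_prod_meas1 ig).
have E : fubini_F leb ((EFin \o g) \_ (reftri : set (M * M))) =
  ((EFin \o (fun s : R => G (s, 1 - s) - G (s, 0))) \_ (`]0%R, 1%R[%classic : set R)).
  apply/funext => s; rewrite /fubini_F patchE; case: ifPn => [|/negP].
    rewrite inE /= in_itv/= => /andP[s0 s1].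
    have s1' : 0 < 1 - s by rewrite subr_gt0.
    rewrite -(@ftc_patch (fun t => G (s, t)) (fun t => g (s, t)) _ s1').
    - apply: eq_integral => t _; rewrite !patchE; congr (if _ then _ else _).
      apply/idP/idP; rewrite !inE /reftri /= in_itv/=.
        by case=> _ -> /=; lra.
      by move=> /andP[h1 h2]; split=> //; lra.
    - move=> t; apply: (@continuous_comp _ _ _ (fun t : R => (s, t)) g); last exact: cg.
      by apply: (@continuous_pair R R R (fun=> s) id) => ? //; exact: cvg_cst.
  rewrite inE /= in_itv/= => ns.
  apply: integral0_eq => t _; rewrite patchE ifF//; apply/negP; rewrite inE => -[/= h1 h2 h3].
  by apply: ns; apply/andP; split; lra.
rewrite E -integral_mkcond -(@integral_itv_bndoo R 0 1 _ true false)//.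
apply/measurable_EFinP; apply: measurable_funTS.
apply: continuous_measurable_fun => s; apply: cvgB.
  apply: (@continuous_comp _ _ _ (fun s : R => (s, 1 - s)) G); last exact: cG.
  by apply: (@continuous_pair R R R id (fun s => 1 - s)) => ? //; apply: cvgB; [exact: cvg_cst|exact: cvg_id].
apply: (@continuous_comp _ _ _ (fun s : R => (s, 0)) G); last exact: cG.
by apply: (@continuous_pair R R R id (fun=> 0)) => ? //; exact: cvg_cst.
Qed.

Lemma ftc_reftri_x G g : continuous g -> continuous G ->
  (forall s t : R, is_derive s (1 : R) (fun s => G (s, t)) (g (s, t))) ->
  \int[mu]_(x in (reftri : set (M * M))) g x = \int[leb]_(t in `[0, 1]) (G (1 - t, t) - G (0, t)).
Proof.
move=> cg cG dG; rewrite /Rintegral; congr fine.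
have mT : measurable (reftri : set (M * M)) := mU open_reftri.
have ig := continuous_integrable open_reftri bounded_reftri cg.
move/(integrable_mkcond _ mT) : ig => ig.
rewrite [LHS]integral_mkcond -[LHS](integral21_prod_meas1 ig).
have E : fubini_G leb ((EFin \o g) \_ (reftri : set (M * M))) =
  ((EFin \o (fun s : R => G (1 - s, s) - G (0, s))) \_ (`]0%R, 1%R[%classic : set R)).
  apply/funext => s; rewrite /fubini_G patchE; case: ifPn => [|/negP].
    rewrite inE /= in_itv/= => /andP[s0 s1].
    have s1' : 0 < 1 - s by rewrite subr_gt0.
    rewrite -(@ftc_patch (fun t => G (t, s)) (fun t => g (t, s)) _ s1').
    - apply: eq_integral => t _; rewrite !patchE; congr (if _ then _ else _).
      apply/idP/idP; rewrite !inE /reftri /= in_itv/=.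
        by case=> -> _ /=; lra.
      by move=> /andP[h1 h2]; split=> //; lra.
    - move=> t; apply: (@continuous_comp _ _ _ (fun t : R => (t, s)) g); last exact: cg.
      by apply: (@continuous_pair R R R id (fun=> s)) => ? //; exact: cvg_cst.
  rewrite inE /= in_itv/= => ns.
  apply: integral0_eq => t _; rewrite patchE ifF//; apply/negP; rewrite inE => -[/= h1 h2 h3].
  by apply: ns; apply/andP; split; lra.
rewrite E -integral_mkcond -(@integral_itv_bndoo R 0 1 _ true false)//.
apply/measurable_EFinP; apply: measurable_funTS.
apply: continuous_measurable_fun => s; apply: cvgB.
  apply: (@continuous_comp _ _ _ (fun s : R => (1 - s, s)) G); last exact: cG.
  by apply: (@continuous_pair R R R (fun s => 1 - s) id) => ? //; apply: cvgB; [exact: cvg_cst|exact: cvg_id].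
apply: (@continuous_comp _ _ _ (fun s : R => (0, s)) G); last exact: cG.
by apply: (@continuous_pair R R R (fun=> 0) id) => ? //; exact: cvg_cst.
Qed.

Lemma continuous_line p (v : R * R) : continuous (fun t : R => (p.1 + t * v.1, p.2 + t * v.2)).
Proof.
have cl (k l : R) : continuous (fun t : R => k + t * l).
  by move=> t; apply: cvgD; [exact: cvg_cst|apply: cvgM; [exact: cvg_id|exact: cvg_cst]].
by apply: continuous_pair.
Qed.

Lemma integrable01 (h : R -> R) : continuous h -> leb.-integrable `[0, 1] (EFin \o h).
Proof.
move=> ch; apply: continuous_compact_integrable; first exact: segment_compact.
exact: continuous_subspaceT.
Qed.

Lemma Rintegral01_onem (h : R -> R) : continuous h ->
  \int[leb]_(t in `[0, 1]) h (1 - t) = \int[leb]_(t in `[0, 1]) h t.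
Proof.
move=> ch; have := @Rintegration_by_substitution_onem R h 1.
rewrite ler01 lexx unstable.onem1 => E; rewrite E//; exact: continuous_subspaceT.
Qed.

Lemma continuous_edge (e : (R * R) * (R * R)) : continuous (edge_point e).
Proof. by have := @continuous_line e.1 (e.2.1 - e.1.1, e.2.2 - e.1.2). Qed.

Definition edge_mean (e : (R * R) * (R * R)) F : R := \int[leb]_(t in `[0, 1]) F (edge_point e t).

Lemma continuous_edge_comp e F : continuous F -> continuous (F \o edge_point e).
Proof. by move=> cF t; apply: continuous_comp; [exact: continuous_edge|exact: cF]. Qed.

Lemma edge_meanB e F G : continuous F -> continuous G ->
  edge_mean e (fun x => F x - G x) = edge_mean e F - edge_mean e G.
Proof.
move=> cF cG; rewrite /edge_mean RintegralB//; apply: integrable01; exact: continuous_edge_comp.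
Qed.

Variables (b H : R).
Hypothesis H0 : 0 < H.
Let Hn0 : H != 0. Proof. exact: lt0r_neq0. Qed.

(** The open triangle with vertices (0, 0), (1, 0) and (b, H), as the preimage of the reference
    triangle under the inverse of [phi]; the two arguments are the barycentric coordinates of (1, 0)
    and (b, H). *)
Definition tri : set (R * R) := [set x | reftri (x.1 - b / H * x.2, x.2 / H)].
Definition phi p : R * R := (p.1 + b * p.2, H * p.2).

Lemma triE : tri = [set p : R * R | 0 < 1 * p.1 + (- (b / H)) * p.2 + 0] `&`
  [set p : R * R | 0 < 0 * p.1 + H^-1 * p.2 + 0] `&`
  [set p : R * R | 0 < -1 * p.1 + (b / H - H^-1) * p.2 + 1].
Proof.
apply/seteqP; split=> p; rewrite /tri /reftri/= => -[].
  by move=> h1 h2 h3; split; [split|]; nra.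
by move=> -[] h1 h2 h3; split; nra.
Qed.

Lemma open_tri : open tri.
Proof. by rewrite triE; do 2?apply: openI; exact: open_lin. Qed.

Lemma tri_phi p : tri (phi p) = reftri p.
Proof.
rewrite /tri /phi /=; congr reftri; rewrite [RHS]surjective_pairing; congr pair; field => //.
Qed.

Lemma convex_tri x y l : tri x -> tri y -> 0 < l < 1 ->
  tri (l * x.1 + (1 - l) * y.1, l * x.2 + (1 - l) * y.2).
Proof.
case=> x1 x2 x3 [y1 y2 y3] /andP[l0 l1]; move: x1 x2 x3 y1 y2 y3 => /=.
set u1 := x.1 - _; set u2 := x.2 / H; set v1 := y.1 - _; set v2 := y.2 / H => x1 x2 x3 y1 y2 y3.
have E1 : l * x.1 + (1 - l) * y.1 - b / H * (l * x.2 + (1 - l) * y.2) = l * u1 + (1 - l) * v1.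
  by rewrite /u1 /v1; ring.
have E2 : (l * x.2 + (1 - l) * y.2) / H = l * u2 + (1 - l) * v2.
  by rewrite /u2 /v2; ring.
by split; rewrite /= ?E1 ?E2; nra.
Qed.

Definition tri_diam : R := 1 + `|b| + H.

Lemma bounded_tri x : tri x -> `|x.1| <= tri_diam /\ `|x.2| <= tri_diam.
Proof.
case=> /= h1 h2 h3; rewrite /tri_diam.
have e2 : x.2 = H * (x.2 / H) by field.
have e1 : x.1 = (x.1 - b / H * x.2) + b * (x.2 / H) by field.
move: h1 h2 h3 e1 e2; set u := x.1 - _; set w := x.2 / H => h1 h2 h3 e1 e2.
clearbody u w; have HH := ltW H0; have nb := normr_ge0 b.
split.
  rewrite e1 (le_trans (ler_normD _ _))// normrM (gtr0_norm h1) (gtr0_norm h2).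
  have : `|b| * w <= `|b| by rewrite ler_piMr//; lra.
  by move: (`|b| * w) (`|b|) nb => B1 B2; lra.
have : H * w <= H by rewrite ler_piMr//; lra.
by rewrite e2 normrM (gtr0_norm h2) gtr0_norm//; move: (H * w) => A; lra.
Qed.

Lemma tri_ne : tri (phi (3^-1, 3^-1)).
Proof. by rewrite tri_phi /reftri; split => /=; lra. Qed.

Lemma integrable_tri F : continuous F -> mu.-integrable (tri : set (M * M)) (EFin \o F).
Proof. exact: (continuous_integrable open_tri bounded_tri). Qed.

Lemma continuous_phi : continuous phi.
Proof.
apply: continuous_pair => p.
  apply: cvgD; first exact: cvg_fst.
  by apply: cvgM; [exact: cvg_cst|exact: cvg_snd].
by apply: cvgM; [exact: cvg_cst|exact: cvg_snd].
Qed.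

Lemma continuous_phi_comp F : continuous F -> continuous (F \o phi).
Proof. by move=> cF p; apply: continuous_comp; [exact: continuous_phi|exact: cF]. Qed.

Lemma ge0_int_tri F : continuous F -> (forall x, 0 <= F x) ->
  (\int[mu]_(x in (tri : set (M * M))) (F x)%:E =
   H%:E * \int[mu]_(x in (reftri : set (M * M))) (F (phi x))%:E)%E.
Proof.
move=> cF F0.
have mt : measurable (tri : set (M * M)) := mU open_tri.
rewrite [in LHS]integral_mkcond [in RHS]integral_mkcond.
have := @ge0_area_affine R 1 b H 0 0 ((EFin \o F) \_ (tri : set (M * M))) (oner_neq0 _) Hn0.
rewrite mul1r gtr0_norm// => E.
rewrite [X in (_ * X)%E](_ : _ = (H^-1%:E * \int[mu]_p ((EFin \o F) \_ (tri : set (M * M))) p)%E); last first.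
  rewrite -E.
  - apply: eq_integral => p _; rewrite !patchE.
    have -> : (1 * p.1 + b * p.2 + 0, H * p.2 + 0) = phi p by rewrite mul1r !addr0.
    congr (if _ then _ else _).
    by apply/idP/idP; rewrite !inE tri_phi.
  - apply/(measurable_restrictT _ mt); apply/measurable_EFinP.
    exact: continuous_measurable2.
  - by move=> x; rewrite patchE; case: ifP => //= _; rewrite lee_fin.
by rewrite muleA -EFinM divff// mul1e.
Qed.

(** The substitution is known for nonnegative continuous functions; 2 F is the difference of two
    such functions, |F| + F and |F| - F. *)
Lemma int_tri F : continuous F ->
  \int[mu]_(x in (tri : set (M * M))) F x =
  H * \int[mu]_(x in (reftri : set (M * M))) F (phi x).
Proof.
move=> cF.
have iF := integrable_tri cF.
have cFp := continuous_phi_comp cF.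
have ip := continuous_integrable open_reftri bounded_reftri cFp.
have mt : measurable (tri : set (M * M)) := mU open_tri.
have mr : measurable (reftri : set (M * M)) := mU open_reftri.
have c1 (s : R) : continuous (fun x => `|F x| + s * F x).
  move=> x; apply: cvgD; first by apply: cvg_norm; exact: cF.
  by apply: cvgM; [exact: cvg_cst|exact: cF].
have g1 (s : R) x : `|s| = 1 -> 0 <= `|F x| + s * F x.
  move=> s1; have := ler_norm (- (s * F x)); rewrite normrN normrM s1 mul1r; lra.
have E (s : R) : `|s| = 1 -> \int[mu]_(x in (tri : set (M * M))) (`|F x| + s * F x) =
    H * \int[mu]_(x in (reftri : set (M * M))) (`|F (phi x)| + s * F (phi x)).
  move=> s1; rewrite /Rintegral (ge0_int_tri (c1 s)); last by move=> x; exact: g1.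
  rewrite fineM//; apply: integrable_fin_num => //.
  exact: (continuous_integrable open_reftri bounded_reftri (continuous_phi_comp (c1 s))).
have E1 := E 1 (normr1 _); have E2 := E (-1) (normrN1 _).
have L1 := RintegralB mt (integrable_tri (c1 1)) (integrable_tri (c1 (-1))).
have ir s := continuous_integrable open_reftri bounded_reftri (continuous_phi_comp (c1 s)).
have L2 := RintegralB mr (ir 1) (ir (-1)).
have D1 u : `|u| + 1 * u - (`|u| + -1 * u) = 2 * u :> R by ring.
rewrite E1 E2 in L1.
have X1 : \int[mu]_(x in (tri : set (M * M))) (2 * F x) = 2 * \int[mu]_(x in (tri : set (M * M))) F x.
  by rewrite RintegralZl.
have X2 : \int[mu]_(x in (reftri : set (M * M))) (2 * F (phi x)) = 2 * \int[mu]_(x in (reftri : set (M * M))) F (phi x).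
  by rewrite RintegralZl.
have Y1 : \int[mu]_(x in (tri : set (M * M))) (2 * F x) =
    H * \int[mu]_(x in (reftri : set (M * M))) (2 * F (phi x)).
  have -> : \int[mu]_(x in (tri : set (M * M))) (2 * F x) =
      \int[mu]_(x in (tri : set (M * M))) (`|F x| + 1 * F x - (`|F x| + -1 * F x)).
    by apply: eq_Rintegral => x _; rewrite D1.
  rewrite [LHS]L1.
  by rewrite -mulrBr -[in LHS]L2; congr (_ * _); apply: eq_Rintegral => x _; exact: D1.
move: Y1; rewrite X1 X2; move: (Rintegral _ _ _) (Rintegral _ _ _) => A B; lra.
Qed.

Definition tri_e1 : (R * R) * (R * R) := ((0, 0), (1, 0)).
Definition tri_e2 : (R * R) * (R * R) := ((b, H), (0, 0)).
Definition tri_e3 : (R * R) * (R * R) := ((1, 0), (b, H)).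

(** The directions (1, 0) and (b, H), here and in the next lemma, are the images of the coordinate
    axes of the reference triangle: lines parallel to (1, 0) run from OB to AB, lines parallel to
    (b, H) from OA to AB. The factor H is the Jacobian. *)
Lemma int_tri_dx f : smooth f -> \int[mu]_(x in (tri : set (M * M))) 'D_(@dx R) f x =
  H * (edge_mean tri_e3 f - edge_mean tri_e2 f).
Proof.
move=> sf; have cf := smooth_cont sf; have cdf := smooth_cont (smoothDx sf).
rewrite int_tri//; congr (_ * _).
transitivity (\int[leb]_(t in `[0, 1]) (f (phi (1 - t, t)) - f (phi (0, t)))).
  apply: (@ftc_reftri_x (f \o phi) (fun p => 'D_(@dx R) f (phi p))).
  - exact: (continuous_phi_comp cdf).
  - exact: continuous_phi_comp.
  move=> s t; have := @smooth_lineE R f (b * t, H * t) (@dx R) s sf.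
  have Ep u : (b * t + u * 1, H * t + u * 0) = phi (u, t) by rewrite /phi /=; congr pair; ring.
  rewrite /dx /= mul1r mul0r addr0 Ep (_ : (fun t0 => _) = (fun u : R => f (phi (u, t))))//.
  by apply/funext => u; rewrite Ep.
(* [tri_e2] runs from (b, H) to the origin, against the parameter of the double integral. *)
rewrite /edge_mean -(Rintegral01_onem (h := f \o edge_point tri_e2)); last exact: continuous_edge_comp.
rewrite -RintegralB//.
- apply: eq_Rintegral => t _; rewrite /phi /edge_point /=; congr (f _ - f _); congr pair; ring.
- exact/integrable01/continuous_edge_comp.
- apply: integrable01 => t.
  apply: (@continuous_comp _ _ _ (fun t : R => 1 - t) (f \o edge_point tri_e2)).
    by apply: cvgB; [exact: cvg_cst|exact: cvg_id].
  exact: continuous_edge_comp.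
Qed.

Lemma int_tri_dw f : smooth f ->
  \int[mu]_(x in (tri : set (M * M))) (b * 'D_(@dx R) f x + H * 'D_(@dy R) f x) =
  H * (edge_mean tri_e3 f - edge_mean tri_e1 f).
Proof.
move=> sf; have cf := smooth_cont sf.
have cdf : continuous (fun x => b * 'D_(@dx R) f x + H * 'D_(@dy R) f x).
  apply: smooth_cont; apply: smoothD; apply: smoothZ; [exact: smoothDx|exact: smoothDy].
rewrite int_tri//; congr (_ * _).
transitivity (\int[leb]_(t in `[0, 1]) (f (phi (t, 1 - t)) - f (phi (t, 0)))).
  apply: (@ftc_reftri_y (f \o phi) (fun p => b * 'D_(@dx R) f (phi p) + H * 'D_(@dy R) f (phi p))).
  - exact: (continuous_phi_comp cdf).
  - exact: continuous_phi_comp.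
  move=> s t; have := @smooth_lineE R f (s, 0) (b, H) t sf.
  have Ep u : (s + u * b, 0 + u * H) = phi (s, u) by rewrite /phi /=; congr pair; ring.
  rewrite /= Ep (_ : (fun t0 => _) = (fun u : R => f (phi (s, u))))//.
  by apply/funext => u; rewrite Ep.
rewrite /edge_mean -(Rintegral01_onem (h := f \o edge_point tri_e3)); last exact: continuous_edge_comp.
rewrite -RintegralB//.
- apply: eq_Rintegral => t _; rewrite /phi /edge_point /=; congr (f _ - f _); congr pair; ring.
- apply: integrable01 => t.
  apply: (@continuous_comp _ _ _ (fun t : R => 1 - t) (f \o edge_point tri_e3)).
    by apply: cvgB; [exact: cvg_cst|exact: cvg_id].
  exact: continuous_edge_comp.
- exact/integrable01/continuous_edge_comp.
Qed.

End triangle.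

(** * The Poincare inequality *)

Section segments.
Variable R : realType.
Notation M := (measurableTypeR R).
Notation mu := (@area R).
Notation leb := (@lebesgue_measure R).
Implicit Types (f : R * R -> R) (x y p : R * R).

Lemma ftc01 (h dh : R -> R) : continuous dh ->
  (forall t : R, is_derive t (1 : R) h (dh t)) ->
  \int[leb]_(t in `[0, 1]) dh t = h 1 - h 0.
Proof.
move=> cdh dhE; have := @ftc_patch R h dh 1 ltr01 cdh dhE.
rewrite -integral_mkcond -(@integral_itv_bndoo R 0 1 _ true false); last first.
  apply/measurable_EFinP; apply: measurable_funTS.
  exact: continuous_measurable_fun.
by rewrite /Rintegral => ->.
Qed.

Lemma continuous_sqr (T : topologicalType) (h : T -> R) : continuous h -> continuous (fun t => h t ^+ 2).
Proof.
move=> ch; rewrite (_ : (fun t => h t ^+ 2) = fun t => h t * h t).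
  by move=> t; apply: cvgM; exact: ch.
by apply/funext => t; rewrite expr2.
Qed.

Lemma sq_integrable01 (h : R -> R) : continuous h -> sq_integrable leb `[0, 1] h.
Proof.
move=> ch; split; last by apply: integrable01; exact: continuous_sqr.
by apply: measurable_funTS; exact: continuous_measurable_fun.
Qed.

Lemma leb01 : leb (`[0, 1]%classic : set M) = 1%E.
Proof. by rewrite lebesgue_measure_itv/= lte_fin ltr01 -EFinB subr0. Qed.

Lemma l2norm01_cst (k : R) : l2norm leb (`[0, 1] : set R) (fun=> k) = `|k|.
Proof.
have E : fine (leb (`[0, 1]%classic : set M)) = 1 by rewrite leb01.
by rewrite /l2norm Rintegral_cst// E mulr1 sqrtr_sqr.
Qed.

Lemma sqr_int01 (h : R -> R) : continuous h ->
  (\int[leb]_(t in `[0, 1]) h t) ^+ 2 <= \int[leb]_(t in `[0, 1]) (h t ^+ 2).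
Proof.
move=> ch; have m01 : measurable (`[0, 1]%classic : set M) by [].
have s1 : sq_integrable leb `[0, 1] (fun=> 1 : R) by apply: sq_integrable01 => t; exact: cvg_cst.
have := cauchy_schwarz m01 s1 (sq_integrable01 ch).
under eq_Rintegral do rewrite mul1r.
rewrite l2norm01_cst normr1 mul1r -l2norm_sqr//.
move=> H; rewrite -real_normK ?num_real//.
by rewrite lerXn2r ?nnegrE ?l2norm_ge0.
Qed.

Definition gradsq f x : R := 'D_(@dx R) f x ^+ 2 + 'D_(@dy R) f x ^+ 2.

Lemma gradsq_ge0 f x : 0 <= gradsq f x.
Proof. by rewrite addr_ge0// sqr_ge0. Qed.

Lemma continuous_gradsq f : smooth f -> continuous (gradsq f).
Proof.
move=> sf x.
have c1 := continuous_sqr (smooth_cont (smoothDx sf)).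
have c2 := continuous_sqr (smooth_cont (smoothDy sf)).
by apply: cvgD; [exact: c1|exact: c2].
Qed.

(** Fundamental theorem along the segment, Jensen on [0, 1], then Cauchy-Schwarz in the plane. The
    squared length is absorbed in k, so that the integrand depends on x and y only through the point
    of the segment. *)
Lemma sqr_diff_segment f x y (k : R) : smooth f ->
  (x.1 - y.1) ^+ 2 + (x.2 - y.2) ^+ 2 <= k ->
  (f x - f y) ^+ 2 <=
  \int[leb]_(s in `[0, 1]) (k * gradsq f (s * x.1 + (1 - s) * y.1, s * x.2 + (1 - s) * y.2)).
Proof.
move=> sf hk; pose v := (x.1 - y.1, x.2 - y.2).
pose l (s : R) : R * R := (y.1 + s * v.1, y.2 + s * v.2).
have cl : continuous l by exact: continuous_line.
pose dh s := v.1 * 'D_(@dx R) f (l s) + v.2 * 'D_(@dy R) f (l s).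
have cc (g : R * R -> R) : continuous g -> continuous (g \o l).
  by move=> cg t; apply: continuous_comp; [exact: cl|exact: cg].
have cdh : continuous dh.
  have c1 := cc _ (smooth_cont (smoothDx sf)); have c2 := cc _ (smooth_cont (smoothDy sf)).
  by move=> t; apply: cvgD; apply: cvgM; [exact: cvg_cst|exact: c1|exact: cvg_cst|exact: c2].
have E := @ftc01 (fun s => f (l s)) dh cdh (fun t => @smooth_lineE R f y v t sf).
have -> : f x - f y = f (l 1) - f (l 0).
  rewrite /l /v /= !mul1r !mul0r !addr0 ![_ + (_ - _)]addrC !subrK.
  by rewrite -!surjective_pairing.
have ls s : (s * x.1 + (1 - s) * y.1, s * x.2 + (1 - s) * y.2) = l s.
  by rewrite /l /v /=; congr pair; ring.
rewrite -E; apply: (le_trans (sqr_int01 cdh)); apply: le_Rintegral.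
- by [].
- by apply: integrable01; exact: continuous_sqr.
- have cg := cc _ (continuous_gradsq sf).
  apply: integrable01; under eq_fun do rewrite ls.
  by move=> t; apply: cvgM; [exact: cvg_cst|exact: cg].
move=> s _; rewrite ls /dh /gradsq; move: hk; rewrite -/v.
have -> : (x.1 - y.1) ^+ 2 + (x.2 - y.2) ^+ 2 = v.1 ^+ 2 + v.2 ^+ 2 by [].
move: ('D_ _ _ _ : R) ('D_ _ _ _ : R) v.1 v.2 => A B p q hk.
apply: (@le_trans _ _ ((p ^+ 2 + q ^+ 2) * (B ^+ 2 + A ^+ 2))).
  rewrite -subr_ge0 (_ : _ - _ = (p * A - q * B) ^+ 2); first exact: sqr_ge0.
  ring.
by rewrite ler_wpM2r// addr_ge0// sqr_ge0.
Qed.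

End segments.

Section poincare.
Variable R : realType.
Notation M := (measurableTypeR R).
Notation mu := (@area R).
Notation leb := (@lebesgue_measure R).
Implicit Types (f : R * R -> R) (x y p : R * R).

Variables (U : set (R * R)).
Hypothesis oU : open U.
Hypothesis cvxU : forall x y l, U x -> U y -> 0 < l < 1 ->
  U (l * x.1 + (1 - l) * y.1, l * x.2 + (1 - l) * y.2).
Notation U' := (U : set (M * M)).
Let mU' : measurable U' := mU oU.

Lemma cvxU01 x y s : U x -> U y -> 0 <= s <= 1 ->
  U (s * x.1 + (1 - s) * y.1, s * x.2 + (1 - s) * y.2).
Proof.
move=> Ux Uy /andP[s0 s1].
have [->|n0] := eqVneq s 0; first by rewrite !mul0r !add0r subr0 !mul1r -surjective_pairing.
have [->|n1] := eqVneq s 1; first by rewrite !mul1r subrr !mul0r !addr0 -surjective_pairing.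
by apply: cvxU => //; rewrite !lt_neqAle eq_sym n0 s0 n1 s1.
Qed.

Variables (G : R * R -> R).
Hypothesis cG : continuous G.
Hypothesis G0 : forall x, 0 <= G x.

Let G' : M * M -> R := G \_ U'.
Let seg (s : R) (x y : R * R) : R * R := (s * x.1 + (1 - s) * y.1, s * x.2 + (1 - s) * y.2).
(** All indicators are put in the integrand, so that the triple integral ranges over the full
    product space and its order can be changed. *)
Let K (q : (M * (M * M)) * (M * M)) : R :=
  \1_(`[0, 1]%classic : set M) q.1.1 * \1_U' q.1.2 * \1_U' q.2 * G' (seg q.1.1 q.1.2 q.2).

Let mG' : measurable_fun setT G'.
Proof. by apply/(measurable_restrictT G mU'); exact: continuous_measurable2. Qed.

Let G'0 x : 0 <= G' x.
Proof. by rewrite /G' patchE; case: ifP. Qed.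

Let mK : measurable_fun setT K.
Proof.
have ms : measurable_fun (setT : set ((M * (M * M)) * (M * M))) (fun q => q.1.1 : R).
  by apply: (measurableT_comp measurable_fst); exact: measurable_fst.
have mx : measurable_fun (setT : set ((M * (M * M)) * (M * M))) (fun q => q.1.2 : M * M).
  by apply: (measurableT_comp measurable_snd); exact: measurable_fst.
have my : measurable_fun (setT : set ((M * (M * M)) * (M * M))) (fun q => q.2 : M * M).
  exact: measurable_snd.
have mx1 := measurableT_comp (@measurable_fst _ _ M M) mx.
have mx2 := measurableT_comp (@measurable_snd _ _ M M) mx.
have my1 := measurableT_comp (@measurable_fst _ _ M M) my.
have my2 := measurableT_comp (@measurable_snd _ _ M M) my.
have m1s : measurable_fun (setT : set ((M * (M * M)) * (M * M))) (fun q => 1 - q.1.1 : R).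
  by apply: measurable_funB => //; exact: measurable_cst.
rewrite /K; apply: measurable_funM.
  apply: measurable_funM; first apply: measurable_funM.
  - by apply: (measurableT_comp _ ms); exact: measurable_indic.
  - by apply: (measurableT_comp _ mx); exact: measurable_indic.
  - by apply: (measurableT_comp _ my); exact: measurable_indic.
apply: (measurableT_comp mG').
by apply: measurable_fun_pair; apply: measurable_funD; apply: measurable_funM.
Qed.

Let K0 q : 0 <= K q.
Proof. by rewrite /K !mulr_ge0 // !indicE; case: (_ \in _). Qed.

Let I := (\int[mu]_x (G' x)%:E)%E.

Let int_seg (s c : R) (z : R * R) : 1 / 2 <= s ->
  (\int[mu]_x (G' (s * x.1 + c * z.1, s * x.2 + c * z.2))%:E <= 4%:E * I)%E.
Proof.
move=> s2; have s0 : s != 0 by rewrite gt_eqF//; lra.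
have := @ge0_area_affine R s 0 s (c * z.1) (c * z.2) (EFin \o G') s0 s0.
move=> E; rewrite [leLHS](_ : _ = ((`|s * s|^-1)%:E * I)%E); last first.
  rewrite -E//; last by apply/measurable_EFinP.
  by apply: eq_integral => x _ /=; rewrite mul0r addr0.
apply: lee_wpmul2r; first by apply: integral_ge0 => x _; rewrite lee_fin.
rewrite lee_fin ger0_norm; last by rewrite mulr_ge0//; lra.
rewrite -[leRHS]invrK lef_pV2 ?posrE; nra.
Qed.

Let I0 : (0 <= I)%E.
Proof. by apply: integral_ge0 => x _; rewrite lee_fin. Qed.

Let mKs s : measurable_fun setT (fun q : (M * M) * (M * M) => (K ((s, q.1), q.2))%:E).
Proof.
apply/measurable_EFinP; apply: (measurableT_comp mK).
apply: measurable_fun_pair; last exact: measurable_snd.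
by apply: measurable_fun_pair; [exact: measurable_cst|exact: measurable_fst].
Qed.

Let K_le s x y : K ((s, x), y) <= \1_U' x * G' (seg s x y).
Proof.
rewrite /K !indicE /=; have := G'0 (seg s x y).
case: (_ \in _); case: (_ \in _); case: (_ \in _); rewrite ?mul1r ?mul0r//; lra.
Qed.

Let K_le' s x y : K ((s, x), y) <= \1_U' y * G' (seg s x y).
Proof.
rewrite /K !indicE /=; have := G'0 (seg s x y).
case: (_ \in _); case: (_ \in _); case: (_ \in _); rewrite ?mul1r ?mul0r//; lra.
Qed.

(** The inner integral is bounded uniformly over the whole plane; the indicator of U kept in the
    outer variable supplies the factor mu U. *)
Let int2_le (P Q : M * M -> M * M -> R) (c : \bar R) : (0 <= c)%E ->
  measurable_fun setT (fun q : (M * M) * (M * M) => P q.1 q.2) ->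
  (forall x y, 0 <= P x y) -> (forall x, measurable_fun setT (Q x)) ->
  (forall x y, 0 <= Q x y) -> (forall x y, P x y <= \1_U' x * Q x y) ->
  (forall x, (\int[mu]_y (Q x y)%:E <= c)%E) ->
  (\int[mu]_x \int[mu]_y (P x y)%:E <= mu U' * c)%E.
Proof.
move=> c0 mP P0 mQ Q0 PQ Qc.
have mPE : measurable_fun setT (fun q : (M * M) * (M * M) => (P q.1 q.2)%:E) by apply/measurable_EFinP.
have mI : measurable_fun setT (fun x : M * M => (\1_U' x : R)%:E).
  by apply/measurable_EFinP; exact: measurable_indic.
have -> : (mu U' * c = \int[mu]_x (c * (\1_U' x)%:E))%E.
  rewrite ge0_integralZl//; first by rewrite integral_indic// setIT muleC.
apply: ge0_le_integral => //.
- by move=> x _; apply: integral_ge0 => y _; rewrite lee_fin.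
- by apply: (measurable_int_area mPE) => q; rewrite lee_fin.
- exact: measurable_funeM.
move=> x _; apply: (@le_trans _ _ ((\1_U' x)%:E * \int[mu]_y (Q x y)%:E)%E).
  rewrite -ge0_integralZl//; last 2 first.
  - by apply/measurable_EFinP; exact: mQ.
  - by move=> y _; rewrite lee_fin.
  apply: ge0_le_integral => //.
  - by move=> y _; rewrite lee_fin.
  - by have := measurableT_comp mPE (measurable_pair1 x).
  - by apply: measurable_funeM; apply/measurable_EFinP.
  by move=> y _; rewrite -EFinM lee_fin.
by rewrite muleC; apply: lee_wpmul2r; [rewrite lee_fin indicE ler0n|exact: Qc].
Qed.

Let int_K s : (\int[mu]_x \int[mu]_y (K ((s, x), y))%:E <= mu U' * (4%:E * I))%E.
Proof.
have I40 : (0 <= 4%:E * I)%E by rewrite mule_ge0.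
have mg z (c1 c2 : R) : measurable_fun setT (fun x : M * M => G' (c1 * x.1 + z.1, c1 * x.2 + z.2)).
  apply: (measurableT_comp mG').
  by apply: measurable_fun_pair; apply: measurable_funD => //; apply: measurable_funM.
have [s2|s2] := leP (1 / 2) s.
  rewrite (tonelli_area2 (H := fun q => (K ((s, q.1), q.2))%:E)) => [|//|q]; last by rewrite lee_fin.
  apply: (@int2_le (fun y x => K ((s, x), y)) (fun y x => G' (seg s x y))) => //.
  - have m1 : measurable_fun setT (fun q : (M * M) * (M * M) => (K ((s, q.2), q.1))%:E).
      exact: (measurableT_comp (mKs s) (measurable_fun_pair measurable_snd measurable_fst)).
    exact/measurable_EFinP.
  - by move=> y; exact: (mg ((1 - s) * y.1, (1 - s) * y.2)).
  - by move=> y; exact: int_seg.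
have sE x y : seg s x y = ((1 - s) * y.1 + s * x.1, (1 - s) * y.2 + s * x.2).
  by rewrite /seg; congr pair; rewrite addrC.
apply: (@int2_le (fun x y => K ((s, x), y)) (fun x y => G' (seg s x y))) => //.
- by apply/measurable_EFinP; exact: mKs.
- move=> x; under eq_fun do rewrite sE; exact: (mg (s * x.1, s * x.2)).
- move=> x; under eq_integral do rewrite sE.
  by apply: int_seg; lra.
Qed.

(* For s >= 1/2 the map x |-> s x + (1 - s) y has Jacobian at least 1/4; for s <= 1/2 the roles
   of x and y are exchanged. *)
Lemma int3_segment (F : M * M -> M * M -> R) :
  measurable_fun setT (fun q : (M * M) * (M * M) => F q.1 q.2) ->
  (forall x y, 0 <= F x y) ->
  (forall x y, U x -> U y -> F x y <= \int[leb]_(s in `[0, 1]) G (seg s x y)) ->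
  (\int[mu]_(x in U') \int[mu]_(y in U') (F x y)%:E <=
   mu U' * (4%:E * \int[mu]_(x in U') (G x)%:E))%E.
Proof.
move=> mF F0 FG.
have mKE : measurable_fun setT (fun q => (K q)%:E) by apply/measurable_EFinP.
have K0E q : (0 <= (K q)%:E)%E by rewrite lee_fin.
have mJ : measurable_fun setT (fun sx : M * (M * M) => (\int[mu]_y (K (sx, y))%:E)%E).
  exact: (measurable_int_area mKE).
have IE : I = (\int[mu]_(x in U') (G x)%:E)%E.
  by rewrite [RHS]integral_mkcond; apply: eq_integral => x _; rewrite /G' !patchE; case: ifP.
rewrite -IE.
pose F1 (q : (M * M) * (M * M)) : \bar R := (\1_U' q.1 * (\1_U' q.2 * F q.1 q.2))%:E.
have mF1 : measurable_fun setT F1.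
  apply/measurable_EFinP; apply: measurable_funM; last apply: measurable_funM => //.
    by apply: (measurableT_comp _ measurable_fst); exact: measurable_indic.
  by apply: (measurableT_comp _ measurable_snd); exact: measurable_indic.
have F10 q : (0 <= F1 q)%E by rewrite lee_fin !mulr_ge0// indicE ler0n.
have -> : (\int[mu]_(x in U') \int[mu]_(y in U') (F x y)%:E = \int[mu]_x \int[mu]_y F1 (x, y))%E.
  rewrite integral_mkcond; apply: eq_integral => x _; rewrite patchE; case: ifPn => Ux.
    rewrite integral_mkcond; apply: eq_integral => y _; rewrite patchE /F1 /= !indicE Ux mul1r.
    by case: ifPn => Uy; rewrite ?mul1r ?mul0r.
  by apply/esym/integral0_eq => y _; rewrite /F1 /= !indicE (negbTE Ux) mul0r.
have F1K x y : (F1 (x, y) <= \int[leb]_s (K ((s, x), y))%:E)%E.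
  rewrite /F1 /= !indicE; case: (boolP (x \in U)) => Ux; last first.
    by rewrite mul0r; apply: integral_ge0.
  case: (boolP (y \in U)) => Uy; last first.
    by rewrite mul0r mulr0; apply: integral_ge0.
  rewrite !mul1r; move: (Ux) (Uy); rewrite !inE => Ux' Uy'.
  have cs : continuous (fun s => G (seg s x y)).
    move=> s; apply: (@continuous_comp _ _ _ (fun s => seg s x y) G); last exact: cG.
    have := @continuous_line R y (x.1 - y.1, x.2 - y.2) s.
    rewrite (_ : (fun t => _) = (fun s => seg s x y))//.
    by apply/funext => t; rewrite /seg /=; congr pair; ring.
  apply: (@le_trans _ _ (\int[leb]_(s in `[0%R, 1%R]) (G (seg s x y))%:E)%E).
    rewrite -[leRHS]fineK; first by rewrite lee_fin; exact: FG.
    by apply: integrable_fin_num => //; exact: integrable01.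
  rewrite integral_mkcond le_eqVlt; apply/orP; left; apply/eqP.
  apply: eq_integral => s _; rewrite patchE /K /= !indicE Ux Uy !mulr1.
  case: ifPn => s01; last by rewrite mul0r.
  rewrite mul1r /G' patchE ifT// inE; apply: cvxU01 => //.
  by move: s01; rewrite inE /= in_itv.
(* Two applications of Tonelli bring the integral over s outermost; for fixed s the double integral
   is bounded by [int_K]. *)
apply: (@le_trans _ _ (\int[mu]_x \int[leb]_s \int[mu]_y (K ((s, x), y))%:E)%E).
  have mJ' : measurable_fun setT (fun x : M * M => \int[leb]_s \int[mu]_y (K ((s, x), y))%:E)%E.
    have := @measurable_fun_fubini_tonelli_G _ _ _ _ _ leb
      (fun sx : M * (M * M) => (\int[mu]_y (K (sx, y))%:E)%E) mJ.
    by apply => sx; exact: integral_ge0.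
  apply: ge0_le_integral => //.
  - by move=> x _; exact: integral_ge0.
  - exact: (measurable_int_area mF1).
  move=> x _.
  have mx : measurable_fun setT (fun sy : M * (M * M) => (K ((sy.1, x), sy.2))%:E).
    apply: (measurableT_comp mKE); apply: measurable_fun_pair; last exact: measurable_snd.
    by apply: measurable_fun_pair; [exact: measurable_fst|exact: measurable_cst].
  rewrite (tonelli_area leb (H := fun sy => (K ((sy.1, x), sy.2))%:E))//.
  apply: ge0_le_integral => //.
  - by apply: (measurableT_comp mF1); exact: measurable_pair1.
  - have := @measurable_fun_fubini_tonelli_G _ _ _ _ _ leb
      (fun sy : M * (M * M) => (K ((sy.1, x), sy.2))%:E) mx.
    by apply => sx; exact: K0E.
rewrite -(tonelli_area leb (H := fun sx => (\int[mu]_y (K (sx, y))%:E)%E))//; last first.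
  by move=> sx; exact: integral_ge0.
have -> : (mu U' * (4%:E * I) = \int[leb]_(s in `[0%R, 1%R]) (mu U' * (4%:E * I)))%E.
  by apply/esym; rewrite integral_cst// -[RHS]mule1; congr (_ * _)%E; exact: leb01.
rewrite [leRHS]integral_mkcond; apply: ge0_le_integral => //.
- by move=> s _; apply: integral_ge0 => x _; exact: integral_ge0.
- have := @measurable_fun_fubini_tonelli_F _ _ _ _ _ (area_sf R)
      (fun sx : M * (M * M) => (\int[mu]_y (K (sx, y))%:E)%E) mJ.
  by apply => sx; exact: integral_ge0.
- have m01 : measurable (`[0, 1]%classic : set M) by [].
  by apply/(measurable_restrictT (fun=> _) m01).
move=> s _; rewrite patchE; case: ifPn => s01; first exact: int_K.
rewrite integral0_eq// => x _; rewrite integral0_eq// => y _.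
by rewrite /K /= indicE (negbTE s01) !mul0r.
Qed.

End poincare.

Section poincare_mean.
Variable R : realType.
Notation M := (measurableTypeR R).
Notation mu := (@area R).
Notation leb := (@lebesgue_measure R).
Implicit Types (f : R * R -> R) (x y p : R * R).

Variables (U : set (R * R)) (D : R).
Hypothesis oU : open U.
Hypothesis cvxU : forall x y l, U x -> U y -> 0 < l < 1 ->
  U (l * x.1 + (1 - l) * y.1, l * x.2 + (1 - l) * y.2).
Hypothesis bU : forall x, U x -> `|x.1| <= D /\ `|x.2| <= D.
Variable p0 : R * R.
Hypothesis Up0 : U p0.
Notation U' := (U : set (M * M)).
Let mU' : measurable U' := mU oU.

(** On a null set the integral of a mollifier would be 0 instead of 1. *)
Lemma area_gt0 : 0 < fine (mu U').
Proof.
rewrite lt_neqAle fine_ge0// andbT; apply/eqP => E.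
have [eta [te e0 e1]] := mollifier_exists oU bU Up0.
have U0 : mu U' = 0%E by rewrite -(@fineK _ (mu U')) -?E// ge0_fin_numE// (area_lty oU bU).
have ce : continuous eta by apply: smooth_cont; case: te.
have : (\int[mu]_p (eta p)%:E = \int[mu]_(p in U') (eta p)%:E)%E.
  rewrite [RHS]integral_mkcond; apply: eq_integral => x _; rewrite patchE.
  by case: ifPn => // /negP; rewrite inE => /(test_fun_out te) ->.
rewrite e1 null_set_integral//.
  by move/eqP; rewrite eqe oner_eq0.
by apply/measurable_EFinP; exact: continuous_measurable2.
Qed.

Notation V := (fine (mu U')).
Let V0 : 0 < V := area_gt0.

Let VE : V%:E = mu U'.
Proof. by rewrite fineK// ge0_fin_numE// (area_lty oU bU). Qed.

Lemma sq_integrable_continuous f : continuous f -> sq_integrable mu U' f.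
Proof.
move=> cf; split; first exact: continuous_measurable2.
by apply: (continuous_integrable oU bU); exact: continuous_sqr.
Qed.

Lemma sqr_int_le f : continuous f ->
  (\int[mu]_(x in U') f x) ^+ 2 <= V * \int[mu]_(x in U') (f x ^+ 2).
Proof.
move=> cf; have s1 : sq_integrable mu U' (fun=> 1).
  by apply: sq_integrable_continuous => x; exact: cvg_cst.
have := cauchy_schwarz mU' s1 (sq_integrable_continuous cf).
under eq_Rintegral do rewrite mul1r.
have EV : l2norm mu U' (fun=> 1) ^+ 2 = V.
  by rewrite l2norm_sqr// -[RHS]mul1r -Rintegral_cst//; apply: eq_Rintegral => x _; rewrite expr1n.
rewrite -EV -l2norm_sqr// -exprMn => H; rewrite -real_normK ?num_real//.
by rewrite lerXn2r ?nnegrE ?mulr_ge0 ?l2norm_ge0.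
Qed.

Definition mean f : R := V^-1 * \int[mu]_(x in U') f x.

(** By Cauchy-Schwarz, V (f x - mean) ^ 2 is at most the integral of (f x - f y) ^ 2 over y;
    integrating over x with [int3_segment], the factor V cancels. The constant is 8 D ^ 2, a bound
    for the squared diameter, times 4 from the Jacobian. *)
Lemma poincare_mean f : smooth f ->
  \int[mu]_(x in U') ((f x - mean f) ^+ 2) <= 32 * D ^+ 2 * \int[mu]_(x in U') gradsq f x.
Proof.
move=> sf; have cf := smooth_cont sf.
pose G x := 8 * D ^+ 2 * gradsq f x.
have cgr := continuous_gradsq sf.
have cG : continuous G by move=> x; apply: cvgM; [exact: cvg_cst|exact: cgr].
have D80 : 0 <= 8 * D ^+ 2 by rewrite mulr_ge0// sqr_ge0.
have G0 x : 0 <= G x by rewrite mulr_ge0// gradsq_ge0.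
have mf : measurable_fun (setT : set (M * M)) f by exact: (@continuous_measurable2 R setT).
have mFF : measurable_fun setT (fun q : (M * M) * (M * M) => (f q.1 - f q.2) ^+ 2).
  apply: measurable_funX; apply: measurable_funB.
    exact: (measurableT_comp mf).
  exact: (measurableT_comp mf).
have FG x y : U x -> U y ->
    (f x - f y) ^+ 2 <= \int[leb]_(s in `[0, 1]) G (s * x.1 + (1 - s) * y.1, s * x.2 + (1 - s) * y.2).
  move=> /bU [x1 x2] /bU [y1 y2]; apply: sqr_diff_segment => //.
  by move: x1 x2 y1 y2; rewrite !ler_norml => /andP[? ?] /andP[? ?] /andP[? ?] /andP[? ?]; nra.
have L := int3_segment oU cvxU cG G0 mFF (fun x y => sqr_ge0 _) FG.
have ic x : mu.-integrable U' (EFin \o (fun y => (f x - f y) ^+ 2)).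
  apply: (continuous_integrable oU bU); apply: continuous_sqr => y.
  by apply: cvgB; [exact: cvg_cst|exact: cf].
have im : mu.-integrable U' (EFin \o (fun y => (f y - mean f) ^+ 2)).
  apply: (continuous_integrable oU bU); apply: continuous_sqr => y.
  by apply: cvgB; [exact: cf|exact: cvg_cst].
have pt x : V * (f x - mean f) ^+ 2 <= \int[mu]_(y in U') ((f x - f y) ^+ 2).
  have cfx : continuous (fun y => f x - f y).
    by move=> y; apply: cvgB; [exact: cvg_cst|exact: cf].
  rewrite -(ler_pM2l V0); apply: le_trans (sqr_int_le cfx).
  rewrite RintegralB//; last 2 first.
  - exact: (integrable_cstU oU bU).
  - exact: (continuous_integrable oU bU cf).
  rewrite Rintegral_cst// /mean.
  move: (\int[mu]_(_ in _) _) => J.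
  rewrite le_eqVlt; apply/orP; left; apply/eqP; move: V V0 => W W0; field; exact: lt0r_neq0.
have {}L : (\int[mu]_(x in U') (V * (f x - mean f) ^+ 2)%:E <= mu U' * (4%:E * \int[mu]_(x in U') (G x)%:E))%E.
  apply: le_trans L; apply: ge0_le_integral => //.
  - by move=> x _; rewrite lee_fin mulr_ge0 ?sqr_ge0// ltW.
  - apply/measurable_EFinP; apply: measurable_funM => //.
    by apply/measurable_EFinP; exact: measurable_int im.
  - have := @measurable_int_area R _ _ (fun q : (M * M) * (M * M) => (\1_U' q.2 * (f q.1 - f q.2) ^+ 2)%:E).
    move=> H; have {}H : measurable_fun setT (fun x : M * M => \int[mu]_y (\1_U' y * (f x - f y) ^+ 2)%:E)%E.
      apply: H.
        apply/measurable_EFinP; apply: measurable_funM => //.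
        by apply: (measurableT_comp _ measurable_snd); exact: measurable_indic.
      by move=> q; rewrite lee_fin mulr_ge0 ?sqr_ge0// indicE ler0n.
    apply: measurable_funTS; apply: eq_measurable_fun H => x _.
    rewrite [RHS]integral_mkcond; apply: eq_integral => y _; rewrite patchE indicE.
    by case: ifPn => _; rewrite ?mul1r ?mul0r.
  move=> x _; rewrite -[leRHS]fineK; last exact: (integrable_fin_num mU' (ic x)).
  by rewrite lee_fin; exact: pt.
have iG := continuous_integrable oU bU cG.
have EL : (\int[mu]_(x in U') (V * (f x - mean f) ^+ 2)%:E = (V * \int[mu]_(x in U') ((f x - mean f) ^+ 2))%:E)%E.
  rewrite -RintegralZl// /Rintegral fineK//; apply: integrable_fin_num => //.
  exact: (integrableZR mU' V im).
have EG : (\int[mu]_(x in U') (G x)%:E = (8 * D ^+ 2 * \int[mu]_(x in U') gradsq f x)%:E)%E.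
  rewrite -RintegralZl//; first by rewrite /Rintegral fineK//; exact: integrable_fin_num.
  exact: (continuous_integrable oU bU cgr).
move: L; rewrite EL EG -VE -!EFinM lee_fin (ler_pM2l V0) => L.
apply: (le_trans L); rewrite mulrA mulrA -natrM.
by [].
Qed.

End poincare_mean.

(** * Traces *)

Section trace_inequality.
Variable R : realType.
Notation M := (measurableTypeR R).
Notation mu := (@area R).
Notation leb := (@lebesgue_measure R).
Implicit Types (f g v w : R * R -> R) (x y p : R * R) (e : (R * R) * (R * R)).

Variables (b H : R).
Hypothesis H0 : 0 < H.
Let Hn0 : H != 0. Proof. exact: lt0r_neq0. Qed.

Notation T := (tri b H).
Notation T' := (T : set (M * M)).
Notation Dx f := ('D_(@dx R) f).
Notation Dy f := ('D_(@dy R) f).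

Lemma measurable_tri : measurable T'. Proof. apply: mU; exact: open_tri. Qed.
Let mT : measurable T' := measurable_tri.
Let oT : open T. Proof. exact: open_tri. Qed.

Lemma sq_integrable_tri f : continuous f -> sq_integrable mu T' f.
Proof. exact: (sq_integrable_continuous oT (bounded_tri H0)). Qed.

Lemma derivexM f g x : smooth f -> smooth g ->
  Dx (fun y => f y * g y) x = f x * Dx g x + g x * Dx f x.
Proof.
by move=> sf sg; exact: (deriveM (@smooth_derx R f sf x) (@smooth_derx R g sg x)).
Qed.

Lemma deriveyM f g x : smooth f -> smooth g ->
  Dy (fun y => f y * g y) x = f x * Dy g x + g x * Dy f x.
Proof.
by move=> sf sg; exact: (deriveM (@smooth_dery R f sf x) (@smooth_dery R g sg x)).
Qed.

Lemma derive_affine (c1 c2 c0 : R) x :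
  Dx (fun q : R * R => c1 * q.1 + c2 * q.2 + c0) x = c1 /\
  Dy (fun q : R * R => c1 * q.1 + c2 * q.2 + c0) x = c2.
Proof.
have Di (v : R * R) : is_derive x v (fun q : R * R => c1 * q.1 + c2 * q.2 + c0) ((c1 * v.1 + c2 * v.2) * 1).
  by apply: (@is_derive_lin R c1 c2 c0 id (fun=> 1)) => s; exact: is_derive_id.
split; first by case: (Di (@dx R)) => _ ->; rewrite /dx /= !(mulr0, mulr1, addr0).
by case: (Di (@dy R)) => _ ->; rewrite /dy /= !(mulr0, mulr1, add0r).
Qed.

(** The square of the full H1 norm. *)
Definition grad_int f : R := \int[mu]_(x in T') (f x ^+ 2) + \int[mu]_(x in T') gradsq f x.

(** With an affine weight bounded by 1, the derivative consists of g ^ 2 with a constant coefficient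
    and of products of g with its derivatives, absorbed by 2 |g X| <= g ^ 2 + X ^ 2. *)
Lemma int_grad_affine_le (c1 c2 c0 k l : R) :
  (forall x, T x -> `|c1 * x.1 + c2 * x.2 + c0| <= 1) ->
  exists2 C, 0 <= C & forall g, smooth g ->
  let f := (fun x => g x ^+ 2 * (c1 * x.1 + c2 * x.2 + c0)) in
  \int[mu]_(x in T') (k * Dx f x + l * Dy f x) <= C * grad_int g.
Proof.
move=> Hb; exists (`|k| + `|l| + `|k * c1 + l * c2|); first by rewrite !addr_ge0.
move=> g sg /=; set f := (fun x => _ * _); set C := (_ + _).
have sb := @smooth_affine R c1 c2 c0.
have sg2 : smooth (fun x => g x ^+ 2).
  by under eq_fun do rewrite expr2; exact: smoothM.
have sf : smooth f by exact: smoothM.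
have cg2 := smooth_cont sg2; have cgr := continuous_gradsq sg.
rewrite /grad_int -RintegralD//; [|exact: integrable_tri|exact: integrable_tri].
rewrite -RintegralZl//; last by apply: integrableDR => //; exact: integrable_tri.
apply: le_Rintegral => //.
- apply: (integrable_tri b H0 (F := fun x => k * Dx f x + l * Dy f x)).
  by apply: smooth_cont; apply: smoothD; apply: smoothZ; [exact: smoothDx|exact: smoothDy].
- by apply: integrableZR => //; apply: integrableDR => //; exact: integrable_tri.
move=> x Tx; rewrite /gradsq.
have -> : Dx f x = (g x ^+ 2) * c1 + (c1 * x.1 + c2 * x.2 + c0) * (2 * g x * Dx g x).
  rewrite /f (@derivexM (fun x => g x ^+ 2))//; congr (_ * _ + _ * _); first by case: (derive_affine c1 c2 c0 x).
  have -> : (fun x => g x ^+ 2) = (fun x => g x * g x) by apply/funext => ?; rewrite expr2.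
  by rewrite derivexM//; move: (g x) (Dx g x : R) => A B; ring.
have -> : Dy f x = (g x ^+ 2) * c2 + (c1 * x.1 + c2 * x.2 + c0) * (2 * g x * Dy g x).
  rewrite /f (@deriveyM (fun x => g x ^+ 2))//; congr (_ * _ + _ * _); first by case: (derive_affine c1 c2 c0 x).
  have -> : (fun x => g x ^+ 2) = (fun x => g x * g x) by apply/funext => ?; rewrite expr2.
  by rewrite deriveyM//; move: (g x) (Dy g x : R) => A B; ring.
have := Hb x Tx; rewrite /C; clear.
move: (c1 * x.1 + c2 * x.2 + c0) (g x) (Dx g x : R) (Dy g x : R) => B G X Y HB.
have -> : k * (G ^+ 2 * c1 + B * (2 * G * X)) + l * (G ^+ 2 * c2 + B * (2 * G * Y)) =
  (k * c1 + l * c2) * G ^+ 2 + k * (B * (2 * G * X)) + l * (B * (2 * G * Y)) by ring.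
have A1 Z : `|B * (2 * G * Z)| <= G ^+ 2 + Z ^+ 2.
  rewrite normrM; apply: (@le_trans _ _ `|2 * G * Z|); first by rewrite ler_piMl.
  rewrite ler_norml; have := sqr_ge0 (G + Z); have := sqr_ge0 (G - Z).
  by move=> h1 h2; apply/andP; split; nra.
have A2 m Z : m * (B * (2 * G * Z)) <= `|m| * (G ^+ 2 + Z ^+ 2).
  by rewrite (le_trans (ler_norm _))// normrM ler_wpM2l.
have h1 := A2 k X; have h2 := A2 l Y.
have h3 : (k * c1 + l * c2) * G ^+ 2 <= `|k * c1 + l * c2| * G ^+ 2.
  by rewrite ler_wpM2r ?sqr_ge0// ler_norm.
have n1 := normr_ge0 k; have n2 := normr_ge0 l; have n3 := normr_ge0 (k * c1 + l * c2).
have G2 := sqr_ge0 G; have X2 := sqr_ge0 X; have Y2 := sqr_ge0 Y.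
have p1 := mulr_ge0 n1 Y2; have p2 := mulr_ge0 n2 X2.
have p3 := mulr_ge0 n3 X2; have p4 := mulr_ge0 n3 Y2.
rewrite (_ : (_ + _ + _) * _ = `|k| * (G ^+ 2 + X ^+ 2) + `|l| * (G ^+ 2 + Y ^+ 2) +
  `|k * c1 + l * c2| * G ^+ 2 + (`|k| * Y ^+ 2 + `|l| * X ^+ 2 +
  `|k * c1 + l * c2| * X ^+ 2 + `|k * c1 + l * c2| * Y ^+ 2)); last by ring.
rewrite -[leLHS]addr0; apply: lerD; last by rewrite !addr_ge0.
by rewrite -addrA addrC; apply: lerD => //; exact: lerD.
Qed.

Definition trace_bounded e := exists2 C, 0 <= C &
  forall g, smooth g -> edge_mean e (fun x => g x ^+ 2) <= C * grad_int g.

(* On the edge e two barycentric coordinates add up to 1, and each vanishes on one further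
   edge, so the integral of g ^ 2 times either over e is the integral over the triangle of a
   directional derivative. *)
Lemma trace_bounded_split e (c1 c2 c0 k l c1' c2' c0' k' l' : R) :
  (forall x, T x -> `|c1 * x.1 + c2 * x.2 + c0| <= 1) ->
  (forall x, T x -> `|c1' * x.1 + c2' * x.2 + c0'| <= 1) ->
  (forall t, (c1 * (edge_point e t).1 + c2 * (edge_point e t).2 + c0) +
   (c1' * (edge_point e t).1 + c2' * (edge_point e t).2 + c0') = 1) ->
  (forall g, smooth g -> let f := (fun x => g x ^+ 2 * (c1 * x.1 + c2 * x.2 + c0)) in
    edge_mean e f = \int[mu]_(x in T') (k * Dx f x + l * Dy f x)) ->
  (forall g, smooth g -> let f := (fun x => g x ^+ 2 * (c1' * x.1 + c2' * x.2 + c0')) in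
    edge_mean e f = \int[mu]_(x in T') (k' * Dx f x + l' * Dy f x)) ->
  trace_bounded e.
Proof.
move=> B1 B2 B12 E1 E2.
have [C C0 HC] := int_grad_affine_le k l B1.
have [C' C'0 HC'] := int_grad_affine_le k' l' B2.
exists (C + C'); first exact: addr_ge0.
move=> g sg.
have cg2 := continuous_sqr (smooth_cont sg).
have cb (a1 a2 a0 : R) := smooth_cont (@smooth_affine R a1 a2 a0).
have cf (a1 a2 a0 : R) : continuous (fun x => g x ^+ 2 * (a1 * x.1 + a2 * x.2 + a0)).
  by move=> x; apply: cvgM; [exact: cg2|exact: cb].
have -> : edge_mean e (fun x => g x ^+ 2) =
   edge_mean e (fun x => g x ^+ 2 * (c1 * x.1 + c2 * x.2 + c0)) +
   edge_mean e (fun x => g x ^+ 2 * (c1' * x.1 + c2' * x.2 + c0')).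
  rewrite /edge_mean -RintegralD//.
  - by apply: eq_Rintegral => t _; rewrite -mulrDr B12 mulr1.
  - exact: (integrable01 (continuous_edge_comp (cf _ _ _))).
  - exact: (integrable01 (continuous_edge_comp (cf _ _ _))).
rewrite mulrDl; apply: lerD.
  by rewrite (E1 g sg); exact: HC.
by rewrite (E2 g sg); exact: HC'.
Qed.

(** The divergence theorem for the field f (k, l): the coefficients of the edge means are the
    products of (k, l) with the outward normals scaled by the edge lengths. It follows from the two
    directions (1, 0) and (b, H), which span the plane as H is nonzero. *)
Lemma int_tri_grad (k l : R) f : smooth f ->
  \int[mu]_(x in T') (k * Dx f x + l * Dy f x) =
  k * (H * (edge_mean (tri_e3 b H) f - edge_mean (tri_e2 b H) f)) +
  l * ((1 - b) * edge_mean (tri_e3 b H) f + b * edge_mean (tri_e2 b H) f - edge_mean (tri_e1 R) f).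
Proof.
move=> sf.
have ix := integrable_tri b H0 (smooth_cont (smoothDx sf)).
have iy := integrable_tri b H0 (smooth_cont (smoothDy sf)).
have Ex := int_tri_dx b H0 sf.
have Ew := int_tri_dw b H0 sf.
rewrite (Rintegral_lin2 b H mT ix iy) Ex in Ew.
rewrite (Rintegral_lin2 k l mT ix iy) Ex; congr (_ + l * _).
move: Ew; move: (\int[mu]_(x in T') _) (edge_mean _ f) (edge_mean _ f) (edge_mean _ f) => Y A B C Ew.
by apply: (mulfI Hn0); lra.
Qed.

Lemma edge_mean_eq0 e f : (forall t, f (edge_point e t) = 0) -> edge_mean e f = 0.
Proof.
move=> f0; rewrite /edge_mean; under eq_Rintegral do rewrite f0.
by rewrite /Rintegral integral0.
Qed.

(** The affine functions in these three bounds are the barycentric coordinates of (1, 0), (b, H) and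
    (0, 0). *)
Let lamA_le x : T x -> `|1 * x.1 + (- (b / H)) * x.2 + 0| <= 1.
Proof. by case=> /= h1 h2 h3; rewrite ler_norml; apply/andP; split; nra. Qed.
Let lamB_le x : T x -> `|0 * x.1 + H^-1 * x.2 + 0| <= 1.
Proof. by case=> /= h1 h2 h3; rewrite ler_norml; apply/andP; split; nra. Qed.
Let lamO_le x : T x -> `|-1 * x.1 + (b / H - H^-1) * x.2 + 1| <= 1.
Proof. by case=> /= h1 h2 h3; rewrite ler_norml; apply/andP; split; nra. Qed.

Let smooth_gl g (c1 c2 c0 : R) : smooth g ->
  smooth (fun x => g x ^+ 2 * (c1 * x.1 + c2 * x.2 + c0)).
Proof.
move=> sg; apply: smoothM; last exact: smooth_affine.
by under eq_fun do rewrite expr2; exact: smoothM.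
Qed.

Lemma trace_bounded1 : trace_bounded (tri_e1 R).
Proof.
(* The coordinate of O vanishes on e3, that of A on e2. Each direction (k, l) is parallel to the
   remaining edge and scaled so that the mean over e1 gets coefficient 1 in [int_tri_grad]. The
   other two edges follow the same recipe. *)
apply: (@trace_bounded_split _ (-1) (b / H - H^-1) 1 (- (b / H)) (-1) 1 (- (b / H)) 0 (- ((b - 1) / H)) (-1)) => //.
- by move=> t; rewrite /edge_point /=; ring.
- move=> g sg /=; rewrite int_tri_grad; last exact: smooth_gl.
  rewrite (@edge_mean_eq0 (tri_e3 b H)); last by move=> t; rewrite /edge_point /=; field.
  move: (edge_mean _ _) (edge_mean _ _) => A B; field => //.
- move=> g sg /=; rewrite int_tri_grad; last exact: smooth_gl.
  rewrite (@edge_mean_eq0 (tri_e2 b H)); last by move=> t; rewrite /edge_point /=; field.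
  move: (edge_mean _ _) (edge_mean _ _) => A B; field => //.
Qed.

Lemma trace_bounded2 : trace_bounded (tri_e2 b H).
Proof.
apply: (@trace_bounded_split _ (-1) (b / H - H^-1) 1 (- H^-1) 0 0 H^-1 0 ((b - 1) / H) 1) => //.
- by move=> t; rewrite /edge_point /=; field.
- move=> g sg /=; rewrite int_tri_grad; last exact: smooth_gl.
  rewrite (@edge_mean_eq0 (tri_e3 b H)); last by move=> t; rewrite /edge_point /=; field.
  move: (edge_mean _ _) (edge_mean _ _) => A B; field => //.
- move=> g sg /=; rewrite int_tri_grad; last exact: smooth_gl.
  rewrite (@edge_mean_eq0 (tri_e1 R)); last by move=> t; rewrite /edge_point /=; field.
  move: (edge_mean _ _) (edge_mean _ _) => A B; field => //.
Qed.

Lemma trace_bounded3 : trace_bounded (tri_e3 b H).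
Proof.
apply: (@trace_bounded_split _ 1 (- (b / H)) 0 (H^-1) 0 0 H^-1 0 (b / H) 1) => //.
- by move=> t; rewrite /edge_point /=; field.
- move=> g sg /=; rewrite int_tri_grad; last exact: smooth_gl.
  rewrite (@edge_mean_eq0 (tri_e2 b H)); last by move=> t; rewrite /edge_point /=; field.
  move: (edge_mean _ _) (edge_mean _ _) => A B; field => //.
- move=> g sg /=; rewrite int_tri_grad; last exact: smooth_gl.
  rewrite (@edge_mean_eq0 (tri_e1 R)); last by move=> t; rewrite /edge_point /=; field.
  move: (edge_mean _ _) (edge_mean _ _) => A B; field => //.
Qed.

End trace_inequality.

Lemma cvg0_le (R : realType) (u v : nat -> R) : (forall n, 0 <= u n <= v n) ->
  v n @[n --> \oo] --> (0 : R) -> u n @[n --> \oo] --> (0 : R).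
Proof.
move=> uv v0; apply: (squeeze_cvgr _ (cvg_cst 0) v0).
by apply: nearW => n; exact: uv.
Qed.

(** * Limits in L2 *)

Section L2_limits.
Context d (T : measurableType d) (R : realType) (mu : {measure set T -> \bar R}).
Variables (D : set T) (mD : measurable D).
Implicit Types (f g u v : T -> R).

Definition l2cv (f_ : nat -> T -> R) f := l2norm mu D (fun x => f_ n x - f x) @[n --> \oo] --> (0 : R).

Lemma l2cv_lin (k l : R) (f_ g_ : nat -> T -> R) u v :
  (forall n, sq_integrable mu D (f_ n)) -> (forall n, sq_integrable mu D (g_ n)) ->
  sq_integrable mu D u -> sq_integrable mu D v ->
  l2cv f_ u -> l2cv g_ v ->
  l2cv (fun n x => k * f_ n x + l * g_ n x) (fun x => k * u x + l * v x).
Proof.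
move=> sf sg su sv cf cg.
apply: (@cvg0_le _ _ (fun n => `|k| * l2norm mu D (fun x => f_ n x - u x) +
  `|l| * l2norm mu D (fun x => g_ n x - v x))); last first.
  rewrite -[0](_ : `|k| * 0 + `|l| * 0 = 0); last by rewrite !mulr0 addr0.
  by apply: cvgD; apply: cvgM => //; exact: cvg_cst.
move=> n; rewrite l2norm_ge0/=.
have sfu := sq_integrableB mD (sf n) su; have sgv := sq_integrableB mD (sg n) sv.
rewrite -!l2normZ//.
have -> : l2norm mu D (fun x => k * f_ n x + l * g_ n x - (k * u x + l * v x)) =
  l2norm mu D (fun x => k * (f_ n x - u x) + l * (g_ n x - v x)).
  by congr l2norm; apply/funext => x; ring.
by apply: l2norm_triangle => //; exact: sq_integrableZ.
Qed.

Lemma l2norm_leD f g : sq_integrable mu D f -> sq_integrable mu D g ->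
  l2norm mu D f <= l2norm mu D (fun x => f x - g x) + l2norm mu D g.
Proof.
move=> sf sg.
have -> : l2norm mu D f = l2norm mu D (fun x => (f x - g x) + g x).
  by congr l2norm; apply/funext => x; rewrite subrK.
by apply: l2norm_triangle => //; exact: sq_integrableB.
Qed.

Lemma l2cv_norm (f_ : nat -> T -> R) f : (forall n, sq_integrable mu D (f_ n)) -> sq_integrable mu D f ->
  l2cv f_ f -> l2norm mu D (f_ n) @[n --> \oo] --> l2norm mu D f.
Proof.
move=> sf_ sf cf; apply/cvgrPdist_le => e e0.
have /cvgrPdist_le /(_ e e0) := cf; apply: filterS => n.
rewrite sub0r normrN (ger0_norm (l2norm_ge0 _ _ _)) => le.
apply: le_trans le; rewrite ler_norml; apply/andP.
have h1 := l2norm_leD (sf_ n) sf; have h2 := l2norm_leD sf (sf_ n).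
rewrite l2normC in h2.
by move: (l2norm _ _ _) (l2norm _ _ _) (l2norm _ _ _) h1 h2 => A B C h1 h2; split; lra.
Qed.

Lemma l2cv_int (f_ : nat -> T -> R) f : sq_integrable mu D (fun=> 1) ->
  (forall n, sq_integrable mu D (f_ n)) -> sq_integrable mu D f ->
  l2cv f_ f -> \int[mu]_(x in D) f_ n x @[n --> \oo] --> \int[mu]_(x in D) f x.
Proof.
move=> s1 sf_ sf cf.
have iint g : sq_integrable mu D g -> mu.-integrable D (EFin \o g).
  move=> sg; have := sq_integrableM mD s1 sg.
  by apply: eq_integrable => // x _ /=; rewrite mul1r.
apply/subr_cvg0; apply/cvgr0Pnorm_le => e e0.
pose C := l2norm mu D (fun=> 1) + 1.
have C0 : 0 < C by rewrite ltr_wpDl// l2norm_ge0.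
have /cvgrPdist_le /(_ (e / C) (divr_gt0 e0 C0)) := cf; apply: filterS => n.
rewrite sub0r normrN (ger0_norm (l2norm_ge0 _ _ _)) => le.
have sB := sq_integrableB mD (sf_ n) sf.
have := cauchy_schwarz mD s1 sB.
under eq_Rintegral do rewrite mul1r.
rewrite RintegralB//; [|exact: iint|exact: iint].
move=> h; apply: (le_trans h); apply: (@le_trans _ _ (C * (e / C))).
  by apply: ler_pM => //; rewrite ?l2norm_ge0// /C lerDl.
by rewrite mulrC divfK// lt0r_neq0.
Qed.

Lemma ae_eq_l2cv (f_ : nat -> T -> R) f g : (forall n, sq_integrable mu D (f_ n)) ->
  sq_integrable mu D f -> sq_integrable mu D g -> ae_eq mu D f g ->
  l2cv f_ f -> l2cv f_ g.
Proof.
move=> sf_ sf sg fg; rewrite /l2cv.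
rewrite (_ : (fun n => l2norm mu D (fun x => f_ n x - f x)) =
             (fun n => l2norm mu D (fun x => f_ n x - g x)))//.
apply/funext => n; apply: ae_eq_l2norm => //.
- by case: (sq_integrableB mD (sf_ n) sf).
- by case: (sq_integrableB mD (sf_ n) sg).
by apply: filterS fg => x fg Dx; rewrite fg.
Qed.

End L2_limits.

(** * Weak derivatives and smooth approximation on the triangle *)

Section H1_limits.
Variable R : realType.
Notation M := (measurableTypeR R).
Notation mu := (@area R).
Notation leb := (@lebesgue_measure R).
Implicit Types (f g v w : R * R -> R) (x y p : R * R).

Variables (b H : R).
Hypothesis H0 : 0 < H.
Let Hn0 : H != 0. Proof. exact: lt0r_neq0. Qed.

Notation T := (tri b H).
Notation T' := (T : set (M * M)).
Notation Dx f := ('D_(@dx R) f).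
Notation Dy f := ('D_(@dy R) f).
Let mT : measurable T' := @measurable_tri R b H.
Let oT : open T. Proof. exact: open_tri. Qed.
Let cT := @convex_tri R b H.
Let bT := @bounded_tri R b H H0.
Let pT := @tri_ne R b H H0.
Notation L2 := (sq_integrable mu T').
Notation nrm := (l2norm mu T').
Notation wdx := (weak_deriv T (@dx R)).
Notation wdy := (weak_deriv T (@dy R)).
Notation cv := (l2cv mu T').

Lemma test_fun_L2 f : test_fun T f -> L2 f.
Proof. by move=> [sf _ _]; exact: sq_integrable_tri (smooth_cont sf). Qed.

Lemma test_fun_D e f : e = @dx R \/ e = @dy R -> test_fun T f -> L2 (fun x => 'D_e f x).
Proof. by case=> -> tf; apply: test_fun_L2; [exact: test_funDx|exact: test_funDy]. Qed.

Lemma is_weak_deriv_lin e (k l : R) u v g h : e = @dx R \/ e = @dy R ->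
  inL2 T u -> inL2 T v -> is_weak_deriv T e u g -> is_weak_deriv T e v h ->
  is_weak_deriv T e (fun x => k * u x + l * v x) (fun x => k * g x + l * h x).
Proof.
move=> He su sv [sg Eg] [sh Eh]; split.
  by apply: (sq_integrableD mT); exact: sq_integrableZ.
move=> f tf; have sf := test_fun_L2 tf; have sDf := test_fun_D He tf.
transitivity (k * \int[mu]_(x in T') (u x * 'D_e f x) + l * \int[mu]_(x in T') (v x * 'D_e f x)).
  rewrite -Rintegral_lin2//; [|exact: sq_integrableM|exact: sq_integrableM].
  by apply: eq_Rintegral => x _; move: (u x) (v x) ('D_e f x : R) => ? ? ?; ring.
rewrite Eg// Eh// !mulrN -opprD; congr (- _).
rewrite -Rintegral_lin2//; [|exact: sq_integrableM|exact: sq_integrableM].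
by apply: eq_Rintegral => x _; move: (g x) (h x) (f x) => ? ? ?; ring.
Qed.

Lemma tri_edge_out t : [/\ ~ T (edge_point (tri_e1 R) t), ~ T (edge_point (tri_e2 b H) t) &
  ~ T (edge_point (tri_e3 b H) t)].
Proof.
split; rewrite /edge_point /=.
- by case=> _ /=; rewrite !(mulr0, addr0, subr0) mul0r ltxx.
- case=> /=; rewrite (_ : _ - _ = 0) ?ltxx//; field => //.
- case=> _ _ /=; rewrite (_ : _ + _ = 1) ?ltxx//; field => //.
Qed.

(** Integration by parts: the product of f with a test function vanishes on all three edges, so the
    integral of its gradient is 0 by [int_tri_grad]. *)
Lemma is_weak_deriv_smooth f : smooth f ->
  is_weak_deriv T (@dx R) f (fun x => Dx f x) /\ is_weak_deriv T (@dy R) f (fun x => Dy f x).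
Proof.
move=> sf.
have lf := sq_integrable_tri b H0 (smooth_cont sf).
have lx := sq_integrable_tri b H0 (smooth_cont (smoothDx sf)).
have ly := sq_integrable_tri b H0 (smooth_cont (smoothDy sf)).
have Z (k l : R) g : test_fun T g ->
    \int[mu]_(x in T') (k * Dx (fun x => f x * g x) x + l * Dy (fun x => f x * g x) x) = 0.
  move=> tg; have [sg _ _] := tg.
  have V e : (forall t, ~ T (edge_point e t)) -> edge_mean e (fun x => f x * g x) = 0.
    by move=> He; apply: edge_mean_eq0 => t; rewrite (test_fun_out tg) ?mulr0.
  rewrite int_tri_grad//; last exact: smoothM.
  rewrite !V ?(subr0, mulr0, addr0)// => t; by case: (tri_edge_out t).
have opp (a c : R) : a + c = 0 -> a = - c by move=> ac; apply/eqP; rewrite -addr_eq0 ac.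
have W e (k l : R) (h : R * R -> R) : (e = @dx R \/ e = @dy R) -> L2 h ->
    (forall g x, smooth g -> k * Dx (fun x => f x * g x) x + l * Dy (fun x => f x * g x) x =
       f x * 'D_e g x + h x * g x) -> is_weak_deriv T e f h.
  move=> He lh E; split=> // g tg; have [sg _ _] := tg.
  have lg := test_fun_L2 tg; have lDg := test_fun_D He tg.
  apply: opp.
  apply: (etrans (esym (RintegralD mT (sq_integrableM mT lf lDg) (sq_integrableM mT lh lg)))).
  by rewrite -[RHS](Z k l g tg); apply: eq_Rintegral => x _; rewrite E.
split.
- apply: (W _ 1 0); [by left|exact: lx|].
  move=> g x sg; rewrite derivexM//.
  move: (f x) (g x) (Dx f x : R) (Dx g x : R) ('D_(@dy R) _ x : R) => ? ? ? ? ?; ring.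
- apply: (W _ 0 1); [by right|exact: ly|].
  move=> g x sg; rewrite deriveyM//.
  move: (f x) (g x) ('D_(@dx R) _ x : R) (Dy f x : R) (Dy g x : R) => ? ? ? ? ?; ring.
Qed.

Lemma inH1_smooth f : smooth f -> inH1 T f.
Proof.
move=> sf; have [hx hy] := is_weak_deriv_smooth sf.
split; [exact: (sq_integrable_tri b H0 (smooth_cont sf))|by exists (fun x => Dx f x)|by exists (fun x => Dy f x)].
Qed.

Lemma weak_derivP v : inH1 T v ->
  is_weak_deriv T (@dx R) v (wdx v) /\ is_weak_deriv T (@dy R) v (wdy v).
Proof.
case=> _ [gx hx] [gy hy]; split.
  exact: (@xgetPex _ (fun=> 0) [set g | is_weak_deriv T (@dx R) v g] (ex_intro _ _ hx)).
exact: (@xgetPex _ (fun=> 0) [set g | is_weak_deriv T (@dy R) v g] (ex_intro _ _ hy)).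
Qed.

(** [weak_deriv] is a chosen representative; this transfers explicit weak derivatives to it almost
    everywhere, which is all that the norms see. *)
Lemma weak_deriv_aeE v gx gy : inL2 T v ->
  is_weak_deriv T (@dx R) v gx -> is_weak_deriv T (@dy R) v gy ->
  [/\ inH1 T v, ae_eq mu T' (wdx v) gx & ae_eq mu T' (wdy v) gy].
Proof.
move=> lv hx hy.
have Hv : inH1 T v by split; [|exists gx|exists gy].
have [wx wy] := weak_derivP Hv.
split => //; [exact: (weak_deriv_unique oT cT bT pT wx hx)|exact: (weak_deriv_unique oT cT bT pT wy hy)].
Qed.

Lemma inH1_lin (k l : R) u v : inH1 T u -> inH1 T v ->
  [/\ inH1 T (fun x => k * u x + l * v x),
     ae_eq mu T' (wdx (fun x => k * u x + l * v x)) (fun x => k * wdx u x + l * wdx v x) &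
     ae_eq mu T' (wdy (fun x => k * u x + l * v x)) (fun x => k * wdy u x + l * wdy v x)].
Proof.
move=> Hu Hv; have [ux uy] := weak_derivP Hu; have [vx vy] := weak_derivP Hv.
have [lu _ _] := Hu; have [lv _ _] := Hv.
apply: weak_deriv_aeE.
- by apply: (sq_integrableD mT); exact: sq_integrableZ.
- by apply: is_weak_deriv_lin => //; left.
- by apply: is_weak_deriv_lin => //; right.
Qed.

Definition H1cv (f_ : nat -> R * R -> R) v :=
  [/\ forall n, smooth (f_ n), cv f_ v, cv (fun n x => Dx (f_ n) x) (wdx v) &
      cv (fun n x => Dy (f_ n) x) (wdy v)].

Lemma H1cv_exists v : inH1 T v -> exists f_ : nat -> R * R -> R, H1cv f_ v.
Proof.
by move=> Hv; have [wx wy] := weak_derivP Hv; have [lv _ _] := Hv; exact: (smooth_dense oT cT bT pT lv wx wy).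
Qed.

Lemma deriv_lin (k l : R) f g x : smooth f -> smooth g ->
  Dx (fun x => k * f x + l * g x) x = k * Dx f x + l * Dx g x /\
  Dy (fun x => k * f x + l * g x) x = k * Dy f x + l * Dy g x.
Proof.
move=> sf sg; split.
- have d1 := is_deriveZ k (derivableP (@smooth_derx R f sf x)).
  have d2 := is_deriveZ l (derivableP (@smooth_derx R g sg x)).
  by case: (is_deriveD d1 d2).
- have d1 := is_deriveZ k (derivableP (@smooth_dery R f sf x)).
  have d2 := is_deriveZ l (derivableP (@smooth_dery R g sg x)).
  by case: (is_deriveD d1 d2).
Qed.

Lemma H1cv_lin (k l : R) (f_ g_ : nat -> R * R -> R) u v : inH1 T u -> inH1 T v -> H1cv f_ u -> H1cv g_ v ->
  H1cv (fun n x => k * f_ n x + l * g_ n x) (fun x => k * u x + l * v x).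
Proof.
move=> Hu Hv [sf fu fx fy] [sg gv gx gy].
have [[_ ux] [_ uy]] := weak_derivP Hu; have [[lvx _] [lvy _]] := weak_derivP Hv.
have [[lux _] [luy _]] := weak_derivP Hu.
have [lu _ _] := Hu; have [lv _ _] := Hv.
have [HL ex ey] := inH1_lin k l Hu Hv.
have [[lwx _] [lwy _]] := weak_derivP HL.
have lf n := sq_integrable_tri b H0 (smooth_cont (sf n)).
have lfx n := sq_integrable_tri b H0 (smooth_cont (smoothDx (sf n))).
have lfy n := sq_integrable_tri b H0 (smooth_cont (smoothDy (sf n))).
have lg n := sq_integrable_tri b H0 (smooth_cont (sg n)).
have lgx n := sq_integrable_tri b H0 (smooth_cont (smoothDx (sg n))).
have lgy n := sq_integrable_tri b H0 (smooth_cont (smoothDy (sg n))).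
have L (p q : R * R -> R) : L2 p -> L2 q -> L2 (fun x => k * p x + l * q x).
  by move=> lp lq; apply: (sq_integrableD mT); exact: sq_integrableZ.
split.
- by move=> n; apply: smoothD; exact: smoothZ.
- exact: l2cv_lin.
- have E : (fun n x => Dx (fun x => k * f_ n x + l * g_ n x) x) =
      (fun n x => k * Dx (f_ n) x + l * Dx (g_ n) x).
    by apply/funext => n; apply/funext => x; case: (deriv_lin k l x (sf n) (sg n)).
  rewrite E; exact: (ae_eq_l2cv mT (fun n => L _ _ (lfx n) (lgx n)) (L _ _ lux lvx) lwx (ae_eq_sym ex) (l2cv_lin mT k l lfx lgx lux lvx fx gx)).
- have E : (fun n x => Dy (fun x => k * f_ n x + l * g_ n x) x) =
      (fun n x => k * Dy (f_ n) x + l * Dy (g_ n) x).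
    by apply/funext => n; apply/funext => x; case: (deriv_lin k l x (sf n) (sg n)).
  rewrite E; exact: (ae_eq_l2cv mT (fun n => L _ _ (lfy n) (lgy n)) (L _ _ luy lvy) lwy (ae_eq_sym ey) (l2cv_lin mT k l lfy lgy luy lvy fy gy)).
Qed.

Lemma H1cv_smooth f : smooth f -> H1cv (fun=> f) f.
Proof.
move=> sf; have [hx hy] := is_weak_deriv_smooth sf.
have lf := sq_integrable_tri b H0 (smooth_cont sf).
have [Hf ex ey] := weak_deriv_aeE lf hx hy.
have [[lwx _] [lwy _]] := weak_derivP Hf.
have Z g : cv (fun=> g) g.
  rewrite /l2cv (_ : (fun n => _) = fun=> 0); first exact: cvg_cst.
  apply/funext => n; rewrite /l2norm; under eq_Rintegral do rewrite subrr expr0n/=.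
  by rewrite /Rintegral integral0 sqrtr0.
split=> //.
- by apply: (ae_eq_l2cv mT _ hx.1 lwx (ae_eq_sym ex) (Z _)) => n; exact: hx.1.
- by apply: (ae_eq_l2cv mT _ hy.1 lwy (ae_eq_sym ey) (Z _)) => n; exact: hy.1.
Qed.

End H1_limits.

Lemma cvgD0 (R : realType) (u v : nat -> R) : u n @[n --> \oo] --> (0 : R) ->
  v n @[n --> \oo] --> (0 : R) -> u n + v n @[n --> \oo] --> (0 : R).
Proof. by move=> hu hv; rewrite -[0 in X in _ --> X](addr0 (0 : R)); exact: cvgD. Qed.

Lemma cvgZ0 (R : realType) (k : R) (u : nat -> R) : u n @[n --> \oo] --> (0 : R) ->
  k * u n @[n --> \oo] --> (0 : R).
Proof.
by move=> hu; rewrite -[0 in X in _ --> X](mulr0 k); apply: cvgM => //; exact: cvg_cst.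
Qed.

Lemma sqr_sum3_le (R : realType) (a c d : R) : 0 <= a -> 0 <= c -> 0 <= d ->
  a ^+ 2 + (c ^+ 2 + d ^+ 2) <= (a + c + d) ^+ 2.
Proof. by move=> a0 c0 d0; nra. Qed.

Lemma L2norm_edgeE (R : realType) (e : (R * R) * (R * R)) w : 0 < edge_length e -> L2norm_edge e w =
  Num.sqrt (edge_length e) * l2norm (@lebesgue_measure R) (`[0, 1]%classic : set (measurableTypeR R)) (w \o edge_point e).
Proof. by move=> e0; rewrite /L2norm_edge /line_integral sqrtrM// ltW. Qed.

Lemma lerD3 (R : realType) (a c d a1 c1 d1 a2 c2 d2 : R) : a <= a1 + a2 -> c <= c1 + c2 ->
  d <= d1 + d2 -> a + c + d <= a1 + c1 + d1 + (a2 + c2 + d2).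
Proof. by move=> h1 h2 h3; lra. Qed.

Lemma sqr_le_sum (R : realType) (K a X Y : R) : 0 <= K -> 0 <= X -> 0 <= Y ->
  a ^+ 2 <= K * (X ^+ 2 + Y ^+ 2) -> `|a| <= Num.sqrt K * (X + Y).
Proof.
move=> K0 X0 Y0 h; rewrite -(@ler_pXn2r _ 2)// ?nnegrE ?mulr_ge0 ?sqrtr_ge0 ?addr_ge0//.
rewrite real_normK ?num_real// exprMn sqr_sqrtr//; apply: (le_trans h).
by apply: ler_wpM2l => //; nra.
Qed.

Lemma cvg_lin2 (R : realType) (k l a c : R) (u v : nat -> R) : u n @[n --> \oo] --> a ->
  v n @[n --> \oo] --> c -> k * u n + l * v n @[n --> \oo] --> k * a + l * c.
Proof. by move=> hu hv; apply: cvgD; apply: cvgM => //; exact: cvg_cst. Qed.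

(* Sealed, as conversion problems that compare two unequal norms or derivatives by
   unfolding them do not terminate in reasonable time. *)
HB.lock Definition tnorm (R : realType) (U : set (R * R)) (f : R * R -> R) : R :=
  l2norm (@area R) (U : set (measurableTypeR R * measurableTypeR R)) f.
HB.lock Definition pdx (R : realType) (f : R * R -> R) : R * R -> R := fun x => 'D_(@dx R) f x.
HB.lock Definition pdy (R : realType) (f : R * R -> R) : R * R -> R := fun x => 'D_(@dy R) f x.
HB.lock Definition wpdx (R : realType) (U : set (R * R)) (v : R * R -> R) : R * R -> R :=
  weak_deriv U (@dx R) v.
HB.lock Definition wpdy (R : realType) (U : set (R * R)) (v : R * R -> R) : R * R -> R :=
  weak_deriv U (@dy R) v.

Definition H1lim (R : realType) (U : set (R * R)) (f_ : nat -> R * R -> R) (v : R * R -> R) : Prop :=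
  [/\ forall n, smooth (f_ n),
     tnorm U (fun x => f_ n x - v x) @[n --> \oo] --> (0 : R),
     tnorm U (fun x => pdx (f_ n) x - wpdx U v x) @[n --> \oo] --> (0 : R) &
     tnorm U (fun x => pdy (f_ n) x - wpdy U v x) @[n --> \oo] --> (0 : R)].

Lemma H1semiE (R : realType) (U : set (R * R)) v : H1semi U v =
  Num.sqrt (tnorm U (wpdx U v) ^+ 2 + tnorm U (wpdy U v) ^+ 2).
Proof. by rewrite tnorm.unlock wpdx.unlock wpdy.unlock. Qed.

Lemma tnorm_ge0 (R : realType) (U : set (R * R)) f : 0 <= tnorm U f.
Proof. by rewrite tnorm.unlock; exact: l2norm_ge0. Qed.

Lemma is_traceE (R : realType) (U : set (R * R)) e v w : is_trace U e v w <->
  inL2_edge e w /\ exists2 f_ : nat -> R * R -> R, H1lim U f_ v &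
     L2norm_edge e (fun x => f_ n x - w x) @[n --> \oo] --> (0 : R).
Proof.
rewrite /H1lim tnorm.unlock pdx.unlock pdy.unlock wpdx.unlock wpdy.unlock; split.
  by case=> l [f [sf c cx cy ce]]; exact: (conj l (ex_intro2 _ _ f (And4 sf c cx cy) ce)).
by case=> l [f [sf c cx cy] ce]; exact: (conj l (ex_intro _ f (And5 sf c cx cy ce))).
Qed.

(** * Existence of traces and the Poincare inequality for vanishing edge integral *)

Section trace.
Variable R : realType.
Notation M := (measurableTypeR R).
Notation mu := (@area R).
Notation leb := (@lebesgue_measure R).
Implicit Types (f g v w : R * R -> R) (x y p : R * R).

Variables (b H : R).
Hypothesis H0 : 0 < H.

Notation T := (tri b H).
Notation T' := (T : set (M * M)).
Let mT : measurable T' := @measurable_tri R b H.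
Let oT : open T. Proof. exact: open_tri. Qed.
Let cT := @convex_tri R b H.
Let bT := @bounded_tri R b H H0.
Let pT := @tri_ne R b H H0.
Notation nrm := (tnorm T).
Notation wdx := (wpdx T).
Notation wdy := (wpdy T).
Notation I01 := (`[0, 1]%classic : set M).
Let m01 : measurable I01. Proof. by []. Qed.

Lemma H1limE (f_ : nat -> R * R -> R) v : H1lim T f_ v = H1cv b H f_ v.
Proof. by rewrite /H1lim tnorm.unlock pdx.unlock pdy.unlock wpdx.unlock wpdy.unlock. Qed.

Lemma inL2_smooth f : smooth f -> [/\ inL2 T f, inL2 T (pdx f) & inL2 T (pdy f)].
Proof.
move=> sf; rewrite pdx.unlock pdy.unlock.
have s1 := sq_integrable_tri b H0 (smooth_cont sf).
have s2 := sq_integrable_tri b H0 (smooth_cont (smoothDx sf)).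
have s3 := sq_integrable_tri b H0 (smooth_cont (smoothDy sf)).
exact: (And3 s1 s2 s3).
Qed.

Lemma inL2_inH1 v : inH1 T v -> [/\ inL2 T v, inL2 T (wdx v) & inL2 T (wdy v)].
Proof.
move=> Hv; have [[lx _] [ly _]] := weak_derivP Hv; have [l _ _] := Hv.
rewrite wpdx.unlock wpdy.unlock; exact: (And3 l lx ly).
Qed.

Lemma H1lim_exists v : inH1 T v -> exists f_ : nat -> R * R -> R, H1lim T f_ v.
Proof. by move=> Hv; have [f_ cf] := H1cv_exists H0 Hv; exists f_; rewrite H1limE. Qed.

Lemma H1lim_lin (k l : R) (f_ g_ : nat -> R * R -> R) u v : inH1 T u -> inH1 T v ->
  H1lim T f_ u -> H1lim T g_ v ->
  H1lim T (fun n x => k * f_ n x + l * g_ n x) (fun x => k * u x + l * v x).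
Proof. by rewrite !H1limE; exact: H1cv_lin. Qed.

Lemma H1lim_smooth f : smooth f -> H1lim T (fun=> f) f.
Proof. by rewrite H1limE; exact: H1cv_smooth. Qed.

Lemma tnorm_triangle f g v : inL2 T f -> inL2 T g -> inL2 T v ->
  nrm (fun x => f x - g x) <= nrm (fun x => f x - v x) + nrm (fun x => g x - v x).
Proof.
move=> lf lg lv; rewrite tnorm.unlock [X in _ <= _ + X](l2normC mu T').
exact: (l2norm_triangleB mT (sq_integrableB mT lf lv) (sq_integrableB mT lv lg)).
Qed.

Lemma tnorm_lim (f_ : nat -> R * R -> R) v : (forall n, inL2 T (f_ n)) -> inL2 T v ->
  nrm (fun x => f_ n x - v x) @[n --> \oo] --> (0 : R) -> nrm (f_ n) @[n --> \oo] --> nrm v.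
Proof. by rewrite tnorm.unlock => lf lv; exact: (l2cv_norm mT lf lv). Qed.

Lemma int_lim (f_ : nat -> R * R -> R) v : (forall n, inL2 T (f_ n)) -> inL2 T v ->
  nrm (fun x => f_ n x - v x) @[n --> \oo] --> (0 : R) ->
  \int[mu]_(x in T') f_ n x @[n --> \oo] --> \int[mu]_(x in T') v x.
Proof.
rewrite tnorm.unlock => lf lv; have [l1 _ _] := inL2_smooth (@smooth_cst R 1).
exact: (l2cv_int mT l1 lf lv).
Qed.

Lemma int_gradsq f : smooth f ->
  \int[mu]_(x in T') gradsq f x = nrm (pdx f) ^+ 2 + nrm (pdy f) ^+ 2.
Proof.
move=> sf; have [_ lx ly] := inL2_smooth sf.
have E : gradsq f = (fun x => pdx f x ^+ 2 + pdy f x ^+ 2).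
  by rewrite pdx.unlock pdy.unlock.
rewrite E tnorm.unlock (@l2norm_sqr _ _ _ mu T' (pdx f)) (@l2norm_sqr _ _ _ mu T' (pdy f)).
exact: (RintegralD mT lx.2 ly.2).
Qed.

Lemma pdB f g : smooth f -> smooth g ->
  pdx (fun x => f x - g x) = (fun x => pdx f x - pdx g x) /\
  pdy (fun x => f x - g x) = (fun x => pdy f x - pdy g x).
Proof.
move=> sf sg; rewrite pdx.unlock pdy.unlock; split; apply/funext => x.
  exact: (deriveB (@smooth_derx R f sf x) (@smooth_derx R g sg x)).
exact: (deriveB (@smooth_dery R f sf x) (@smooth_dery R g sg x)).
Qed.

Definition h1dist f v : R :=
  nrm (fun x => f x - v x) + nrm (fun x => pdx f x - wdx v x) + nrm (fun x => pdy f x - wdy v x).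

Lemma h1dist_ge0 f v : 0 <= h1dist f v.
Proof. by rewrite /h1dist !addr_ge0 ?tnorm_ge0. Qed.

Lemma H1lim_h1dist (f_ : nat -> R * R -> R) v : H1lim T f_ v -> h1dist (f_ n) v @[n --> \oo] --> (0 : R).
Proof. by move=> [_ c cx cy]; exact: (cvgD0 (cvgD0 c cx) cy). Qed.

Lemma tnorm_sqr f : nrm f ^+ 2 = \int[mu]_(x in T') (f x ^+ 2).
Proof. by rewrite tnorm.unlock (@l2norm_sqr _ _ _ mu T'). Qed.

Variable e : (R * R) * (R * R).
Hypothesis e_neq : 0 < edge_length e.
Hypothesis tb : trace_bounded b H e.
Notation enrm := (l2norm leb I01).

Lemma edge_norm_le : exists2 C, 0 <= C & forall f, smooth f ->
  enrm (f \o edge_point e) <= C * (nrm f + nrm (pdx f) + nrm (pdy f)).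
Proof.
have [C C0 HC] := tb; exists (Num.sqrt C); first exact: sqrtr_ge0.
move=> f sf; have := HC f sf.
rewrite /grad_int (int_gradsq sf) -tnorm_sqr => h.
have n1 := tnorm_ge0 T f; have n2 := tnorm_ge0 T (pdx f).
have n3 := tnorm_ge0 T (pdy f).
rewrite -(@ler_pXn2r _ 2)// ?nnegrE ?l2norm_ge0//; last first.
  by rewrite mulr_ge0 ?sqrtr_ge0// !addr_ge0.
rewrite (l2norm_sqr leb I01 (f \o edge_point e)) exprMn (sqr_sqrtr C0); apply: (le_trans h).
by apply: ler_wpM2l => //; exact: sqr_sum3_le.
Qed.

(** The trace bound for f - g, with v inserted. It serves twice: approximations of v are Cauchy on
    the edge, and any two approximating sequences have the same limit there. *)
Lemma edge_norm_dist : exists2 C, 0 <= C & forall f g v, inH1 T v -> smooth f -> smooth g ->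
  enrm (fun t => f (edge_point e t) - g (edge_point e t)) <= C * (h1dist f v + h1dist g v).
Proof.
have [C C0 HC] := edge_norm_le; exists C => // f g v Hv sf sg.
have [lv lvx lvy] := inL2_inH1 Hv.
have [lf lfx lfy] := inL2_smooth sf; have [lg lgx lgy] := inL2_smooth sg.
apply: (le_trans (HC (fun x => f x - g x) (smoothB sf sg))).
apply: ler_wpM2l => //; rewrite /h1dist.
have [-> ->] := pdB sf sg.
exact: (lerD3 (tnorm_triangle lf lg lv) (tnorm_triangle lfx lgx lvx) (tnorm_triangle lfy lgy lvy)).
Qed.

(* Any function with edge_param (edge_point e t) = t would do: it extends an L2 function of the
   parameter t to a function on the plane, as is_trace requires. *)
Definition edge_param p : R :=
  ((p.1 - e.1.1) * (e.2.1 - e.1.1) + (p.2 - e.1.2) * (e.2.2 - e.1.2)) / edge_length e ^+ 2.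

Lemma edge_paramK t : edge_param (edge_point e t) = t.
Proof.
have E : edge_length e ^+ 2 = (e.2.1 - e.1.1) ^+ 2 + (e.2.2 - e.1.2) ^+ 2.
  by rewrite sqr_sqrtr// addr_ge0// sqr_ge0.
have n0 : edge_length e ^+ 2 != 0 by rewrite expf_neq0// lt0r_neq0.
rewrite /edge_param /edge_point /=; apply: (canLR (mulfK n0)); rewrite E; ring.
Qed.

Lemma sq_integrable_edge f : continuous f -> sq_integrable leb I01 (f \o edge_point e).
Proof. by move=> cf; apply: sq_integrable01; exact: continuous_edge_comp. Qed.

(** Restrictions of smooth approximations converge on the edge by the trace bound; the sequence is
    first thinned out to reach the geometric rate that [l2_complete] requires. *)
Lemma trace_exists v : inH1 T v -> exists w, is_trace T e v w.
Proof.
move=> Hv; have [f_ cf] := H1lim_exists Hv.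
have [C C0 HC] := edge_norm_dist.
have d0 := H1lim_h1dist cf; have [sf_ _ _ _] := cf.
(* Chosen so that (C + 1) (eps n + eps n) = 4 ^ -n; C + 1 in place of C avoids a division by 0. *)
pose eps n : R := 4^-1 ^+ n / (2 * (C + 1)).
have K0 : 0 < 2 * (C + 1) by rewrite mulr_gt0// ltr_wpDl.
have eps0 n : 0 < eps n by rewrite divr_gt0// exprn_gt0// invr_gt0.
have ex n : exists k, h1dist (f_ k) v <= eps n.
  have /cvgrPdist_le /(_ _ (eps0 n)) [N _ HN] := d0.
  by exists N; have := HN N (leqnn _); rewrite sub0r normrN ger0_norm// h1dist_ge0.
have [k Hk] := choice ex.
pose g n := f_ (k n).
have sg n : smooth (g n) by exact: sf_.
have leg n m : (n <= m)%N ->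
    enrm (fun t => g m (edge_point e t) - g n (edge_point e t)) <= 4^-1 ^+ n.
  move=> nm; apply: (le_trans (HC (g m) (g n) v Hv (sg m) (sg n))).
  have em : eps m <= eps n.
    rewrite /eps; apply: ler_wpM2r; first by rewrite invr_ge0 ltW.
    by apply: ler_wiXn2l => //; rewrite ?invr_ge0// invf_le1// ler1n.
  have : C * (h1dist (g m) v + h1dist (g n) v) <= (C + 1) * (eps n + eps n).
    apply: ler_pM; [exact: C0|by apply: addr_ge0; exact: h1dist_ge0|by rewrite lerDl|].
    by apply: lerD; [exact: (le_trans (Hk m) em)|exact: Hk].
  move=> h; apply: (le_trans h); rewrite /eps le_eqVlt; apply/orP; left; apply/eqP.
  have C1 : C + 1 != 0 by rewrite lt0r_neq0// ltr_wpDl.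
  by move: (4^-1 ^+ n) => A; field.
have [w0 lw0 cw0] := l2_complete m01 (fun n => sq_integrable_edge (smooth_cont (sg n))) leg.
exists (w0 \o edge_param).
have Ew : (w0 \o edge_param) \o edge_point e = w0.
  by apply/funext => t; rewrite /= edge_paramK.
have lE : inL2_edge e (w0 \o edge_param).
  by rewrite /inL2_edge Ew; case: lw0 => m1 i1; split=> //; move: i1; apply: eq_integrable => // t _ /=; rewrite edge_paramK.
have dg : h1dist (g n) v @[n --> \oo] --> (0 : R).
  apply: (@cvg0_le _ _ eps) => [n|]; first by rewrite h1dist_ge0 Hk.
  rewrite -[0](mul0r (2 * (C + 1))^-1); apply: cvgM; last exact: cvg_cst.
  by apply: cvg_expr; rewrite ger0_norm ?invr_ge0// invf_lt1// ltr1n.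
have le3 n : [/\ 0 <= nrm (fun x => g n x - v x) <= h1dist (g n) v,
   0 <= nrm (fun x => pdx (g n) x - wdx v x) <= h1dist (g n) v &
   0 <= nrm (fun x => pdy (g n) x - wdy v x) <= h1dist (g n) v].
  have n1 := tnorm_ge0 T (fun x => g n x - v x).
  have n2 := tnorm_ge0 T (fun x => pdx (g n) x - wdx v x).
  have n3 := tnorm_ge0 T (fun x => pdy (g n) x - wdy v x).
  rewrite n1 n2 n3 /h1dist; move: (nrm _) (nrm _) (nrm _) n1 n2 n3 => a c d a0 c0 d0'.
  by split; lra.
apply/is_traceE; split; first exact: lE.
exists g.
  split; [exact: sg| | |]; apply: cvg0_le dg => n; by case: (le3 n).
rewrite (_ : (fun n => _) = (fun n => Num.sqrt (edge_length e) *
    enrm (fun t => g n (edge_point e t) - w0 t))); last first.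
  apply/funext => n; rewrite (L2norm_edgeE _ e_neq); congr (_ * l2norm _ _ _).
  by apply/funext => t; rewrite /= edge_paramK.
exact: (cvgZ0 _ cw0).
Qed.

Lemma traceP v : inH1 T v -> is_trace T e v (trace T e v).
Proof.
move=> Hv; have [w Hw] := trace_exists Hv.
exact: (@xgetPex _ (fun=> 0) [set w | is_trace T e v w] (ex_intro _ _ Hw)).
Qed.

(** [trace] is a chosen function with its own approximating sequence; comparing that sequence with
    an arbitrary one shows that every H1 approximation computes the edge integral. *)
Lemma edge_integral_lim (f_ : nat -> R * R -> R) v : inH1 T v -> H1lim T f_ v ->
  edge_length e * edge_mean e (f_ n) @[n --> \oo] --> edge_integral T e v.
Proof.
move=> Hv cf; rewrite /edge_integral /line_integral.
apply: cvgM; first exact: cvg_cst.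
have [lw [g cg cw]] := (is_traceE _ _ _ _).1 (traceP Hv).
have [sg _ _ _] := cg.
set w := trace T e v in lw cw *.
have [C C0 HC] := edge_norm_dist.
have [sf _ _ _] := cf.
have dg : h1dist (g n) v @[n --> \oo] --> (0 : R) by exact: H1lim_h1dist.
have df := H1lim_h1dist cf.
have lw' : sq_integrable leb I01 (w \o edge_point e) by exact: lw.
have lf n := sq_integrable_edge (smooth_cont (sf n)).
have lg n := sq_integrable_edge (smooth_cont (sg n)).
have s1 : sq_integrable leb I01 (fun=> 1 : R).
  by apply: sq_integrable01 => t; exact: cvg_cst.
apply: (l2cv_int m01 s1 lf lw').
have sl : Num.sqrt (edge_length e) != 0 by rewrite gt_eqF// sqrtr_gt0.
have cw' : enrm (fun t => g n (edge_point e t) - w (edge_point e t)) @[n --> \oo] --> (0 : R).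
  rewrite (_ : (fun n => _) = (fun n => (Num.sqrt (edge_length e))^-1 *
    L2norm_edge e (fun x => g n x - w x))); last first.
    by apply/funext => n; rewrite (L2norm_edgeE _ e_neq) mulKf.
  exact: (cvgZ0 _ cw).
apply: (@cvg0_le _ _ (fun n => C * (h1dist (f_ n) v + h1dist (g n) v) +
   enrm (fun t => g n (edge_point e t) - w (edge_point e t)))); last first.
  exact: (cvgD0 (cvgZ0 C (cvgD0 df dg)) cw').
move=> n; rewrite l2norm_ge0/=.
apply: (le_trans (l2norm_triangleB m01 (sq_integrableB m01 (lf n) (lg n)) (sq_integrableB m01 (lg n) lw'))).
by rewrite lerD2r; exact: HC.
Qed.

(** The chosen traces need not be linear in v pointwise, but the limit of the edge integrals of
    approximations is unique. *)
Lemma edge_integral_lin (k l : R) u v : inH1 T u -> inH1 T v ->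
  edge_integral T e (fun x => k * u x + l * v x) =
  k * edge_integral T e u + l * edge_integral T e v.
Proof.
move=> Hu Hv.
have [f cf] := H1lim_exists Hu; have [g cg] := H1lim_exists Hv.
have [HL _ _] := inH1_lin H0 k l Hu Hv.
have cL := H1lim_lin k l Hu Hv cf cg.
have limL := edge_integral_lim HL cL.
have limf := edge_integral_lim Hu cf; have limg := edge_integral_lim Hv cg.
apply: (cvg_unique _ limL) => //.
have [sf _ _ _] := cf; have [sg _ _ _] := cg.
rewrite (_ : (fun n => _) = (fun n => k * (edge_length e * edge_mean e (f n)) +
   l * (edge_length e * edge_mean e (g n)))).
  exact: cvg_lin2 limf limg.
apply/funext => n; rewrite /edge_mean Rintegral_lin2//.
- move: (Rintegral _ _ _) (Rintegral _ _ _) => A B; ring.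
- exact: (integrable01 (continuous_edge_comp (smooth_cont (sf n)))).
- exact: (integrable01 (continuous_edge_comp (smooth_cont (sg n)))).
Qed.

Lemma edge_integral_smooth f : smooth f -> edge_integral T e f = edge_length e * edge_mean e f.
Proof.
move=> sf; have := edge_integral_lim (inH1_smooth b H0 sf) (H1lim_smooth sf).
by move=> h; apply: (cvg_unique _ h) => //; exact: cvg_cst.
Qed.

(** With m the mean over the triangle, ||f|| <= ||f - m|| + |m| ||1||. The first term is bounded by
    [poincare_mean]; with E the edge mean of f, |m| <= |E| + |E - m|, and the trace bound for f - m
    controls |E - m| by the gradient. *)
Lemma poincare_edge_smooth : exists2 C, 0 <= C & forall f, smooth f ->
  nrm f <= C * (nrm (pdx f) + nrm (pdy f) + `|edge_mean e f|).
Proof.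
have [C C0 HC] := tb.
pose K := 32 * (tri_diam b H) ^+ 2.
have K0 : 0 <= K by rewrite mulr_ge0// sqr_ge0.
pose S := Num.sqrt (C * (K + 1)); pose W := nrm (fun=> 1).
have S0 : 0 <= S by exact: sqrtr_ge0.
have W0 : 0 <= W by exact: tnorm_ge0.
exists (Num.sqrt K + W + W * S); first by rewrite !addr_ge0 ?mulr_ge0// sqrtr_ge0.
move=> f sf; pose m := mean T f; pose g x := f x - m.
have sm : smooth (fun=> m) by exact: smooth_cst.
have sg : smooth g by exact: smoothB.
have [lf lfx lfy] := inL2_smooth sf; have [lg lgx lgy] := inL2_smooth sg; have [lm _ _] := inL2_smooth sm.
have [l1 _ _] := inL2_smooth (@smooth_cst R 1).
have Eg : gradsq g = gradsq f.
  have [Ex Ey] := pdB sf sm; rewrite /gradsq /g; apply/funext => x.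
  have -> : 'D_(@dx R) (fun x => f x - m) x = pdx (fun x => f x - m) x by rewrite pdx.unlock.
  have -> : 'D_(@dy R) (fun x => f x - m) x = pdy (fun x => f x - m) x by rewrite pdy.unlock.
  by rewrite Ex Ey pdx.unlock pdy.unlock !derive_cst !subr0.
have pm := poincare_mean oT cT bT pT sf.
have tg := HC g sg.
have sg2 := sqr_int01 (continuous_edge_comp (e := e) (smooth_cont sg)).
move: tg pm sg2; rewrite /grad_int Eg (int_gradsq sf) -/m -/K.
rewrite -/(edge_mean e g) -/(edge_mean e (fun x => g x ^+ 2)) -!tnorm_sqr.
have -> : edge_mean e g = edge_mean e f - m.
  rewrite edge_meanB; [|exact: smooth_cont|exact: smooth_cont]; congr (_ - _).
  have E1 : fine (leb I01) = 1 by rewrite leb01.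
  by rewrite /edge_mean Rintegral_cst// E1 mulr1.
have nf : nrm f <= nrm g + `|m| * W.
  rewrite /W tnorm.unlock -(l2normZ mT m l1).
  rewrite (_ : (fun x => m * _) = (fun=> m)); first exact: (l2norm_leD mT lf lm).
  by apply/funext => x; rewrite mulr1.
have g0 := tnorm_ge0 T g.
have X0 := tnorm_ge0 T (pdx f); have Y0 := tnorm_ge0 T (pdy f).
move: nf g0 X0 Y0; rewrite -/g.
have F (N G X Y E : R) : N <= G + `|m| * W -> 0 <= G -> 0 <= X -> 0 <= Y ->
    edge_mean e (fun x => g x ^+ 2) <= C * (G ^+ 2 + (X ^+ 2 + Y ^+ 2)) ->
    G ^+ 2 <= K * (X ^+ 2 + Y ^+ 2) ->
    (E - m) ^+ 2 <= edge_mean e (fun x => g x ^+ 2) ->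
    N <= (Num.sqrt K + W + W * S) * (X + Y + `|E|).
  move: (edge_mean e _) => E2 hN G0 X0 Y0 h1 h2 h3.
  have hG := sqr_le_sum K0 X0 Y0 h2; rewrite ger0_norm// in hG.
  have CK0 : 0 <= C * (K + 1) by rewrite mulr_ge0// addr_ge0.
  have hE : (E - m) ^+ 2 <= C * (K + 1) * (X ^+ 2 + Y ^+ 2).
    apply: (le_trans h3); apply: (le_trans h1); rewrite -mulrA; apply: ler_wpM2l => //.
    by rewrite mulrDl mul1r lerD2r.
  have hm := sqr_le_sum CK0 X0 Y0 hE; rewrite -/S in hm.
  have hm' : `|m| <= `|E| + S * (X + Y).
    have -> : m = E - (E - m) by ring.
    by rewrite (le_trans (ler_normB _ _))// lerD2l.
  apply: (le_trans hN); apply: (le_trans (lerD hG (ler_wpM2r W0 hm'))).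
  have sK := sqrtr_ge0 K; have nE := normr_ge0 E.
  move: (Num.sqrt K) (`|E|) sK nE => k en k0 en0.
  rewrite -subr_ge0 (_ : _ - _ = k * en + W * (X + Y) + W * S * en); last by ring.
  by rewrite !addr_ge0 ?mulr_ge0 ?addr_ge0.
exact: F.
Qed.

(** The smooth inequality passes to the limit, where the edge mean disappears; the factor 2 comes
    from a + d <= 2 sqrt (a ^ 2 + d ^ 2). *)
Lemma poincare_edge : exists2 C, 0 <= C & forall v, inH1 T v -> edge_integral T e v = 0 ->
  nrm v <= C * H1semi T v.
Proof.
have [C C0 HC] := poincare_edge_smooth.
exists (2 * C); first exact: mulr_ge0.
move=> v Hv Ev; have [f cf] := H1lim_exists Hv.
have [sf c cx cy] := cf.
have [lv lvx lvy] := inL2_inH1 Hv.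
have lf n : inL2 T (f n) by case: (inL2_smooth (sf n)).
have lfx n : inL2 T (pdx (f n)) by case: (inL2_smooth (sf n)).
have lfy n : inL2 T (pdy (f n)) by case: (inL2_smooth (sf n)).
have N1 := tnorm_lim lf lv c; have N2 := tnorm_lim lfx lvx cx; have N3 := tnorm_lim lfy lvy cy.
have El : edge_mean e (f n) @[n --> \oo] --> (0 : R).
  have := edge_integral_lim Hv cf; rewrite Ev => h.
  rewrite (_ : (fun n => _) = (fun n => (edge_length e)^-1 * (edge_length e * edge_mean e (f n)))).
    exact: (cvgZ0 _ h).
  by apply/funext => n; rewrite mulKf// lt0r_neq0.
have El' : `|edge_mean e (f n)| @[n --> \oo] --> (0 : R).
  by rewrite -(normr0 R); exact: cvg_norm.
have : nrm v <= C * (nrm (wdx v) + nrm (wdy v) + 0).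
  have N4 : C * (nrm (pdx (f n)) + nrm (pdy (f n)) + `|edge_mean e (f n)|) @[n --> \oo] -->
      C * (nrm (wdx v) + nrm (wdy v) + 0).
    by apply: cvgM; [exact: cvg_cst|apply: cvgD => //; exact: cvgD].
  by apply: (ler_cvg_to N1 N4); apply: nearW => n; exact: HC.
move=> h; apply: (le_trans h); rewrite addr0 (mulrC 2) -mulrA; apply: ler_wpM2l => //.
have n2 := tnorm_ge0 T (wdx v); have n3 := tnorm_ge0 T (wdy v).
rewrite H1semiE; set a := nrm _ in n2 *; set d := nrm _ in n3 *.
have s0 := sqrtr_ge0 (a ^+ 2 + d ^+ 2).
have s2 : Num.sqrt (a ^+ 2 + d ^+ 2) ^+ 2 = a ^+ 2 + d ^+ 2 by rewrite sqr_sqrtr// addr_ge0// sqr_ge0.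
move: (Num.sqrt _) s0 s2 => s s0 s2.
rewrite -(@ler_pXn2r _ 2)// ?nnegrE ?addr_ge0 ?mulr_ge0// exprMn s2.
clearbody a d; nra.
Qed.

End trace.

(** * The quadratic form behind the constant *)

Lemma quad_form_ge0 (R : realType) (p q r A B : R) : 0 <= p -> 0 <= q -> p * q = r ^+ 2 ->
  0 <= p * A ^+ 2 + q * B ^+ 2 - 2 * r * A * B.
Proof.
move=> p0 q0 pq; have [p00|pn] := eqVneq p 0.
  have r0 : r = 0 by apply/eqP; rewrite -sqrf_eq0 -pq p00 mul0r.
  by rewrite p00 r0 !(mulr0, mul0r) add0r subr0 mulr_ge0// sqr_ge0.
have pp : 0 < p by rewrite lt_neqAle eq_sym pn.
rewrite -(pmulr_rge0 _ pp).
rewrite [leRHS](_ : _ = (p * A - r * B) ^+ 2 + (p * q - r ^+ 2) * B ^+ 2); last by ring.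
by rewrite pq subrr mul0r addr0 sqr_ge0.
Qed.

(* lam is the root of lam ^ 2 - (c1 ^ 2 + c2 ^ 2 + 2 c1 c2 c ^ 2) lam + s ^ 4 c1 ^ 2 c2 ^ 2 = 0
   for which the difference of the two sides is a positive semidefinite form in (A, B); its
   determinant vanishes. *)
Lemma quad_form_bound (R : realType) (c1 c2 s c A B lam x : R) : 0 <= c1 -> 0 <= c2 ->
  s ^+ 2 + c ^+ 2 = 1 -> 0 <= x ->
  x ^+ 2 = c1 ^+ 2 + c2 ^+ 2 + 2 * c1 * c2 * (2 * c ^+ 2 - 1) ->
  2 * lam = c1 ^+ 2 + c2 ^+ 2 + 2 * c1 * c2 * c ^+ 2 + (c1 + c2) * x ->
  s ^+ 2 * (c1 ^+ 2 * A ^+ 2 + c2 ^+ 2 * B ^+ 2 + 2 * `|c| * (c1 * c2 * A * B)) <=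
  lam * (A ^+ 2 + B ^+ 2 - 2 * `|c| * (A * B)).
Proof.
move=> c10 c20 sc x0 xE lamE.
have k2 : `|c| ^+ 2 = c ^+ 2 by rewrite real_normK ?num_real.
have k0 := normr_ge0 c; move: (`|c|) k2 k0 => k k2 k0.
have m0 : 0 <= c1 * c2 by rewrite mulr_ge0.
have s20 := sqr_ge0 s; have c20' := sqr_ge0 c.
have s21 : s ^+ 2 <= 1 by lra.
have mc0 : 0 <= c1 * c2 * c ^+ 2 by rewrite mulr_ge0.
(* x ^ 2 = (c1 - c2) ^ 2 + 4 c1 c2 c ^ 2, so x >= |c1 - c2|. Multiplied by c1 + c2 this gives lam >=
   c1 ^ 2 and lam >= c2 ^ 2, whence both diagonal entries of the form are nonnegative. *)
have x1 : c1 - c2 <= x /\ c2 - c1 <= x.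
  have : `|c1 - c2| <= x.
    rewrite -(@ler_pXn2r _ 2)// ?nnegrE//; rewrite real_normK ?num_real// xE; lra.
  by rewrite ler_norml => /andP[? ?]; split; lra.
have [x1a x1b] := x1.
have l1 : c1 ^+ 2 <= lam.
  have : (c1 + c2) * (c1 - c2) <= (c1 + c2) * x by rewrite ler_wpM2l// addr_ge0.
  lra.
have l2 : c2 ^+ 2 <= lam.
  have : (c1 + c2) * (c2 - c1) <= (c1 + c2) * x by rewrite ler_wpM2l// addr_ge0.
  lra.
have a11 : 0 <= lam - s ^+ 2 * c1 ^+ 2.
  have : s ^+ 2 * c1 ^+ 2 <= c1 ^+ 2 by rewrite ler_piMl ?sqr_ge0.
  lra.
have a22 : 0 <= lam - s ^+ 2 * c2 ^+ 2.
  have : s ^+ 2 * c2 ^+ 2 <= c2 ^+ 2 by rewrite ler_piMl ?sqr_ge0.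
  lra.
(* (c1 + c2) ^ 2 x ^ 2 is the discriminant of this equation, so [lam], with the plus sign, is its
   larger root. *)
have lamq : lam ^+ 2 - (c1 ^+ 2 + c2 ^+ 2 + 2 * c1 * c2 * c ^+ 2) * lam +
    s ^+ 2 * s ^+ 2 * (c1 * c2) ^+ 2 = 0.
  have s2E : s ^+ 2 = 1 - c ^+ 2 by lra.
  rewrite s2E; set Tq := _ + _ + 2 * c1 * c2 * c ^+ 2 in lamE *.
  have -> : lam = (Tq + (c1 + c2) * x) / 2 by rewrite -lamE; field.
  have -> : ((Tq + (c1 + c2) * x) / 2) ^+ 2 - Tq * ((Tq + (c1 + c2) * x) / 2) =
    ((c1 + c2) ^+ 2 * x ^+ 2 - Tq ^+ 2) / 4 by field.
  by rewrite xE /Tq; field.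
have det : (lam - s ^+ 2 * c1 ^+ 2) * (lam - s ^+ 2 * c2 ^+ 2) =
    (k * (lam + s ^+ 2 * (c1 * c2))) ^+ 2.
  rewrite exprMn k2 (_ : c ^+ 2 = 1 - s ^+ 2); last by lra.
  apply/eqP; rewrite -subr_eq0; apply/eqP.
  rewrite (_ : _ - _ = s ^+ 2 * (lam ^+ 2 - (c1 ^+ 2 + c2 ^+ 2 + 2 * c1 * c2 * (1 - s ^+ 2)) * lam +
    s ^+ 2 * s ^+ 2 * (c1 * c2) ^+ 2)); last by ring.
  by rewrite (_ : 1 - s ^+ 2 = c ^+ 2) ?lamq ?mulr0//; lra.
have := quad_form_ge0 A B a11 a22 det.
move=> h; rewrite -subr_ge0; apply: le_trans h _.
by rewrite le_eqVlt; apply/orP; left; apply/eqP; ring.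
Qed.

(** * Fluxes and the Fortin interpolation *)

Section flux.
Variable R : realType.
Notation M := (measurableTypeR R).
Notation mu := (@area R).
Implicit Types (f g v w : R * R -> R) (x y p : R * R).

Variables (b H : R).
Hypothesis H0 : 0 < H.
Let Hn0 : H != 0. Proof. exact: lt0r_neq0. Qed.

Notation T := (tri b H).
Notation T' := (T : set (M * M)).
Let mT : measurable T' := @measurable_tri R b H.
Notation nrm := (tnorm T).
Notation wdx := (wpdx T).
Notation wdy := (wpdy T).
Notation e1 := (tri_e1 R).
Notation e2 := (tri_e2 b H).
Notation e3 := (tri_e3 b H).
Notation l2 := (edge_length e2).
Notation l3 := (edge_length e3).

Lemma edge_length1 : edge_length e1 = 1.
Proof. by rewrite /edge_length /= !subr0 expr1n expr0n/= addr0 sqrtr1. Qed.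

Lemma edge_length2_gt0 : 0 < l2.
Proof. by rewrite sqrtr_gt0 /= !sub0r !sqrrN ltr_wpDl ?sqr_ge0// exprn_gt0. Qed.

Lemma edge_length3_gt0 : 0 < l3.
Proof. by rewrite sqrtr_gt0 /= subr0 ltr_wpDl ?sqr_ge0// exprn_gt0. Qed.

Lemma edge_length1_gt0 : 0 < edge_length e1. Proof. by rewrite edge_length1. Qed.

Definition regular_edge e := 0 < edge_length e /\ trace_bounded b H e.

Lemma regular_edge1 : regular_edge e1. Proof. exact: (conj edge_length1_gt0 (trace_bounded1 b H0)). Qed.
Lemma regular_edge2 : regular_edge e2. Proof. exact: (conj edge_length2_gt0 (trace_bounded2 b H0)). Qed.
Lemma regular_edge3 : regular_edge e3. Proof. exact: (conj edge_length3_gt0 (trace_bounded3 b H0)). Qed.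

Lemma edge_mean_lim e (f_ : nat -> R * R -> R) v : regular_edge e -> inH1 T v -> H1lim T f_ v ->
  edge_mean e (f_ n) @[n --> \oo] --> edge_integral T e v / edge_length e.
Proof.
move=> [l0 tb] Hv cf; have h := edge_integral_lim H0 l0 tb Hv cf.
rewrite (_ : (fun n => _) = (fun n => (edge_length e * edge_mean e (f_ n)) * (edge_length e)^-1)).
  by apply: cvgM => //; exact: cvg_cst.
by apply/funext => n; rewrite mulrAC mulfV ?mul1r// lt0r_neq0.
Qed.

(** The boundary formula for smooth functions passes to H1, as integrals of derivatives and edge
    means both converge under [H1lim]. *)
Lemma int_wpd v : inH1 T v ->
  \int[mu]_(x in T') wdx v x = H * (edge_integral T e3 v / l3 - edge_integral T e2 v / l2) /\
  \int[mu]_(x in T') wdy v x = (1 - b) * (edge_integral T e3 v / l3) +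
     b * (edge_integral T e2 v / l2) - edge_integral T e1 v.
Proof.
move=> Hv; have [f_ cf] := H1lim_exists H0 Hv.
have [sf c cx cy] := cf; have [lv lvx lvy] := inL2_inH1 Hv.
have m1 := edge_mean_lim regular_edge1 Hv cf.
rewrite edge_length1 divr1 in m1.
have m2 := edge_mean_lim regular_edge2 Hv cf; have m3 := edge_mean_lim regular_edge3 Hv cf.
have ix := int_lim H0 (fun n => let: And3 _ p _ := inL2_smooth b H0 (sf n) in p) lvx cx.
have iy := int_lim H0 (fun n => let: And3 _ _ p := inL2_smooth b H0 (sf n) in p) lvy cy.
have G k l n := int_tri_grad b H0 k l (sf n).
have Ex n : \int[mu]_(x in T') pdx (f_ n) x = H * (edge_mean e3 (f_ n) - edge_mean e2 (f_ n)).
  have := G 1 0 n; rewrite mul1r mul0r addr0 => <-; rewrite pdx.unlock.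
  by apply: eq_Rintegral => x _; rewrite mul1r mul0r addr0.
have Ey n : \int[mu]_(x in T') pdy (f_ n) x =
    (1 - b) * edge_mean e3 (f_ n) + b * edge_mean e2 (f_ n) - edge_mean e1 (f_ n).
  have := G 0 1 n; rewrite mul1r mul0r add0r => <-; rewrite pdy.unlock.
  by apply: eq_Rintegral => x _; rewrite mul1r mul0r add0r.
split.
- apply: (cvg_unique _ ix) => //.
  rewrite (_ : (fun n => _) = (fun n => H * (edge_mean e3 (f_ n) - edge_mean e2 (f_ n)))); last exact/funext.
  by apply: cvgM; [exact: cvg_cst|exact: cvgB].
- apply: (cvg_unique _ iy) => //.
  rewrite (_ : (fun n => _) = (fun n => (1 - b) * edge_mean e3 (f_ n) + b * edge_mean e2 (f_ n) - edge_mean e1 (f_ n))); last exact/funext.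
  by apply: cvgB => //; exact: cvg_lin2.
Qed.

Definition flux e (q1 q2 : R * R -> R) : R :=
  edge_integral T e (fun x => (edge_normal e).1 * q1 x + (edge_normal e).2 * q2 x).

Lemma fluxE e q1 q2 : regular_edge e -> inH1 T q1 -> inH1 T q2 ->
  flux e q1 q2 = (edge_normal e).1 * edge_integral T e q1 + (edge_normal e).2 * edge_integral T e q2.
Proof. by move=> [l0 tb] H1 H2; exact: edge_integral_lin. Qed.

Lemma divergence_H1 q1 q2 : inH1 T q1 -> inH1 T q2 ->
  \int[mu]_(x in T') wdx q1 x + \int[mu]_(x in T') wdy q2 x = flux e1 q1 q2 + flux e2 q1 q2 + flux e3 q1 q2.
Proof.
move=> h1 h2; have [-> _] := int_wpd h1; have [_ ->] := int_wpd h2.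
rewrite (fluxE regular_edge1 h1 h2) (fluxE regular_edge2 h1 h2) (fluxE regular_edge3 h1 h2).
rewrite /edge_normal edge_length1 /=.
have := edge_length2_gt0; have := edge_length3_gt0.
move: l2 l3 (edge_integral T e1 _) (edge_integral T e1 _) (edge_integral T e2 _) (edge_integral T e2 _) (edge_integral T e3 _) (edge_integral T e3 _).
move=> L2 L3 A1 A2 A3 A4 A5 A6 L30 L20.
by field; rewrite !lt0r_neq0.
Qed.

End flux.

(** * Real algebra of the interpolation estimate *)

Lemma cauchy2 (R : realType) (x1 x2 y1 y2 X Y : R) : `|X| <= x1 * x2 -> `|Y| <= y1 * y2 ->
  (X + Y) ^+ 2 <= (x1 ^+ 2 + y1 ^+ 2) * (x2 ^+ 2 + y2 ^+ 2).
Proof.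
move=> hX hY; apply: (@le_trans _ _ ((x1 * x2 + y1 * y2) ^+ 2)).
  rewrite -real_normK ?num_real//; have h := lerD hX hY.
  have h' := le_trans (ler_normD X Y) h.
  by rewrite lerXn2r// nnegrE; exact: le_trans h'.
rewrite -subr_ge0 (_ : _ - _ = (x1 * y2 - x2 * y1) ^+ 2); first exact: sqr_ge0.
by ring.
Qed.

(** Dictionary: n1, n2 are the norms of u_1, u_2 and W is their inner product; X1, X2 are the
    squared seminorms and Z is the inner product of the gradients; p_1 = - u_2 and p_2 = - s u_1 + c
    u_2 have norms P, Q and seminorms A, B. *)
Lemma fortin_algebra (R : realType) (s c C1 C2 lam x X1 X2 Z n1 n2 A B P Q W : R) :
  0 < s -> s ^+ 2 + c ^+ 2 = 1 -> 0 <= C1 -> 0 <= C2 -> 0 <= x ->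
  x ^+ 2 = C1 ^+ 2 + C2 ^+ 2 + 2 * C1 * C2 * (2 * c ^+ 2 - 1) ->
  2 * lam = C1 ^+ 2 + C2 ^+ 2 + 2 * C1 * C2 * c ^+ 2 + (C1 + C2) * x ->
  0 <= A -> 0 <= B -> 0 <= P -> 0 <= Q ->
  A ^+ 2 = X2 -> B ^+ 2 = s ^+ 2 * X1 + c ^+ 2 * X2 - 2 * s * c * Z -> Z ^+ 2 <= X1 * X2 ->
  `|W| <= n1 * n2 -> P ^+ 2 = n2 ^+ 2 ->
  Q ^+ 2 = s ^+ 2 * n1 ^+ 2 + c ^+ 2 * n2 ^+ 2 - 2 * s * c * W ->
  P <= C1 * A -> Q <= C2 * B ->
  s ^+ 2 * (n1 ^+ 2 + n2 ^+ 2) <= lam * (X1 + X2).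
Proof.
move=> s0 sc C10 C20 x0 xE lamE A0 B0 P0 Q0 A1 A2 Zc Wc P1 P2 hP hQ.
have s20 : 0 < s ^+ 2 by rewrite exprn_gt0.
have qf := quad_form_bound A B C10 C20 sc x0 xE lamE.
have c2E : c ^+ 2 = 1 - s ^+ 2 by lra.
have Wc2 : W ^+ 2 <= n1 ^+ 2 * n2 ^+ 2.
  by rewrite -exprMn -real_normK ?num_real// lerXn2r// nnegrE//; exact: le_trans Wc.
(* s y - c p ^ 2 is the inner product of p_1 and p_2, or of their gradients; one computation gives
   the identity and Cauchy-Schwarz in both cases. *)
have mix (a d p q y : R) : 0 <= p -> 0 <= q -> p ^+ 2 = d ->
    q ^+ 2 = s ^+ 2 * a + c ^+ 2 * d - 2 * s * c * y -> y ^+ 2 <= a * d ->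
    s ^+ 2 * (a + d) = p ^+ 2 + q ^+ 2 + 2 * c * (s * y - c * p ^+ 2) /\
    `|s * y - c * p ^+ 2| <= p * q.
  move=> p0 q0 pd qE yE; split; first by rewrite qE pd (_ : s ^+ 2 = 1 - c ^+ 2); [ring|lra].
  rewrite -(@ler_pXn2r _ 2)// ?nnegrE ?mulr_ge0// real_normK ?num_real// exprMn qE pd.
  rewrite -subr_ge0 (_ : _ - _ = s ^+ 2 * (a * d - y ^+ 2)); last by ring.
  by rewrite mulr_ge0 ?subr_ge0// ltW.
have [E1 h1] := mix _ _ _ _ _ P0 Q0 P1 P2 Wc2.
have [E2 h2] := mix _ _ _ _ _ A0 B0 A1 A2 Zc.
(* Neither c nor the inner products have a known sign; |c| covers the worst case, from above for the
   norms and from below for the gradients. *)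
have up : s ^+ 2 * (n1 ^+ 2 + n2 ^+ 2) <= P ^+ 2 + Q ^+ 2 + 2 * `|c| * (P * Q).
  rewrite E1 lerD2l; apply: (le_trans (ler_norm _)).
  by rewrite -!mulrA !normrM ger0_norm// ler_wpM2l// ler_wpM2l.
have lo : A ^+ 2 + B ^+ 2 - 2 * `|c| * (A * B) <= s ^+ 2 * (X1 + X2).
  rewrite E2 lerD2l -[leRHS]opprK lerN2; apply: (le_trans (ler_norm _)).
  by rewrite normrN -!mulrA !normrM ger0_norm// ler_wpM2l// ler_wpM2l.
have mid : P ^+ 2 + Q ^+ 2 + 2 * `|c| * (P * Q) <=
    C1 ^+ 2 * A ^+ 2 + C2 ^+ 2 * B ^+ 2 + 2 * `|c| * (C1 * C2 * A * B).
  have a1 : 0 <= C1 * A by rewrite mulr_ge0.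
  have a2 : 0 <= C2 * B by rewrite mulr_ge0.
  apply: lerD; first by apply: lerD; rewrite -exprMn lerXn2r// nnegrE.
  rewrite ler_wpM2l ?mulr_ge0//.
  by rewrite (_ : C1 * C2 * A * B = (C1 * A) * (C2 * B)) ?ler_pM//; ring.
have lam0 : 0 <= lam.
  have e0 : 0 <= C1 * C2 * c ^+ 2 by apply: mulr_ge0; [exact: mulr_ge0|exact: sqr_ge0].
  have e1 : 0 <= (C1 + C2) * x by rewrite mulr_ge0// addr_ge0.
  have := sqr_ge0 C1; have := sqr_ge0 C2; lra.
rewrite -(ler_pM2l s20); apply: (le_trans (ler_wpM2l (ltW s20) (le_trans up mid))).
apply: (le_trans qf); rewrite [leRHS]mulrCA; exact: ler_wpM2l.
Qed.

(** Splits the seminorms into the two partial derivatives. The coefficients 0, -1, - s, c of the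
    normals stay unsimplified so that the identities produced by [tnorm_lin_sqr] fit as they are. *)
Lemma fortin_algebra_gradient (R : realType)
    (s c C1 C2 lam x x1 x2 y1 y2 Zx Zy n1 n2 A ax ay B bx bY P Q W G1 G2 : R) :
  0 < s -> s ^+ 2 + c ^+ 2 = 1 -> 0 <= C1 -> 0 <= C2 -> 0 <= x ->
  x ^+ 2 = C1 ^+ 2 + C2 ^+ 2 + 2 * C1 * C2 * (2 * c ^+ 2 - 1) ->
  2 * lam = C1 ^+ 2 + C2 ^+ 2 + 2 * C1 * C2 * c ^+ 2 + (C1 + C2) * x ->
  0 <= A -> 0 <= B -> 0 <= P -> 0 <= Q ->
  A ^+ 2 = ax + ay -> B ^+ 2 = bx + bY ->
  ax = 0 ^+ 2 * x1 ^+ 2 + (-1) ^+ 2 * x2 ^+ 2 + 2 * 0 * -1 * Zx ->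
  ay = 0 ^+ 2 * y1 ^+ 2 + (-1) ^+ 2 * y2 ^+ 2 + 2 * 0 * -1 * Zy ->
  bx = (- s) ^+ 2 * x1 ^+ 2 + c ^+ 2 * x2 ^+ 2 + 2 * - s * c * Zx ->
  bY = (- s) ^+ 2 * y1 ^+ 2 + c ^+ 2 * y2 ^+ 2 + 2 * - s * c * Zy ->
  `|Zx| <= x1 * x2 -> `|Zy| <= y1 * y2 -> `|W| <= n1 * n2 ->
  P ^+ 2 = 0 ^+ 2 * n1 ^+ 2 + (-1) ^+ 2 * n2 ^+ 2 + 2 * 0 * -1 * W ->
  Q ^+ 2 = (- s) ^+ 2 * n1 ^+ 2 + c ^+ 2 * n2 ^+ 2 + 2 * - s * c * W ->
  P <= C1 * A -> Q <= C2 * B ->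
  G1 = x1 ^+ 2 + y1 ^+ 2 -> G2 = x2 ^+ 2 + y2 ^+ 2 ->
  s ^+ 2 * (n1 ^+ 2 + n2 ^+ 2) <= lam * (G1 + G2).
Proof.
move=> s0 sc C10 C20 x0 xE lamE A0 B0 P0 Q0 A2 B2 axE ayE bxE byE hX hY hW P2 Q2 hP hQ -> ->.
apply: (@fortin_algebra _ s c C1 C2 lam x (x1 ^+ 2 + y1 ^+ 2) (x2 ^+ 2 + y2 ^+ 2) (Zx + Zy) n1 n2 A B P Q W) => //.
- by rewrite A2 axE ayE; ring.
- by rewrite B2 bxE byE; ring.
- exact: cauchy2.
- by rewrite P2; ring.
- by rewrite Q2; ring.
Qed.

(** Here a is the slope of Pi q, n the norm of 1, and I1 to I4 are the integrals of the partial
    derivatives of u = Pi q - q; G1 + G2 and G3 + G4 are the squared seminorms of u and q. Since I1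
    + I4 is the integral of div u, their difference is exactly 2 a ^ 2 n ^ 2. *)
Lemma fortin_gradient_algebra (R : realType)
   (a n nx1 ny1 nx2 ny2 qx1 qy1 qx2 qy2 I1 I2 I3 I4 G1 G2 G3 G4 : R) :
  G1 = nx1 ^+ 2 + ny1 ^+ 2 -> G2 = nx2 ^+ 2 + ny2 ^+ 2 -> G3 = qx1 ^+ 2 + qy1 ^+ 2 ->
  G4 = qx2 ^+ 2 + qy2 ^+ 2 ->
  qx1 ^+ 2 = a ^+ 2 * n ^+ 2 + nx1 ^+ 2 - 2 * a * I1 ->
  qy1 ^+ 2 = 0 ^+ 2 * n ^+ 2 + ny1 ^+ 2 - 2 * 0 * I2 ->
  qx2 ^+ 2 = 0 ^+ 2 * n ^+ 2 + nx2 ^+ 2 - 2 * 0 * I3 ->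
  qy2 ^+ 2 = a ^+ 2 * n ^+ 2 + ny2 ^+ 2 - 2 * a * I4 ->
  I1 + I4 = 0 -> G1 + G2 <= G3 + G4.
Proof.
move=> -> -> -> -> -> -> -> -> div0.
have -> : I4 = - I1 by lra.
have a0 : 0 <= a ^+ 2 * n ^+ 2 by rewrite mulr_ge0// sqr_ge0.
rewrite -subr_ge0 (_ : _ - _ = 2 * (a ^+ 2 * n ^+ 2)); last by ring.
by rewrite mulr_ge0.
Qed.

(** * The edge constants and the error estimate *)

Section estimate.
Variable R : realType.
Notation M := (measurableTypeR R).
Notation mu := (@area R).
Implicit Types (f g u v w : R * R -> R) (x y p : R * R).

Variables (b H : R).
Hypothesis H0 : 0 < H.
Let Hn0 : H != 0. Proof. exact: lt0r_neq0. Qed.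

Notation T := (tri b H).
Notation T' := (T : set (M * M)).
Let mT : measurable T' := @measurable_tri R b H.
Notation nrm := (tnorm T).
Notation wdx := (wpdx T).
Notation wdy := (wpdy T).
Notation e1 := (tri_e1 R).
Notation e2 := (tri_e2 b H).
Notation e3 := (tri_e3 b H).
Notation regular_edge := (regular_edge b H).

Lemma H1semi_ge0 v : 0 <= H1semi T v. Proof. by rewrite H1semiE sqrtr_ge0. Qed.

Lemma H1semi_sqr v : H1semi T v ^+ 2 = nrm (wdx v) ^+ 2 + nrm (wdy v) ^+ 2.
Proof. by rewrite H1semiE sqr_sqrtr// addr_ge0// sqr_ge0. Qed.

Lemma L2norm_tnorm f : L2norm T f = nrm f. Proof. by rewrite tnorm.unlock. Qed.

Lemma tnorm_ae f g : inL2 T f -> inL2 T g -> ae_eq mu T' f g -> nrm f = nrm g.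
Proof. by move=> [mf _] [mg _]; rewrite tnorm.unlock; exact: ae_eq_l2norm. Qed.

Lemma tnorm_lin_sqr (k l : R) f g : inL2 T f -> inL2 T g ->
  nrm (fun x => k * f x + l * g x) ^+ 2 = k ^+ 2 * nrm f ^+ 2 + l ^+ 2 * nrm g ^+ 2 +
    2 * k * l * \int[mu]_(x in T') (f x * g x).
Proof.
move=> lf lg; rewrite !(tnorm_sqr _ _).
have ifg := sq_integrableM mT lf lg.
have i1 := lf.2; have i2 := lg.2.
have i3 := integrableDR mT (integrableZR mT (k ^+ 2) i1) (integrableZR mT (l ^+ 2) i2).
have := Rintegral_lin2 1 (2 * k * l) mT i3 ifg.
rewrite (Rintegral_lin2 (k ^+ 2) (l ^+ 2) mT i1 i2) mul1r => <-.
by apply: eq_Rintegral => x _; move: (f x) (g x) => A B; ring.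
Qed.

Lemma tnorm_cauchy f g : inL2 T f -> inL2 T g ->
  `|\int[mu]_(x in T') (f x * g x)| <= nrm f * nrm g.
Proof. by move=> lf lg; rewrite tnorm.unlock; exact: (cauchy_schwarz mT lf lg). Qed.

Lemma edge_const_has_sup e : regular_edge e ->
  has_ubound [set r | exists v, [/\ inH1 T v, ~ ae_eq mu T v (fun=> 0),
    edge_integral T e v = 0 & r = L2norm T v / H1semi T v]].
Proof.
move=> [l0 tb]; have [C C0 HC] := poincare_edge H0 l0 tb.
exists C => _ [v [Hv _ Ev ->]]; rewrite L2norm_tnorm.
have h := HC v Hv Ev; have s0 := H1semi_ge0 v.
(* Division by 0 gives 0, so a vanishing seminorm contributes only the quotient 0. *)
have [->|n0] := eqVneq (H1semi T v) 0; first by rewrite invr0 mulr0.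
by rewrite ler_pdivrMr// lt_neqAle eq_sym n0.
Qed.

Lemma edge_const_ge0 e : regular_edge e -> 0 <= edge_const T e.
Proof.
move=> ge; rewrite /edge_const; set S := [set r | _].
have [[r Sr]|S0] := pselect (S !=set0).
  apply: (@le_trans _ _ r); last exact: (ub_le_sup (edge_const_has_sup ge) Sr).
  by case: Sr => v [_ _ _ ->]; rewrite L2norm_tnorm divr_ge0 ?tnorm_ge0 ?H1semi_ge0.
(* The supremum of the empty set is 0 by convention. *)
by rewrite sup_out// => -[].
Qed.

Lemma edge_constP e v : regular_edge e -> inH1 T v -> edge_integral T e v = 0 ->
  nrm v <= edge_const T e * H1semi T v.
Proof.
move=> ge Hv Ev; have [lv _ _] := inL2_inH1 Hv.
have s0 := H1semi_ge0 v; have c0 := edge_const_ge0 ge.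
(* Functions equal to 0 almost everywhere are excluded from the supremum and are treated
   directly. *)
have [v0|vn0] := pselect (ae_eq mu T' v (fun=> 0)).
  have l0 : inL2 T (fun=> 0) by have [? _ _] := inL2_smooth b H0 (@smooth_cst R 0).
  rewrite (tnorm_ae lv l0 v0) (_ : nrm _ = 0) ?mulr_ge0//.
  apply/eqP; rewrite -sqrf_eq0 (tnorm_sqr _ _); apply/eqP.
  by rewrite expr0n/= /Rintegral integral0.
have [l0 tb] := ge; have [C C0 HC] := poincare_edge H0 l0 tb.
(* A vanishing seminorm forces the norm of v to be 0 by the Poincare inequality; otherwise the
   quotient belongs to the set of the supremum. *)
have [z|n0] := eqVneq (H1semi T v) 0.
  by have := HC v Hv Ev; rewrite z !mulr0.
have sp : 0 < H1semi T v by rewrite lt_neqAle eq_sym n0.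
rewrite -ler_pdivrMr// -L2norm_tnorm; apply: (ub_le_sup (edge_const_has_sup ge)).
by exists v.
Qed.

Definition affx (a k : R) (p : R * R) : R := a + k * p.1.
Definition affy (a k : R) (p : R * R) : R := a + k * p.2.

Lemma smooth_aff a k : smooth (affx a k) /\ smooth (affy a k).
Proof.
split.
  have := @smooth_affine R k 0 a; rewrite (_ : (fun q => _) = affx a k)//.
  by apply/funext => p; rewrite /affx mul0r addr0 addrC.
have := @smooth_affine R 0 k a; rewrite (_ : (fun q => _) = affy a k)//.
by apply/funext => p; rewrite /affy mul0r add0r addrC.
Qed.

Lemma pd_aff a k : [/\ pdx (affx a k) = fun=> k, pdy (affx a k) = fun=> 0,
  pdx (affy a k) = fun=> 0 & pdy (affy a k) = fun=> k].
Proof.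
have Ex : affx a k = fun q : R * R => k * q.1 + 0 * q.2 + a.
  by apply/funext => p; rewrite /affx mul0r addr0 addrC.
have Ey : affy a k = fun q : R * R => 0 * q.1 + k * q.2 + a.
  by apply/funext => p; rewrite /affy mul0r add0r addrC.
rewrite pdx.unlock pdy.unlock; split; apply/funext => x; rewrite ?Ex ?Ey.
- by case: (derive_affine k 0 a x).
- by case: (derive_affine k 0 a x).
- by case: (derive_affine 0 k a x).
- by case: (derive_affine 0 k a x).
Qed.

(** Meant for lowest-order Raviart-Thomas fields, whose normal component is constant along every
    line. *)
Lemma flux_cst e f1 f2 (k : R) : regular_edge e -> smooth f1 -> smooth f2 ->
  (forall t, (edge_normal e).1 * f1 (edge_point e t) + (edge_normal e).2 * f2 (edge_point e t) = k) ->
  flux b H e f1 f2 = edge_length e * k.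
Proof.
move=> [l0 tb] s1 s2 Hk; rewrite /flux (edge_integral_smooth H0 l0 tb); last first.
  by apply: smoothD; exact: smoothZ.
congr (_ * _); rewrite /edge_mean; under eq_Rintegral do rewrite Hk.
have E1 : fine (@lebesgue_measure R (`[0, 1]%classic : set M)) = 1 by rewrite leb01.
by rewrite Rintegral_cst// E1 mulr1.
Qed.

Lemma inH1_sub u v : inH1 T u -> inH1 T v ->
  [/\ inH1 T (fun x => u x - v x),
    ae_eq mu T' (wdx (fun x => u x - v x)) (fun x => 1 * wdx u x + (-1) * wdx v x) &
    ae_eq mu T' (wdy (fun x => u x - v x)) (fun x => 1 * wdy u x + (-1) * wdy v x)].
Proof.
move=> Hu Hv; have := inH1_lin H0 1 (-1) Hu Hv.
rewrite (_ : (fun x => 1 * u x + _) = (fun x => u x - v x)); last first.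
  by apply/funext => x; rewrite mul1r mulN1r.
by rewrite wpdx.unlock wpdy.unlock.
Qed.

Lemma edge_integral_sub e u v : regular_edge e -> inH1 T u -> inH1 T v ->
  edge_integral T e (fun x => u x - v x) = edge_integral T e u - edge_integral T e v.
Proof.
move=> [l0 tb] Hu Hv; have := edge_integral_lin H0 l0 tb 1 (-1) Hu Hv.
rewrite mul1r mulN1r => <-; congr edge_integral.
by apply/funext => x; rewrite mul1r mulN1r.
Qed.

Lemma flux_sub e u1 u2 v1 v2 : regular_edge e -> inH1 T u1 -> inH1 T u2 -> inH1 T v1 -> inH1 T v2 ->
  flux b H e (fun x => u1 x - v1 x) (fun x => u2 x - v2 x) = flux b H e u1 u2 - flux b H e v1 v2.
Proof.
move=> ge h1 h2 h3 h4.
have [s1 _ _] := inH1_sub h1 h3; have [s2 _ _] := inH1_sub h2 h4.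
rewrite !fluxE// !edge_integral_sub//.
move: (edge_integral _ _ _) (edge_integral _ _ _) (edge_integral _ _ _) (edge_integral _ _ _) => A B C D.
by ring.
Qed.

Lemma fortin_exists q1 q2 : inH1 T q1 -> inH1 T q2 -> exists a1 a2 a3 : R,
  let u1 := fun x => affx a1 a3 x - q1 x in let u2 := fun x => affy a2 a3 x - q2 x in
  [/\ flux b H e1 u1 u2 = 0, flux b H e2 u1 u2 = 0 & flux b H e3 u1 u2 = 0].
Proof.
move=> h1 h2.
pose F1 := flux b H e1 q1 q2; pose F2 := flux b H e2 q1 q2; pose F3 := flux b H e3 q1 q2.
(* The edges e1 and e2 contain O, so x . n = 0 on them: their fluxes - a2 and - H a1 + b a2
   determine a2 and a1. The total flux is the divergence 2 a3 times the area H / 2, which gives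
   a3. *)
pose a2 := - F1; pose a1 := (b * a2 - F2) / H; pose a3 := (F1 + F2 + F3) / H.
exists a1, a2, a3 => /=.
have [sx _] := smooth_aff a1 a3; have [_ sy] := smooth_aff a2 a3.
have Hx := inH1_smooth b H0 sx; have Hy := inH1_smooth b H0 sy.
have g1 := regular_edge1 b H0; have g2 := regular_edge2 b H0; have g3 := regular_edge3 b H0.
have L2 := edge_length2_gt0 b H0; have L3 := edge_length3_gt0 b H0.
have n2 := lt0r_neq0 L2; have n3 := lt0r_neq0 L3.
split; rewrite flux_sub//; apply/eqP; rewrite subr_eq0; apply/eqP.
- rewrite (flux_cst (k := F1) g1 sx sy) ?edge_length1 ?mul1r//.
  by move=> t; rewrite /edge_normal edge_length1 /edge_point /affx /affy /a2 /=; field.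
- rewrite (flux_cst (k := (- H * a1 + b * a2) / edge_length e2) g2 sx sy).
    by rewrite mulrC divfK// /a1 -/F2; field.
  move=> t; rewrite /edge_normal /edge_point /affx /affy /=; move: (edge_length _) n2 => L Ln; field => //.
- rewrite (flux_cst (k := (H * a1 + (1 - b) * a2 + a3 * H) / edge_length e3) g3 sx sy).
    by rewrite mulrC divfK// /a3 /a1 /a2 -/F3; field.
  move=> t; rewrite /edge_normal /edge_point /affx /affy /=; move: (edge_length _) n3 => L Ln; field => //.
Qed.

Lemma H1semi_fortin_le q1 q2 a1 a2 a3 : inH1 T q1 -> inH1 T q2 ->
  let u1 := fun x => affx a1 a3 x - q1 x in let u2 := fun x => affy a2 a3 x - q2 x in
  flux b H e1 u1 u2 = 0 -> flux b H e2 u1 u2 = 0 -> flux b H e3 u1 u2 = 0 ->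
  H1semi T u1 ^+ 2 + H1semi T u2 ^+ 2 <= H1semi T q1 ^+ 2 + H1semi T q2 ^+ 2.
Proof.
move=> h1 h2 u1 u2 F1 F2 F3.
have [sx _] := smooth_aff a1 a3; have [_ sy] := smooth_aff a2 a3.
have Hx := inH1_smooth b H0 sx; have Hy := inH1_smooth b H0 sy.
have [Hu1 _ _] := inH1_sub Hx h1; have [Hu2 _ _] := inH1_sub Hy h2.
have [_ ux1 uy1] := inH1_sub Hx Hu1; have [_ ux2 uy2] := inH1_sub Hy Hu2.
rewrite -/u1 -/u2 in ux1 uy1 ux2 uy2 Hu1 Hu2.
(* q is recovered as Pi q - u, so its gradient is a constant minus that of u; expanding the squares
   leaves integrals of derivatives of u as the only cross terms. *)
have Eq1 : (fun x => affx a1 a3 x - u1 x) = q1 by apply/funext => x; rewrite /u1 subKr.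
have Eq2 : (fun x => affy a2 a3 x - u2 x) = q2 by apply/funext => x; rewrite /u2 subKr.
rewrite Eq1 in ux1 uy1; rewrite Eq2 in ux2 uy2.
have div0 := divergence_H1 H0 Hu1 Hu2; rewrite F1 F2 F3 !addr0 in div0.
have [lu1 lu1x lu1y] := inL2_inH1 Hu1; have [lu2 lu2x lu2y] := inL2_inH1 Hu2.
have [lq1 lq1x lq1y] := inL2_inH1 h1; have [lq2 lq2x lq2y] := inL2_inH1 h2.
have wd_aff f c1 c2 : smooth f -> pdx f = (fun=> c1) -> pdy f = (fun=> c2) ->
    ae_eq mu T' (wdx f) (fun=> c1) /\ ae_eq mu T' (wdy f) (fun=> c2).
  move=> sf Ex Ey; have [wx wy] := is_weak_deriv_smooth b H0 sf.
  have [lf _ _] := inL2_smooth b H0 sf.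
  have [_ ax ay] := weak_deriv_aeE H0 lf wx wy.
  by rewrite -Ex -Ey wpdx.unlock wpdy.unlock pdx.unlock pdy.unlock.
have [Px Py _ _] := pd_aff a1 a3; have [_ _ Qx Qy] := pd_aff a2 a3.
have [wxx wxy] := wd_aff _ _ _ sx Px Py; have [wyx wyy] := wd_aff _ _ _ sy Qx Qy.
have l1 (c : R) : inL2 T (fun=> c) by have [? _ _] := inL2_smooth b H0 (@smooth_cst R c).
have step (c : R) f w g : inL2 T f -> inL2 T w -> ae_eq mu T' w (fun=> c) -> inL2 T g ->
    ae_eq mu T' g (fun x => 1 * w x + (-1) * f x) ->
    nrm g ^+ 2 = c ^+ 2 * nrm (fun=> 1) ^+ 2 + nrm f ^+ 2 - 2 * c * \int[mu]_(x in T') f x.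
  move=> lf lw wc lg ge.
  have lL : inL2 T (fun x => c * 1 + (-1) * f x).
    by apply: (sq_integrableD mT); apply: (sq_integrableZ mT) => //; exact: l1.
  have E : ae_eq mu T' g (fun x => c * 1 + (-1) * f x).
    apply: filterS2 wc ge => x h3 h4 Tx; rewrite (h4 Tx) (h3 Tx); ring.
  rewrite (tnorm_ae lg lL E) tnorm_lin_sqr//.
  under eq_Rintegral do rewrite mul1r.
  by rewrite sqrrN expr1n mul1r mulrN mulr1 mulNr.
have [_ lxx lxy] := inL2_inH1 Hx; have [_ lyx lyy] := inL2_inH1 Hy.
exact: (fortin_gradient_algebra (H1semi_sqr u1) (H1semi_sqr u2) (H1semi_sqr q1) (H1semi_sqr q2)
  (step _ _ _ _ lu1x lxx wxx lq1x ux1) (step _ _ _ _ lu1y lxy wxy lq1y uy1)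
  (step _ _ _ _ lu2x lyx wyx lq2x ux2) (step _ _ _ _ lu2y lyy wyy lq2y uy2) div0).
Qed.

Lemma tnorm_ae_lin_sqr (k l : R) w f g : inL2 T w -> inL2 T f -> inL2 T g ->
  ae_eq mu T' w (fun x => k * f x + l * g x) ->
  nrm w ^+ 2 = k ^+ 2 * nrm f ^+ 2 + l ^+ 2 * nrm g ^+ 2 +
    2 * k * l * \int[mu]_(x in T') (f x * g x).
Proof.
move=> lw lf lg E; rewrite (tnorm_ae lw _ E) ?tnorm_lin_sqr//.
by apply: (sq_integrableD mT); exact: sq_integrableZ.
Qed.

Lemma inH1_lin_sealed (k l : R) u v : inH1 T u -> inH1 T v ->
  [/\ inH1 T (fun x => k * u x + l * v x),
    ae_eq mu T' (wdx (fun x => k * u x + l * v x)) (fun x => k * wdx u x + l * wdx v x) &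
    ae_eq mu T' (wdy (fun x => k * u x + l * v x)) (fun x => k * wdy u x + l * wdy v x)].
Proof. by move=> Hu Hv; have := inH1_lin H0 k l Hu Hv; rewrite wpdx.unlock wpdy.unlock. Qed.

Lemma fortin_estimate (s c al C1 C2 lam x : R) u1 u2 :
  0 < s -> 0 < al -> s ^+ 2 + c ^+ 2 = 1 -> b = al * c -> H = al * s ->
  C1 = edge_const T e1 -> C2 = edge_const T e2 -> 0 <= x ->
  x ^+ 2 = C1 ^+ 2 + C2 ^+ 2 + 2 * C1 * C2 * (2 * c ^+ 2 - 1) ->
  2 * lam = C1 ^+ 2 + C2 ^+ 2 + 2 * C1 * C2 * c ^+ 2 + (C1 + C2) * x ->
  inH1 T u1 -> inH1 T u2 ->
  flux b H e1 u1 u2 = 0 -> flux b H e2 u1 u2 = 0 ->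
  s ^+ 2 * (nrm u1 ^+ 2 + nrm u2 ^+ 2) <= lam * (H1semi T u1 ^+ 2 + H1semi T u2 ^+ 2).
Proof.
move=> s0 al0 sc Eb EH EC1 EC2 x0 xE lamE h1 h2 F1 F2.
have g1 := regular_edge1 b H0; have g2 := regular_edge2 b H0.
have l2E : edge_length e2 = al.
  rewrite /edge_length /= !sub0r !sqrrN Eb EH !exprMn -mulrDr addrC sc mulr1.
  by rewrite sqrtr_sqr gtr0_norm.
have N1 : edge_normal e1 = (0, -1).
  by rewrite /edge_normal edge_length1 /= !divr1 subrr subr0.
have aln := lt0r_neq0 al0.
have N2 : edge_normal e2 = (- s, c).
  by rewrite /edge_normal l2E /= Eb EH; congr pair; field.
rewrite /flux N1 /= in F1; rewrite /flux N2 /= in F2.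
set p1 := (fun x => _) in F1; set p2 := (fun x => _) in F2.
have [Hp1 px1 py1] := inH1_lin_sealed 0 (-1) h1 h2.
have [Hp2 px2 py2] := inH1_lin_sealed (- s) c h1 h2.
rewrite -/p1 in Hp1 px1 py1; rewrite -/p2 in Hp2 px2 py2.
have B1 := edge_constP g1 Hp1 F1; have B2 := edge_constP g2 Hp2 F2.
rewrite -EC1 in B1; rewrite -EC2 in B2.
have C10 : 0 <= C1 by rewrite EC1 edge_const_ge0.
have C20 : 0 <= C2 by rewrite EC2 edge_const_ge0.
have [lu1 lu1x lu1y] := inL2_inH1 h1; have [lu2 lu2x lu2y] := inL2_inH1 h2.
have [lp1 lp1x lp1y] := inL2_inH1 Hp1; have [lp2 lp2x lp2y] := inL2_inH1 Hp2.
exact: (fortin_algebra_gradient s0 sc C10 C20 x0 xE lamE (H1semi_ge0 p1) (H1semi_ge0 p2)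
  (tnorm_ge0 T p1) (tnorm_ge0 T p2) (H1semi_sqr p1) (H1semi_sqr p2)
  (tnorm_ae_lin_sqr lp1x lu1x lu2x px1) (tnorm_ae_lin_sqr lp1y lu1y lu2y py1)
  (tnorm_ae_lin_sqr lp2x lu1x lu2x px2) (tnorm_ae_lin_sqr lp2y lu1y lu2y py2)
  (tnorm_cauchy lu1x lu2x) (tnorm_cauchy lu1y lu2y) (tnorm_cauchy lu1 lu2)
  (tnorm_lin_sqr 0 (-1) lu1 lu2) (tnorm_lin_sqr (- s) c lu1 lu2) B1 B2 (H1semi_sqr u1) (H1semi_sqr u2)).
Qed.

End estimate.

(** * From the model triangle to the statement *)

Lemma tnormC (R : realType) (U : set (R * R)) f g :
  tnorm U (fun x => f x - g x) = tnorm U (fun x => g x - f x).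
Proof. by rewrite tnorm.unlock l2normC. Qed.

Lemma sqrt_quotient_le (R : realType) (s N G L : R) : 0 < s -> 0 <= L ->
  s ^+ 2 * N <= L / 2 * G -> Num.sqrt N <= Num.sqrt L / (Num.sqrt 2 * s) * Num.sqrt G.
Proof.
move=> s0 L0 h.
have e : Num.sqrt L / (Num.sqrt 2 * s) * Num.sqrt G = Num.sqrt (L / 2 * G) / s.
  rewrite sqrtrM ?divr_ge0// sqrtrM// sqrtrV// invfM; ring.
rewrite e ler_pdivlMr// -[X in _ * X](gtr0_norm s0) -sqrtr_sqr mulrC.
by rewrite -sqrtrM ?sqr_ge0// ler_wsqrtr.
Qed.

(** The weights s and t of the convex combination are the coordinates of the inverse chart. *)
Lemma triangleE (R : realType) (alpha theta : R) : 0 < alpha * sin theta ->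
  triangle alpha theta = tri (alpha * cos theta) (alpha * sin theta).
Proof.
move=> H0; have Hn0 := lt0r_neq0 H0; rewrite /triangle /tri /reftri /vtxA /vtxB /=.
move: (alpha * cos theta) (alpha * sin theta) H0 Hn0 => b H H0 Hn0.
apply/seteqP; split => x /=.
  move=> [s [t [s0 t0 st ->]]] /=.
  rewrite (_ : _ - _ = s); last by field.
  by rewrite (_ : _ / H = t); last by field.
case=> h1 h2 h3; exists (x.1 - b / H * x.2), (x.2 / H); split => //.
by rewrite [LHS]surjective_pairing; congr pair; field.
Qed.

Theorem theorem2p2 (R : realType) (alpha theta : R)
    (halpha : 0 < alpha <= 1) (htheta : acos (alpha / 2) <= theta < pi)
    (q : R * R -> R * R) (hq : inH1v (triangle alpha theta) q) :
  L2normv (triangle alpha theta) (fun x => q x - fortin alpha theta q x)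
  <= C6 alpha theta * H1semiv (triangle alpha theta) q.
Proof.
have [al0 al1] := andP halpha; have [th1 th2] := andP htheta.
(* As alpha / 2 < 1, its arc cosine is positive; together with theta < pi this makes sin theta
   positive and the triangle nondegenerate. *)
have th0 : 0 < theta by apply: lt_le_trans th1; apply: acos_gt0; lra.
have s0 : 0 < sin theta by apply: sin_gt0_pi; rewrite th0.
have H0 : 0 < alpha * sin theta by rewrite mulr_gt0.
set c := cos theta; set s := sin theta in s0 H0 *.
have sc : s ^+ 2 + c ^+ 2 = 1 by rewrite addrC cos2Dsin2.
have TE := triangleE H0; rewrite -/c -/s in TE.
pose b := alpha * c; pose H := alpha * s; rewrite -/b -/H in TE H0.
have [h1 h2] := hq; rewrite TE in h1 h2.
have same_fluxE e (a1 a2 a3 : R) :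
    same_flux (tri b H) e (fun x => (a1 + a3 * x.1, a2 + a3 * x.2)) q =
    (flux b H e (fun x => affx a1 a3 x - (fst \o q) x) (fun x => affy a2 a3 x - (snd \o q) x) = 0).
  rewrite /same_flux /flux; congr (edge_integral _ _ _ = 0).
  by apply/funext => x; rewrite /dot mulrC [X in _ + X]mulrC.
(* Existence makes the choice in [fortin] meaningful; the chosen field then enters the estimate
   through its affine form and its three fluxes. *)
have ex : exists qh, is_fortin alpha theta q qh.
  have [a1 [a2 [a3 [F1 F2 F3]]]] := fortin_exists H0 h1 h2.
  exists (fun x => (a1 + a3 * x.1, a2 + a3 * x.2)); rewrite /is_fortin TE.
  split; first (by exists a1, a2, a3); by rewrite same_fluxE.
have : is_fortin alpha theta q (fortin alpha theta q).
  exact: (@xgetPex _ (fun=> (0, 0)) [set qh | is_fortin alpha theta q qh] ex).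
rewrite /is_fortin TE => -[[a1 [a2 [a3 Eqh]]] F1 F2 F3].
move: F1 F2 F3; rewrite Eqh !same_fluxE => F1 F2 F3.
have [sx _] := smooth_aff a1 a3; have [_ sy] := smooth_aff a2 a3.
have [Hu1 _ _] := inH1_sub H0 (inH1_smooth b H0 sx) h1.
have [Hu2 _ _] := inH1_sub H0 (inH1_smooth b H0 sy) h2.
set u1 := (fun x => _ - (fst \o q) x) in F1 F2 F3 Hu1.
set u2 := (fun x => _ - (snd \o q) x) in F1 F2 F3 Hu2.
pose c1 := edge_const (tri b H) (tri_e1 R); pose c2 := edge_const (tri b H) (tri_e2 b H).
have c10 : 0 <= c1 by exact: edge_const_ge0 H0 _ (regular_edge1 b H0).
have c20 : 0 <= c2 by exact: edge_const_ge0 H0 _ (regular_edge2 b H0).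
pose d := c1 ^+ 2 + c2 ^+ 2 + 2 * c1 * c2 * (2 * c ^+ 2 - 1).
(* The inner root of C_6 has a nonnegative argument, so squaring it recovers d. *)
have d0 : 0 <= d.
  rewrite (_ : d = (c1 - c2) ^+ 2 + 4 * (c1 * c2 * c ^+ 2)); last by rewrite /d; ring.
  by rewrite addr_ge0 ?sqr_ge0// mulr_ge0// mulr_ge0 ?sqr_ge0// mulr_ge0.
pose L := c1 ^+ 2 + c2 ^+ 2 + 2 * c1 * c2 * c ^+ 2 + (c1 + c2) * Num.sqrt d.
have L0 : 0 <= L.
  apply: addr_ge0; last by rewrite mulr_ge0 ?addr_ge0 ?sqrtr_ge0.
  by rewrite !addr_ge0 ?sqr_ge0// mulr_ge0 ?sqr_ge0// !mulr_ge0.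
have C6E : C6 alpha theta = Num.sqrt L / (Num.sqrt 2 * s).
  rewrite /C6 /L /d /C1 /C2 TE.
  have -> : cos (2 * theta) = 2 * c ^+ 2 - 1 by rewrite mulr_natl cos_mulr2n -mulr_natl.
  by [].
(* L stands under the outer root of C_6 and L / 2 is the parameter [lam]; the factor sqrt 2 in the
   denominator of C_6 accounts for the half. *)
have est := fortin_estimate (lam := L / 2) H0 s0 al0 sc erefl erefl erefl erefl (sqrtr_ge0 d)
  (sqr_sqrtr d0) _ Hu1 Hu2 F1 F2.
have L2E : 2 * (L / 2) = L by rewrite mulrC divfK.
have {}est := est L2E; rewrite -/b -/H in est.
have sub := H1semi_fortin_le H0 h1 h2 F1 F2 F3.
have lamL : 0 <= L / 2 by rewrite divr_ge0.
have {sub}est := le_trans est (ler_wpM2l lamL sub).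
have NE1 : L2norm (tri b H) (fst \o (fun x => q x - (a1 + a3 * x.1, a2 + a3 * x.2))) = tnorm (tri b H) u1.
  by rewrite L2norm_tnorm tnormC.
have NE2 : L2norm (tri b H) (snd \o (fun x => q x - (a1 + a3 * x.1, a2 + a3 * x.2))) = tnorm (tri b H) u2.
  by rewrite L2norm_tnorm tnormC.
rewrite C6E /L2normv /H1semiv NE1 NE2.
exact: sqrt_quotient_le.
Qed.
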